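(* Let $E$ be a solid TIBF of bounded type on $\mathbb{R}^d$ and let $\mathcal{W}=(w_n)_{n\in\mathbb{N}}$ be a weight function system on $\mathbb{R}^d$ satisfying $(\mathrm{wM})$: for every $n\in\mathbb{N}$ there exist $m\ge n$ and $C>0$ such that $w_n(x+y)\le C w_m(x)$ for all $x\in\mathbb{R}^d$ and $|y|\le1$. Suppose $(\chi^0,\chi^1)\in\mathcal{D}\times\mathcal{D}$ has the moment-wise decomposition factorization property (MDFP). Then for any $f\in\mathcal{D}'$ the following conditions are equivalent: (i) $f\in E^\infty_{\mathcal{W}}$; (ii) for every $\phi\in\mathcal{D}$, the set $\{f*\phi_j : j\in\mathbb{N}\}$ is bounded in $E^\infty_{\mathcal{W}}$; (iii) for every $\phi\in\mathcal{D}$ there exists $r>0$ such that the set $\{2^{-rj}(f*\phi_j): j\in\mathbb{N}\}$ is bounded in $E^\infty_{\mathcal{W}}$; (iv) there exists $r>0$ such that the set $\{2^{-rj}(f*\chi^\ell_j): j\in\mathbb{N},\ \ell=0,1\}$ is bounded in $E^\infty_{\mathcal{W}}$.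
   Context: $\mathbb{N}=\{0,1,2,\dots\}$; $\mathcal{D}$ is the space of compactly supported smooth functions on $\mathbb{R}^d$, $\mathcal{D}'$ the space of distributions; $T_xf(t)=f(t-x)$. For $\phi\in\mathcal{D}$ and $j\in\mathbb{N}$, $\phi_j:=2^{jd}\phi(2^j\,\cdot\,)$ (and $\chi^\ell_j=2^{jd}\chi^\ell(2^j\,\cdot\,)$). Solid TIBF of bounded type: a Banach space $(E,\|\cdot\|_E)$ is a translation-invariant Banach function space (TIBF) of bounded type on $\mathbb{R}^d$ if $E$ is non-trivial, $E\subseteq L^1_{\mathrm{loc}}(\mathbb{R}^d)$ continuously, and: (A.1) $T_xE\subseteq E$ for all $x\in\mathbb{R}^d$; (A.2) there is $C_0>0$ with $\|T_xf\|_E\le C_0\|f\|_E$ for all $x\in\mathbb{R}^d$, $f\in E$; (A.3) $E$ is a Banach module over $L^1(\mathbb{R}^d)$ under convolution ($\|f*\varphi\|_E\le\|f\|_E\|\varphi\|_{L^1}$). It is solid if $f\in E$, $g\in L^1_{\mathrm{loc}}(\mathbb{R}^d)$ and $|g|\le|f|$ a.e. imply $g\in E$ and $\|g\|_E\le\|f\|_E$. A weight function is a locally bounded measurable function $\mathbb{R}^d\to[1,\infty)$; a weight function system is a sequence $\mathcal{W}=(w_n)_{n\in\mathbb{N}}$ of weight functions with $w_n\le w_{n+1}$ for all $n$. For a weight function $\omega$ and $n\in\mathbb{N}$, $E^n_\omega:=\{f\in\mathcal{D}': f^{(\alpha)}\omega\in E\text{ for all }|\alpha|\le n\}$ (the distributional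 derivatives $f^{(\alpha)}$ being in $L^1_{\mathrm{loc}}$), with norm $\max_{|\alpha|\le n}\|f^{(\alpha)}\omega\|_E$; $E^\infty_{\mathcal{W}}:=\bigcap_{n\in\mathbb{N}}E^n_{w_n}$ with its projective limit Fréchet topology (a set is bounded iff it is bounded in each norm $\|\cdot\|_{E^n_{w_n}}$). MDFP: for compact $K\subset\mathbb{R}^d$, $\mathcal{D}(K)$ is the space of smooth functions supported in $K$, and for $L\in\mathbb{N}$, $\mathcal{D}_L(K):=\{\varphi\in\mathcal{D}(K):\int x^\alpha\varphi(x)\,dx=0\text{ for all }|\alpha|<L\}$. A pair $(\chi^0,\chi^1)\in\mathcal{D}\times\mathcal{D}$ has the MDFP if for some compact $K\subset\mathbb{R}^d$ there exist non-trivial functions $(\varphi^\ell_L,\psi^\ell_L)\in\mathcal{D}(K)\times\mathcal{D}_L(K)$, $\ell\in\{0,1\}$, $L\in\mathbb{N}$, such that for every $L$: $2^d\varphi^0_L(2\,\cdot\,)-\varphi^0_L=\Delta\psi^0_L$; $\int\varphi^0_L(x)\,dx=1$; $\varphi^0_L=\chi^0*\varphi^0_L+\chi^1*\varphi^1_L$ and $\psi^0_L=\chi^0*\psi^0_L+\chi^1*\psi^1_L$. *)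

(* Defs.v *)
From HB Require Import structures.
From mathcomp Require Import all_boot all_order all_algebra.
From mathcomp Require Import all_classical all_reals all_analysis.
From mathcomp Require Import complex.

Set Implicit Arguments.
Unset Strict Implicit.
Unset Printing Implicit Defensive.

Import Order.TTheory GRing.Theory Num.Theory.
Import numFieldNormedType.Exports.

Local Open Scope classical_set_scope.
Local Open Scope ring_scope.
Local Open Scope complex_scope.

(* The product sigma-algebra on T^n; for T = R it is the Borel sigma-algebra. *)
Definition measure_rV_display : measure_display -> measure_display.
Proof. exact. Qed.

Section measurable_rV.
Context {disp : measure_display} {T : sigmaRingType disp} (n : nat).

Let coors : 'I_n -> 'rV[T]_n -> T := fun i x => x ord0 i.

Let rV_set0 : g_sigma_preimage coors set0.
Proof. exact: sigma_algebra0. Qed.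

Let rV_setC A : g_sigma_preimage coors A -> g_sigma_preimage coors (~` A).
Proof. exact: sigma_algebraC. Qed.

Let rV_bigcup (F : (set 'rV[T]_n)^nat) :
  (forall i, g_sigma_preimage coors (F i)) ->
  g_sigma_preimage coors (\bigcup_i (F i)).
Proof. exact: sigma_algebra_bigcup. Qed.

HB.instance Definition _ := @isMeasurable.Build (measure_rV_display disp)
  'rV[T]_n (g_sigma_preimage coors) rV_set0 rV_setC rV_bigcup.

End measurable_rV.

Section measurable_rV_lemmas.
Context {disp disp' : measure_display} {T : measurableType disp}
  {U : measurableType disp'} {n : nat}.

Lemma measurable_rV_coord (i : 'I_n) :
  measurable_fun [set: 'rV[T]_n] (fun x => x ord0 i).
Proof.
move=> _ Y mY; rewrite setTI; apply: sub_sigma_algebra => /=.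
rewrite -bigcup_seq/=; exists i => /=; first by rewrite mem_index_enum.
by exists Y => //; rewrite setTI.
Qed.

Lemma measurable_fun_rV (f : U -> 'rV[T]_n) :
  (forall i, measurable_fun setT (fun u => f u ord0 i)) ->
  measurable_fun setT f.
Proof.
move=> mf; pose D := [set A | measurable (f @^-1` A)].
suff sD : measurable `<=` D by move=> _ A mA; rewrite setTI; exact: sD.
apply: smallest_sub.
  split=> [|A|F] /=; rewrite /D /=.
  - by rewrite preimage_set0.
  - by rewrite setTD preimage_setC => ?; exact: measurableC.
  - by rewrite preimage_bigcup => ?; exact: bigcupT_measurable.
move=> A; rewrite -bigcup_seq => -[i _ [B mB <-]].
by have := mf i measurableT B mB; rewrite /D /= !setTI.
Qed.

Definition rV_cons (p : T * 'rV[T]_n) : 'rV[T]_n.+1 :=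
  \row_i if unlift ord0 i is Some j then p.2 ord0 j else p.1.

Definition rV_uncons (x : 'rV[T]_n.+1) : T * 'rV[T]_n :=
  (x ord0 ord0, \row_j x ord0 (lift ord0 j)).

Lemma rV_consK : cancel rV_cons rV_uncons.
Proof.
case=> a v; rewrite /rV_uncons mxE unlift_none; congr pair.
by apply/rowP => j; rewrite !mxE liftK.
Qed.

End measurable_rV_lemmas.

Section measurable_rV_cons.
Context {disp : measure_display} {T : measurableType disp} {n : nat}.

Lemma measurable_rV_cons :
  measurable_fun setT (rV_cons : T * 'rV[T]_n -> 'rV[T]_n.+1).
Proof.
apply: measurable_fun_rV => i; case: (unliftP ord0 i) => [j ->|->].
- rewrite (_ : (fun _ => _) = (fun x : 'rV[T]_n => x ord0 j) \o snd).
    by apply: measurableT_comp => //; exact: measurable_rV_coord.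
  by apply/funext => p /=; rewrite mxE liftK.
- rewrite (_ : (fun _ => _) = fst) //.
  by apply/funext => p /=; rewrite mxE unlift_none.
Qed.

Lemma measurable_rV_uncons :
  measurable_fun setT (rV_uncons : 'rV[T]_n.+1 -> T * 'rV[T]_n).
Proof.
apply: measurable_fun_pair; first exact: measurable_rV_coord.
apply: measurable_fun_rV => i.
rewrite (_ : (fun _ => _) = (fun x : 'rV[T]_n.+1 => x ord0 (lift ord0 i))).
  exact: measurable_rV_coord.
by apply/funext => x; rewrite mxE.
Qed.

End measurable_rV_cons.

Section lebesgue_rV.
Context {R : realType}.
Local Open Scope ereal_scope.

Section step.
Variables (n : nat) (m : {sigma_finite_measure set 'rV[R]_n -> \bar R}).

Let prodm : {measure set (measurableTypeR R * 'rV[R]_n)%type -> \bar R} :=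
  (lebesgue_measure \x m)%E.

Let mcons : measurable_fun [set: (measurableTypeR R * 'rV[R]_n)%type]
  (rV_cons : _ -> 'rV[R]_n.+1) := @measurable_rV_cons _ R n.

Let muncons : measurable_fun setT
  (rV_uncons : 'rV[R]_n.+1 -> (measurableTypeR R * 'rV[R]_n)%type) :=
  @measurable_rV_uncons _ R n.

Definition rV_step : set 'rV[R]_n.+1 -> \bar R := pushforward prodm rV_cons.

Let rV_step0 : rV_step set0 = 0.
Proof. by rewrite /rV_step /pushforward preimage_set0 measure0. Qed.

Let rV_step_ge0 A : 0 <= rV_step A.
Proof. exact: (measure_ge0 prodm). Qed.

Let rV_step_sigma_additive : semi_sigma_additive rV_step.
Proof.
move=> F mF tF mUF; rewrite /rV_step /pushforward preimage_bigcup.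
apply: measure_semi_sigma_additive.
- by move=> k; rewrite -[X in measurable X]setTI; exact: mcons.
- apply/trivIsetP => /= i j _ _ ij; rewrite -preimage_setI.
  by move/trivIsetP : tF => /(_ _ _ _ _ ij) ->//; rewrite preimage_set0.
- rewrite -preimage_bigcup -[X in measurable X]setTI.
  exact: mcons.
Qed.

HB.instance Definition _ := isMeasure.Build _ _ _ rV_step
  rV_step0 rV_step_ge0 rV_step_sigma_additive.

Let rV_step_sigma_finite : sigma_finite setT rV_step.
Proof.
have /sigma_finiteP[F [TF ndF Foo]] := sigma_finiteT (@lebesgue_measure R).
have /sigma_finiteP[G [TG ndG Goo]] := sigma_finiteT m.
exists (fun k => rV_uncons @^-1` (F k `*` G k)).
  rewrite -preimage_bigcup -[LHS](preimage_setT rV_uncons); congr (_ @^-1` _).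
  rewrite -setXTT TF TG predeqE => -[x y]; split.
    move=> [/= [k _ Fkx] [l _ Gly]]; exists (maxn k l) => //; split.
    - by move: x Fkx; exact/subsetPset/ndF/leq_maxl.
    - by move: y Gly; exact/subsetPset/ndG/leq_maxr.
  by move=> [k _ []/= ? ?]; split; exists k.
move=> k; have [mF Fk] := Foo k; have [mG Gk] := Goo k; split.
  rewrite -[X in measurable X]setTI; apply: muncons => //.
  exact: measurableX.
rewrite /rV_step /pushforward -comp_preimage.
rewrite (_ : rV_uncons \o rV_cons = id); last first.
  by apply/funext => p /=; rewrite rV_consK.
by rewrite /= product_measure1E// lte_mul_pinfty// ge0_fin_numE.
Qed.

HB.instance Definition _ := Measure_isSigmaFinite.Build _ _ _ rV_step
  rV_step_sigma_finite.

End step.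

Fixpoint lebesgue_rV (n : nat) : {sigma_finite_measure set 'rV[R]_n -> \bar R} :=
  if n is n'.+1 then rV_step (lebesgue_rV n') else \d_(0 : 'rV[R]_0)%R.

End lebesgue_rV.

Section functions.
Context {R : realType} {d : nat}.
Local Notation Rd := 'rV[R]_d.
Local Notation C := R[i].
Local Notation mu := (@lebesgue_rV R d).
Local Notation Re := (@complex.Re R).
Local Notation Im := (@complex.Im R).
Local Notation normc := (@Normc.normc R).

Implicit Types (f g phi psi : Rd -> C) (K : set Rd) (alpha : {ffun 'I_d -> nat}).

Definition translate (x : Rd) f : Rd -> C := fun t => f (t - x).

(* [dilate phi j] is phi_j = 2^{jd} phi(2^j .). *)
Definition dilate phi (j : nat) : Rd -> C :=
  fun x => 2 ^+ (j * d) * phi ((2 : R) ^+ j *: x).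

(* The Euclidean norm; the norm of the library on row vectors is the sup norm. *)
Definition norm2 (x : Rd) : R := Num.sqrt (\sum_i x ord0 i ^+ 2).

Definition cmeasurable f :=
  measurable_fun setT (fun x => Re (f x)) /\
  measurable_fun setT (fun x => Im (f x)).

Definition cintegrable f :=
  mu.-integrable setT (fun x => (Re (f x))%:E) /\
  mu.-integrable setT (fun x => (Im (f x))%:E).

Definition cintegral f : C :=
  (\int[mu]_x Re (f x)) +i* (\int[mu]_x Im (f x)).

Definition L1norm f : R := \int[mu]_x normc (f x).

Definition L1loc f :=
  cmeasurable f /\
  forall K, compact K -> (\int[mu]_(x in K) (normc (f x))%:E < +oo)%E.

Definition conv f g : Rd -> C := fun x => cintegral (fun t => f (x - t) * g t).

Definition mdeg alpha : nat := (\sum_i alpha i)%N.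

Definition monomial alpha (x : Rd) : C := (\prod_i x ord0 i ^+ alpha i)%:C.

Definition partial (i : 'I_d) (u : Rd -> R) : Rd -> R :=
  fun x => 'D_(delta_mx ord0 i) u x.

(* The iterated partial derivative along a word of directions. *)
Definition partials (s : seq 'I_d) (u : Rd -> R) : Rd -> R := foldr partial u s.

(* Continuity has to be required: for d > 1 the existence of all iterated
   partial derivatives does not imply it. *)
Definition smooth_fun (u : Rd -> R) :=
  forall s : seq 'I_d, continuous (partials s u) /\
    forall i x, derivable (partials s u) x (delta_mx ord0 i).

Definition cpartials (s : seq 'I_d) f : Rd -> C := fun x =>
  partials s (fun y => Re (f y)) x +i* partials s (fun y => Im (f y)) x.

Definition cderiv alpha f : Rd -> C :=
  cpartials (flatten [seq nseq (alpha i) i | i <- enum 'I_d]) f.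

Definition laplacian f : Rd -> C := fun x => \sum_(i < d) cpartials [:: i; i] f x.

Definition csmooth f :=
  smooth_fun (fun x => Re (f x)) /\ smooth_fun (fun x => Im (f x)).

(* [test_on K] is D(K), and [test_fun] is D. *)
Definition test_on K f := csmooth f /\ forall x, ~ K x -> f x = 0.

Definition test_fun f := exists K, compact K /\ test_on K f.

(* [test_on_mom L K] is D_L(K). *)
Definition test_on_mom (L : nat) K f :=
  test_on K f /\
  forall alpha, (mdeg alpha < L)%N ->
    cintegral (fun x => monomial alpha x * f x) = 0.

(* The seminorm sup_{|alpha| <= N, x} |f^(alpha)(x)| on D(K). *)
Definition test_norm (N : nat) f : R :=
  sup [set r | exists alpha x, (mdeg alpha <= N)%N /\ r = normc (cderiv alpha f x)].

(* A distribution is encoded as a functional on all functions of which only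
   the restriction to D is relevant. *)
Definition functional := (Rd -> C) -> C.

Implicit Types T S : functional.

Definition is_distribution T :=
  (forall (a : C) phi psi, test_fun phi -> test_fun psi ->
     T (fun x => a * phi x + psi x) = a * T phi + T psi) /\
  (forall K, compact K -> exists (N : nat) (c : R), forall phi,
     test_on K phi -> normc (T phi) <= c * test_norm N phi).

Definition deq T S := forall phi, test_fun phi -> T phi = S phi.

Definition regular_dist f : functional :=
  fun phi => cintegral (fun x => f x * phi x).

Definition dderiv alpha T : functional :=
  fun phi => (-1) ^+ mdeg alpha * T (cderiv alpha phi).

Definition dconv T phi : Rd -> C := fun x => T (fun y => phi (x - y)).

(* An element of E is an element u of an abstract Banach space together with a
   representative [rep u] of its class in L^1_loc; a function h thus belongs to
   E when [rep u = h %[ae mu]] for some u, and then `|u| is its norm. *)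
Definition cnorm (E : completeNormedModType C) (u : E) : R := Re `|u|.

Record TIBF (E : completeNormedModType C) (rep : E -> Rd -> C) : Prop := {
  TIBF_nontrivial : exists u : E, u != 0 ;
  TIBF_L1loc : forall u, L1loc (rep u) ;
  TIBF_linear : forall (a : C) (u v : E),
    rep (a *: u + v) = (fun x => a * rep u x + rep v x) %[ae mu] ;
  TIBF_injective : forall u v, rep u = rep v %[ae mu] -> u = v ;
  TIBF_continuous : forall K, compact K -> exists c : R, forall u,
    \int[mu]_(x in K) normc (rep u x) <= c * cnorm u ;
  TIBF_translate : forall x u, exists v, rep v = translate x (rep u) %[ae mu] ;
  TIBF_translate_bounded : exists C0 : R, 0 < C0 /\ forall x u v,
    rep v = translate x (rep u) %[ae mu] -> cnorm v <= C0 * cnorm u ;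
  TIBF_module : forall u phi, cintegrable phi ->
    {ae mu, forall x, cintegrable (fun t => rep u (x - t) * phi t)} /\
    exists v, rep v = conv (rep u) phi %[ae mu] /\
              cnorm v <= cnorm u * L1norm phi
}.

Definition is_solid (E : completeNormedModType C) (rep : E -> Rd -> C) :=
  forall u g, L1loc g ->
    {ae mu, forall x, normc (g x) <= normc (rep u x)} ->
    exists v, rep v = g %[ae mu] /\ cnorm v <= cnorm u.

(* The sigma-algebra is Borel's; almost everywhere equality with a Borel function
   is Lebesgue measurability. *)
Definition is_weight (w : Rd -> R) :=
  [/\ exists v : Rd -> R, measurable_fun setT v /\ w = v %[ae mu],
      forall x, 1 <= w x &
      forall K, compact K -> exists M : R, forall x, K x -> w x <= M].

Definition weight_system (w : nat -> Rd -> R) :=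
  (forall n, is_weight (w n)) /\ forall n x, w n x <= w n.+1 x.

Definition wM (w : nat -> Rd -> R) :=
  forall n, exists m, (n <= m)%N /\ exists c : R, 0 < c /\
    forall x y, norm2 y <= 1 -> w n (x + y) <= c * w m x.

Section spaces.
Variables (E : completeNormedModType C) (rep : E -> Rd -> C).

(* T^(alpha) is locally integrable and u is the element T^(alpha) w of E. *)
Definition weighted_deriv (w : Rd -> R) alpha T (u : E) :=
  exists h, [/\ L1loc h, deq (dderiv alpha T) (regular_dist h) &
    rep u = (fun x => h x * (w x)%:C) %[ae mu]].

Definition En (n : nat) (w : Rd -> R) : set functional :=
  [set T | is_distribution T /\ forall alpha, (mdeg alpha <= n)%N ->
     exists u, weighted_deriv w alpha T u].

(* The set has at most one element for every alpha. *)
Definition En_norm (n : nat) (w : Rd -> R) T : R :=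
  sup [set r | exists alpha u, [/\ (mdeg alpha <= n)%N,
    weighted_deriv w alpha T u & r = cnorm u]].

Definition Eoo (w : nat -> Rd -> R) : set functional :=
  \bigcap_n En n (w n).

Definition Eoo_bounded (w : nat -> Rd -> R) (B : set functional) :=
  B `<=` Eoo w /\
  forall n, exists M : R, forall T, B T -> En_norm n (w n) T <= M.

End spaces.

Definition MDFP (chi : 'I_2 -> Rd -> C) :=
  exists K, compact K /\ exists phi psi : 'I_2 -> nat -> Rd -> C,
    (forall l L, [/\ test_on K (phi l L), test_on_mom L K (psi l L),
                     phi l L <> cst 0 & psi l L <> cst 0]) /\
    forall L,
      [/\ forall x, 2 ^+ d * phi 0 L (2 *: x) - phi 0 L x = laplacian (psi 0 L) x,
          cintegral (phi 0 L) = 1,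
          phi 0 L = (conv (chi 0) (phi 0 L) \+ conv (chi 1) (phi 1 L)) &
          psi 0 L = (conv (chi 0) (psi 0 L) \+ conv (chi 1) (psi 1 L))].

(* 2^{-rj} (T * phi_j) *)
Definition scaled_conv (r : R) T phi (j : nat) : functional :=
  regular_dist (fun x => (2 `^ (- (r * j%:R)))%:C * dconv T (dilate phi j) x).

End functions.

(* Main.v *)
(* Only the case L = 0 of the MDFP is used. Write phi^l, psi^l for its functions and
   g^l_j = f * chi^l_j. Since phi^0_(j+1) - phi^0_j = 4^(-j) Delta (psi^0_j), the
   factorizations give
     f * phi^0_j = sum_l g^l_j * phi^l_j,
     f * (phi^0_(j+1) - phi^0_j) = 4^(-j) sum_l g^l_j * Delta (psi^l_j).
   Derivatives of a convolution can be moved onto g^l_j, at the price of a larger index of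
   the norm only, and (wM) absorbs the shift of the weight; so if the g^l_j grow at most
   like 2^(Nj) in all norms, then f * phi^0_j = O(2^(Nj)) and the differences are
   O(2^((N-2)j)). If N = 1 the telescoping series f = lim f * phi^0_J converges in
   E^oo_W. If N >= 2, then f * phi^0_J = O(2^((N-1)J)) by summation, and
     g_J = g_J * phi^0_J + sum_(k >= J) 4^(-k) g_J * Delta (psi^0_k)
   with g_J * phi^0_J = (f * phi^0_J) * chi_J improves the growth of g_J to 2^((N-1)J).
   Iterating, (iv) implies (i). *)

Require Import Defs.
From mathcomp Require Import all_boot all_order all_algebra.
From mathcomp Require Import all_classical all_reals all_analysis.
From mathcomp Require Import measurable_realfun complex ring lra.

Set Implicit Arguments.
Unset Strict Implicit.
Unset Printing Implicit Defensive.

Import Order.TTheory GRing.Theory Num.Theory.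
Import numFieldNormedType.Exports.

Local Open Scope classical_set_scope.
Local Open Scope ring_scope.
Local Open Scope complex_scope.

(** * Lebesgue measure on row vectors *)

Section lebesgue_affine.
Context {R : realType}.
Local Open Scope ereal_scope.
Local Notation leb := (@lebesgue_measure R).

(** The obstacle is that [E] is abstract: its elements are handled through local integrability,
    solidity and the action of L^1, and a pointwise limit says nothing about membership. Estimates
    are therefore carried by [Enb], which exhibits elements of [E] with bounded norm. Infinite sums
    are produced by completeness from summable norms, and their distributional sum is identified
    afterwards through the continuous embedding of [E] into L^1_loc. On the side of distributions
    everything rests on one interchange: the pairing of T * phi with a test function is the value of
    [T] at a convolution of test functions. It is proved by Riemann sums; associativity and
    approximation by mollifiers follow from it. The norm of E^n_w is a supremum over all elements
    representing a derivative. It becomes manageable once such an element is unique, which needs a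
    mollifier; the function phi^0 of the MDFP, of integral 1, is taken for that. *)

Lemma rV_ballP n (x y : 'rV[R]_n) (e : R) : (0 < e)%R ->
  ball x e y <-> forall i, (`|x ord0 i - y ord0 i| < e)%R.
Proof.
move=> e0; split.
  by rewrite /ball/= /mx_ball => -[_ h] i; exact: (h ord0 i).
move=> h; split => // i j; rewrite (ord1 i); exact: h.
Qed.

Lemma rV_coord_le_norm n (x : 'rV[R]_n) i : (`|x ord0 i| <= `|x|)%R.
Proof.
rewrite [leRHS]/Num.norm/= mx_normrE.
by apply/bigmax_geP; right => /=; exists (ord0, i).
Qed.

Lemma measurable_rV_ball n (x : 'rV[R]_n) (e : R) : (0 < e)%R ->
  measurable (ball x e : set 'rV[R]_n).
Proof.
move=> e0; rewrite (_ : ball x e =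
  \bigcap_(i in [set: 'I_n]) ((fun y : 'rV[R]_n => y ord0 i) @^-1` ball (x ord0 i) e)).
  apply: fin_bigcap_measurable => // i _.
  rewrite -[X in measurable X]setTI; apply: (measurable_rV_coord i) => //.
  rewrite ball_itv; exact: measurable_itv.
apply/seteqP; split => y /=.
  by move/(rV_ballP x y e0) => h i _; exact: h.
by move=> h; apply/rV_ballP => // i; exact: (h i).
Qed.

(** The sigma-algebra is generated by the coordinates, and balls of the sup norm are boxes, hence
    measurable. An open set is the union of the balls with rational centre and radius 1/(k+1) that
    it contains, a countable family. *)
Lemma open_measurable_rV n (U : set 'rV[R]_n) : open U -> measurable U.
Proof.
move=> oU.
pose c (q : 'rV[rat]_n) : 'rV[R]_n := map_mx ratr q.
pose D := [set p : 'rV[rat]_n * nat | ball (c p.1) p.2.+1%:R^-1%R `<=` U].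
have -> : U = \bigcup_(p in D) ball (c p.1) p.2.+1%:R^-1%R.
  apply/seteqP; split => [x Ux|x [p Dp]]; last exact: Dp.
  have /nbhs_ballP[e /= e0 eU] := open_nbhs_nbhs (conj oU Ux).
  have [k ke] : exists k : nat, (k.+1%:R^-1 < e / 2)%R.
    have e2 : (0 < e / 2)%R by rewrite divr_gt0.
    near \oo => k; exists k; near: k.
    exact: (near_infty_natSinv_lt (PosNum e2)).
  have k0 : (0 < k.+1%:R^-1 :> R)%R by rewrite invr_gt0.
  have /choice[q hq] : forall i, exists q : rat, (`|x ord0 i - ratr q| < k.+1%:R^-1)%R.
    move=> i; have [|q] := @rat_in_itvoo R (x ord0 i - k.+1%:R^-1)%R (x ord0 i + k.+1%:R^-1)%R.
      by rewrite ltrD2l gtrN.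
    rewrite in_itv/= => /andP[h1 h2]; exists q.
    by rewrite distrC ltr_norml ltrBrDl h1/= ltrBlDl.
  exists (\row_i q i, k) => /=.
    rewrite /D/= => y /(rV_ballP _ _ k0) hy; apply: eU.
    apply/rV_ballP => // i; have := hy i; rewrite !mxE => hyi.
    rewrite (le_lt_trans (ler_distD (ratr (q i)) _ _))// (splitr e) ltrD//.
      exact: lt_trans (hq i) ke.
    exact: lt_trans ke.
  by apply/rV_ballP => // i; rewrite !mxE distrC.
rewrite bigcup_mkcond; apply: countable_bigcupT_measurable => // p.
case: ifP => // _; exact: measurable_rV_ball.
Unshelve. all: by end_near.
Qed.

Lemma continuous_measurable_rV n (f : 'rV[R]_n -> R) :
  continuous f -> measurable_fun setT f.
Proof.
move=> cf; apply: (measurability _ (RGenOInfty.measurableE R)) => _ [_ [a ->] <-].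
rewrite setTI; apply: open_measurable_rV.
by apply: open_comp => [x _|]; [exact: cf|exact: interval_open].
Qed.

Lemma ge0_integral_rVS n (F : 'rV[R]_n.+1 -> \bar R) :
  measurable_fun setT F -> (forall x, 0 <= F x) ->
  \int[lebesgue_rV n.+1]_x F x =
  \int[leb]_t \int[lebesgue_rV n]_y F (rV_cons (t, y)).
Proof.
move=> mF F0 /=; rewrite ge0_integral_pushforward//=; last exact: measurable_rV_cons.
rewrite preimage_setT fubini_tonelli1//.
by apply: measurableT_comp => //; exact: measurable_rV_cons.
Qed.

(** Lebesgue measure is determined by half-open intervals, and on these it agrees with |c| times the
    image measure under t |-> c t + b. The integral formula transports this identity of measures. *)
Lemma ge0_integral_affine (c b : R) (F : R -> \bar R) : c != 0%R ->
  measurable_fun setT F -> (forall x, 0 <= F x) ->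
  \int[leb]_t F (c * t + b)%R = `|c|^-1%:E * \int[leb]_t F t.
Proof.
move=> c0 mF F0.
pose h : measurableTypeR R -> measurableTypeR R := fun t => (c * t + b)%R.
have mh : measurable_fun setT h.
  by apply: measurable_funD => //; exact: measurable_funM.
have c0' : (0 <= `|c|^-1)%R by rewrite invr_ge0.
rewrite -[LHS](@ge0_integral_pushforward _ _ _ _ R h mh (lebesgue_measure : {measure set (measurableTypeR R) -> \bar R}) setT F)//.
transitivity (\int[mscale (NngNum c0') leb]_t F t); last first.
  by rewrite ge0_integral_mscale.
apply: eq_measure_integral => A mA _.
have ha : forall A, measurable A ->
   leb A = mscale (NngNum (normr_ge0 c)) (pushforward leb h) A.
  move=> B mB; apply/lebesgue_measure_unique => //= _ [[u v] _ <-].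
  rewrite /mscale/= /pushforward.
  (* For c < 0 the preimage of a half-open interval is half-open on the other side; its length is
     the same. *)
  have [cn|cp|/eqP] := ltgtP c 0%R; last by rewrite (negbTE c0).
  - rewrite (_ : _ @^-1` _ = `[(v - b) / c, (u - b) / c[%classic)%R; last first.
      apply/seteqP; split => x /=; rewrite !in_itv/= /h.
        by move=> /andP[? ?]; rewrite ler_ndivrMr// ltr_ndivlMr// mulrC; apply/andP; split; lra.
      by rewrite ler_ndivrMr// ltr_ndivlMr// mulrC => /andP[? ?]; apply/andP; split; lra.
    rewrite !lebesgue_measure_itv/= !lte_fin ltr_ndivlMr// divfK ?lt_eqF// ltrD2r.
    case: ifPn => uv; last by rewrite mule0.
    rewrite -!EFinB -EFinM; congr EFin; rewrite ltr0_norm//; field.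
    by rewrite lt_eqF.
  - rewrite (_ : _ @^-1` _ = `](u - b) / c, (v - b) / c]%classic)%R; last first.
      apply/seteqP; split => x /=; rewrite !in_itv/= /h.
        by move=> /andP[? ?]; rewrite ler_pdivlMr// ltr_pdivrMr// mulrC; apply/andP; split; lra.
      by rewrite ler_pdivlMr// ltr_pdivrMr// mulrC => /andP[? ?]; apply/andP; split; lra.
    rewrite !lebesgue_measure_itv/= !lte_fin ltr_pdivlMr// divfK ?gt_eqF// ltrD2r.
    case: ifPn => uv; last by rewrite mule0.
    rewrite -!EFinB -EFinM; congr EFin; rewrite gtr0_norm//; field.
    by rewrite gt_eqF.
change (pushforward leb h A = (`|c|^-1)%:E * leb A).
rewrite (ha mh A mA) /mscale/= muleA -EFinM mulVf ?normr_eq0// mul1e//.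
Qed.

(** Induction on the dimension by Tonelli: the map acts on each coordinate separately, and each
    contributes one factor 1/|c|. Translation, reflection and dilation are the cases c = 1, -1 and
    2^j. *)
Lemma ge0_integral_rV_affine n (c : R) (b : 'rV[R]_n) (F : 'rV[R]_n -> \bar R) :
  c != 0%R -> measurable_fun setT F -> (forall x, 0 <= F x) ->
  \int[lebesgue_rV n]_x F (c *: x + b)%R =
  (`|c| ^- n)%:E * \int[lebesgue_rV n]_x F x.
Proof.
move=> c0; elim: n b F => [|n ih] b F mF F0.
  rewrite expr0 invr1 mul1e; apply: eq_integral => x _; congr F.
  by apply/rowP => -[].
have mcons := @measurable_rV_cons _ R n.
have maff m (a : 'rV[R]_m) : measurable_fun setT (fun x : 'rV[R]_m => c *: x + a)%R.
  apply: measurable_fun_rV => i.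
  rewrite (_ : (fun _ => _) = fun x : 'rV[R]_m => c * x ord0 i + a ord0 i)%R; last first.
    by apply/funext => x; rewrite !mxE.
  apply: measurable_funD => //; apply: measurable_funM => //.
  exact: measurable_rV_coord.
rewrite ge0_integral_rVS//; last exact: (measurableT_comp mF (maff _ b)).
pose b' : 'rV[R]_n := (\row_j b ord0 (lift ord0 j))%R.
have consE t y : (c *: rV_cons (t, y) + b = rV_cons (c * t + b ord0 ord0, c *: y + b'))%R.
  by apply/rowP => i; rewrite !mxE; case: unliftP => [j ->|->]; rewrite ?mxE.
have mFc t : measurable_fun setT (fun y => F (rV_cons (t, y))).
  apply: measurableT_comp => //; apply: (measurableT_comp mcons).
  exact: measurable_pair1.
have mI : measurable_fun [set: measurableTypeR R]
    (fun t => \int[lebesgue_rV n]_y F (rV_cons (t, y))).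
  apply: (@measurable_fun_fubini_tonelli_F _ _ (measurableTypeR R) _ R
    (lebesgue_rV n) (F \o @rV_cons _ R n)); last by move=> x; exact: F0.
  exact: (measurableT_comp mF mcons).
under eq_integral => t _.
  under eq_integral => y _ do rewrite consE.
  rewrite (ih _ (fun y => F (rV_cons (_, y))))//.
  over.
rewrite (@ge0_integral_affine c (b ord0 ord0)
  (fun t => (`|c| ^- n)%:E * \int[lebesgue_rV n]_y F (rV_cons (t, y))))//; last 2 first.
- exact: measurable_funeM.
- move=> t; apply: mule_ge0; last exact: integral_ge0.
  by rewrite lee_fin invr_ge0 exprn_ge0.
rewrite ge0_integralZl//; last by move=> t _; exact: integral_ge0.
by rewrite muleA -EFinM -invfM -exprS -ge0_integral_rVS.
Qed.

Lemma lebesgue_rV_ball_lty n (r : R) :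
  lebesgue_rV n [set x : 'rV[R]_n | forall i, (`|x ord0 i| <= r)%R] < +oo.
Proof.
elim: n => [|n ih] /=.
  by rewrite diracE ltry.
rewrite /rV_step /pushforward.
rewrite (_ : _ @^-1` _ = (`[(- r)%R, r]%classic : set (measurableTypeR R)) `*`
  [set x : 'rV[R]_n | forall i, (`|x ord0 i| <= r)%R]); last first.
  apply/seteqP; split => [[t y] /= h|[t y] /= [h1 h2] i].
    split; first by have := h ord0; rewrite mxE unlift_none/= in_itv/= ler_norml.
    by move=> i; have := h (lift ord0 i); rewrite mxE liftK.
  rewrite mxE; case: unliftP => [j _|_] //=.
  by move: h1; rewrite in_itv/= ler_norml.
have mbox : measurable [set x : 'rV[R]_n | forall i, (`|x ord0 i| <= r)%R].
  rewrite (_ : mkset _ = \bigcap_(i in [set: 'I_n])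
     ((fun y : 'rV[R]_n => y ord0 i) @^-1` `[(-r)%R, r]%classic)).
    apply: fin_bigcap_measurable => // i _.
    rewrite -[X in measurable X]setTI; exact: (measurable_rV_coord i).
  apply/seteqP; split => x /= h i; first by move=> _; have := h i; rewrite /= in_itv/= -ler_norml.
  by have := h i I; rewrite /= in_itv/= -ler_norml.
rewrite -[ltLHS]/((leb \x lebesgue_rV n)%E _).
rewrite [ltLHS](@product_measure1E _ _ (measurableTypeR R) _ R leb (lebesgue_rV n))//=.
rewrite lte_mul_pinfty//; last first.
- by rewrite lebesgue_measure_itv/=; case: ifP => // _; rewrite -EFinD ltry.
Qed.

End lebesgue_affine.

(** * Moduli, real and imaginary parts of complex numbers *)

Section complex_modulus.
Context {R : realType}.
Local Notation C := R[i].
Local Notation Re := (@complex.Re R).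
Local Notation Im := (@complex.Im R).
Local Notation normc := (@Normc.normc R).
Implicit Types (z u : C) (a : R).

Lemma normcE_sqrt z : normc z = Num.sqrt (Re z ^+ 2 + Im z ^+ 2).
Proof. by case: z. Qed.

Lemma normc_ge0 z : 0 <= normc z.
Proof. by rewrite normcE_sqrt sqrtr_ge0. Qed.

Lemma Re_le_normc z : `|Re z| <= normc z.
Proof. by rewrite normcE_sqrt -sqrtr_sqr ler_wsqrtr// lerDl sqr_ge0. Qed.

Lemma Im_le_normc z : `|Im z| <= normc z.
Proof. by rewrite normcE_sqrt -sqrtr_sqr ler_wsqrtr// lerDr sqr_ge0. Qed.

Lemma normc_real a : normc a%:C = `|a|.
Proof. by rewrite normcE_sqrt/= expr0n addr0 sqrtr_sqr. Qed.

Lemma normcB z u : normc (z - u) = normc (u - z).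
Proof. by rewrite -normcN opprB. Qed.

Lemma normc_le_ReIm z : normc z <= `|Re z| + `|Im z|.
Proof.
case: z => a b; rewrite (_ : a +i* b = a%:C + (0 +i* b)); last first.
  by apply/eqP; rewrite eq_complex/= addr0 add0r !eqxx.
apply: (le_trans (le_normcD _ _)); rewrite normc_real/= addr0.
by rewrite expr0n/= !add0r sqrtr_sqr.
Qed.

Lemma normc_sum (I : Type) (s : seq I) (P : pred I) (F : I -> C) :
  normc (\sum_(i <- s | P i) F i) <= \sum_(i <- s | P i) normc (F i).
Proof.
elim/big_ind2 : _ => //; first by rewrite Normc.normc0.
by move=> x1 x2 y1 y2 h1 h2; rewrite (le_trans (le_normcD _ _))// lerD.
Qed.

Lemma normrcE z : `|z| = (normc z)%:C.
Proof. by rewrite normc_def normcE_sqrt. Qed.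

Lemma cReD z u : Re (z + u) = Re z + Re u. Proof. by case: z u => [? ?] []. Qed.
Lemma cImD z u : Im (z + u) = Im z + Im u. Proof. by case: z u => [? ?] []. Qed.
Lemma cReN z : Re (- z) = - Re z. Proof. by case: z. Qed.
Lemma cImN z : Im (- z) = - Im z. Proof. by case: z. Qed.
Lemma cReM z u : Re (z * u) = Re z * Re u - Im z * Im u.
Proof. by case: z u => [? ?] []. Qed.
Lemma cImM z u : Im (z * u) = Re z * Im u + Im z * Re u.
Proof. by case: z u => [? ?] []. Qed.
Lemma complex_eq z u : Re z = Re u -> Im z = Im u -> z = u.
Proof. by case: z u => [? ?] [? ?] /= -> ->. Qed.

Lemma normc_prod_real z a : normc (z * a%:C) = normc z * `|a|.
Proof. by rewrite Normc.normcM normc_real. Qed.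

End complex_modulus.

(** * Complex integrals *)

Section complex_integral.
Context {R : realType} {d : nat}.
Local Notation Rd := 'rV[R]_d.
Local Notation C := R[i].
Local Notation mu := (@lebesgue_rV R d).
Local Notation Re := (@complex.Re R).
Local Notation Im := (@complex.Im R).
Local Notation normc := (@Normc.normc R).
Implicit Types (f g h : Rd -> C) (r : R).

Definition ccontinuous f :=
  continuous (fun x => Re (f x)) /\ continuous (fun x => Im (f x)).

Definition cball (r : R) : set Rd := [set x | `|x| <= r].

Definition supported r f := forall x, r < `|x| -> f x = 0.

Lemma cballE r : 0 <= r ->
  cball r = [set x : Rd | forall i, `|x ord0 i| <= r].
Proof.
move=> r0; apply/seteqP; split => x /=; rewrite /cball/=.
  by move=> xr i; exact: le_trans (rV_coord_le_norm x i) xr.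
move=> h; rewrite [leLHS]/Num.norm/= mx_normrE; apply/bigmax_leP; split => //.
by move=> [i j] _ /=; rewrite (ord1 i).
Qed.

Lemma cball_closed r : closed (cball r).
Proof.
rewrite (_ : cball r = (fun x : Rd => `|x|) @^-1` [set t | t <= r]) //.
apply: preimage_closed; first by move=> x _; exact: norm_continuous.
exact: closed_le.
Qed.

Lemma cball_compact r : compact (cball r).
Proof.
apply: bounded_closed_compact; last exact: cball_closed.
exists r; split; first exact: num_real.
by move=> M rM x /= xr; rewrite (le_trans xr)// ltW.
Qed.

Lemma compact_measurable_rV (K : set Rd) : compact K -> measurable K.
Proof.
move=> cK; rewrite -[K]setCK; apply: measurableC; apply: open_measurable_rV.
by apply: closed_openC; apply: compact_closed.
Qed.

Lemma measurable_cball r : measurable (cball r).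
Proof. exact: compact_measurable_rV (@cball_compact r). Qed.

Lemma compact_sub_cball (K : set Rd) : compact K -> exists r, 0 < r /\ K `<=` cball r.
Proof.
move=> cK; have [M [_ hM]] := compact_bounded cK.
exists (`|M| + 1); split; first by rewrite ltr_wpDl.
by move=> x Kx; apply: hM => //; rewrite (le_lt_trans (ler_norm M))// ltrDl.
Qed.

Lemma mu_cball_lty r : (mu (cball r) < +oo)%E.
Proof.
apply: (@le_lt_trans _ _ (mu (cball (Num.max r 0)))).
  apply: le_measure; rewrite ?inE; [exact: measurable_cball..|].
  by move=> x; rewrite /cball/= => xr; rewrite le_max xr.
by rewrite cballE ?le_max ?lexx ?orbT//; exact: lebesgue_rV_ball_lty.
Qed.

Lemma cmeasurable_cst (a : C) : cmeasurable (cst a : Rd -> C).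
Proof. by split => /=; exact: measurable_cst. Qed.

Lemma cmeasurableD f g : cmeasurable f -> cmeasurable g ->
  cmeasurable (fun x => f x + g x).
Proof.
move=> [f1 f2] [g1 g2]; split.
- rewrite (_ : (fun _ => _) = fun x => Re (f x) + Re (g x)).
    exact: measurable_funD.
  by apply/funext => x; rewrite cReD.
- rewrite (_ : (fun _ => _) = fun x => Im (f x) + Im (g x)).
    exact: measurable_funD.
  by apply/funext => x; rewrite cImD.
Qed.

Lemma cmeasurableM f g : cmeasurable f -> cmeasurable g ->
  cmeasurable (fun x => f x * g x).
Proof.
move=> [f1 f2] [g1 g2]; split.
- rewrite (_ : (fun _ => _) = fun x => Re (f x) * Re (g x) - Im (f x) * Im (g x)).
    by apply: measurable_funB; exact: measurable_funM.
  by apply/funext => x; rewrite cReM.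
- rewrite (_ : (fun _ => _) = fun x => Re (f x) * Im (g x) + Im (f x) * Re (g x)).
    by apply: measurable_funD; exact: measurable_funM.
  by apply/funext => x; rewrite cImM.
Qed.

Lemma cmeasurableZ (a : C) f : cmeasurable f -> cmeasurable (fun x => a * f x).
Proof. exact/cmeasurableM/cmeasurable_cst. Qed.

Lemma cmeasurable_real (u : Rd -> R) : measurable_fun setT u ->
  cmeasurable (fun x => (u x)%:C).
Proof. by move=> mu; split => //=; exact: measurable_cst. Qed.

Lemma measurable_normc f : cmeasurable f -> measurable_fun setT (fun x => normc (f x)).
Proof.
move=> [f1 f2].
rewrite (_ : (fun _ => _) = fun x => Num.sqrt (Re (f x) ^+ 2 + Im (f x) ^+ 2)).
  apply: (measurableT_comp (continuous_measurable_fun (@sqrt_continuous R))).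
  by apply: measurable_funD; exact: measurable_funX.
by apply/funext => x; rewrite normcE_sqrt.
Qed.

Lemma ccontinuous_measurable f : ccontinuous f -> cmeasurable f.
Proof. by move=> [c1 c2]; split; exact: continuous_measurable_rV. Qed.

Lemma measurable_rV_affine (c : R) (b : Rd) :
  measurable_fun setT (fun x : Rd => c *: x + b).
Proof.
apply: measurable_fun_rV => i.
rewrite (_ : (fun _ => _) = fun x : Rd => c * x ord0 i + b ord0 i); last first.
  by apply/funext => x; rewrite !mxE.
apply: measurable_funD => //; apply: measurable_funM => //.
exact: measurable_rV_coord.
Qed.

Lemma cintegrable_dom f (u : Rd -> R) : cmeasurable f ->
  mu.-integrable setT (EFin \o u) -> (forall x, normc (f x) <= u x) -> cintegrable f.
Proof.
move=> [f1 f2] iu fu; split.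
- apply: le_integrable iu => //; first exact/measurable_EFinP.
  move=> x _ /=; rewrite lee_fin (le_trans (Re_le_normc _))//.
  by rewrite (le_trans (fu x))// ler_norm.
- apply: le_integrable iu => //; first exact/measurable_EFinP.
  move=> x _ /=; rewrite lee_fin (le_trans (Im_le_normc _))//.
  by rewrite (le_trans (fu x))// ler_norm.
Qed.

Lemma cintegrable_measurable f : cintegrable f -> cmeasurable f.
Proof.
by move=> [/measurable_int/measurable_EFinP ? /measurable_int/measurable_EFinP ?].
Qed.

Lemma cintegrable_normc f : cintegrable f ->
  mu.-integrable setT (fun x => (normc (f x))%:E).
Proof.
move=> /[dup] /cintegrable_measurable mf [if1 if2].
have : mu.-integrable setT (fun x => (`|Re (f x)|%:E + `|Im (f x)|%:E)%E).
  apply: integrableD => //.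
    exact: (@integrable_norm _ _ _ _ _ (fun x => Re (f x))).
  exact: (@integrable_norm _ _ _ _ _ (fun x => Im (f x))).
apply: le_integrable => //; first by apply/measurable_EFinP; exact: measurable_normc.
move=> x _; rewrite -EFinD !abse_EFin lee_fin ger0_norm ?normc_ge0//.
by rewrite (le_trans (normc_le_ReIm _))// ler_norm.
Qed.

Lemma cintegrableP f : cintegrable f <->
  cmeasurable f /\ mu.-integrable setT (fun x => (normc (f x))%:E).
Proof.
split=> [h|[mf h]]; first by split; [exact: cintegrable_measurable|exact: cintegrable_normc].
exact: cintegrable_dom h _.
Qed.

Lemma cintegrableD f g : cintegrable f -> cintegrable g ->
  cintegrable (fun x => f x + g x).
Proof.
move=> /[dup] /cintegrable_measurable mf [f1 f2].
move=> /[dup] /cintegrable_measurable mg [g1 g2]; split.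
- under eq_fun do rewrite cReD EFinD; exact: integrableD.
- under eq_fun do rewrite cImD EFinD; exact: integrableD.
Qed.

Lemma cintegrableZ (a : C) f : cintegrable f -> cintegrable (fun x => a * f x).
Proof.
move=> /[dup] /cintegrable_measurable mf /cintegrable_normc i.
apply: (@cintegrable_dom _ (fun x => normc a * normc (f x))).
- exact: cmeasurableZ.
- rewrite (_ : EFin \o _ = fun x => ((normc a)%:E * (normc (f x))%:E)%E)//.
  exact: integrableZl.
- by move=> x; rewrite Normc.normcM.
Qed.

Lemma cintegrableB f g : cintegrable f -> cintegrable g ->
  cintegrable (fun x => f x - g x).
Proof.
move=> hf hg; rewrite (_ : (fun _ => _) = fun x => f x + (-1) * g x).
  exact/cintegrableD/cintegrableZ.
by apply/funext => x; rewrite mulN1r.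
Qed.

Lemma cintegrable0 : cintegrable (cst 0 : Rd -> C).
Proof. by split => /=; exact: integrable0. Qed.

Lemma cintegrable_sum (I : Type) (s : seq I) (F : I -> Rd -> C) :
  (forall i, cintegrable (F i)) -> cintegrable (fun x => \sum_(i <- s) F i x).
Proof.
move=> mF; elim: s => [|i s ih].
  under eq_fun do rewrite big_nil; exact: cintegrable0.
by under eq_fun do rewrite big_cons; exact: cintegrableD.
Qed.

Lemma cintegralD f g : cintegrable f -> cintegrable g ->
  cintegral (fun x => f x + g x) = cintegral f + cintegral g.
Proof.
move=> [f1 f2] [g1 g2]; apply: complex_eq; rewrite /cintegral/=.
- by under eq_Rintegral do rewrite cReD; rewrite RintegralD.
- by under eq_Rintegral do rewrite cImD; rewrite RintegralD.
Qed.

Lemma cintegralZ (a : C) f : cintegrable f ->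
  cintegral (fun x => a * f x) = a * cintegral f.
Proof.
move=> [f1 f2].
have iZ (k : R) (u : Rd -> R) : mu.-integrable setT (EFin \o u) ->
    mu.-integrable setT (EFin \o (fun x => k * u x)).
  by move=> iu; rewrite (_ : EFin \o _ = fun x => (k%:E * (u x)%:E)%E)//; exact: integrableZl.
apply: complex_eq; rewrite ?cReM ?cImM /cintegral/=.
- under eq_Rintegral do rewrite cReM.
  by rewrite RintegralB// ?RintegralZl//; [exact: iZ f1|exact: iZ f2].
- under eq_Rintegral do rewrite cImM.
  by rewrite RintegralD// ?RintegralZl//; [exact: iZ f2|exact: iZ f1].
Qed.

Lemma cintegralB f g : cintegrable f -> cintegrable g ->
  cintegral (fun x => f x - g x) = cintegral f - cintegral g.
Proof.
move=> hf hg; rewrite (_ : (fun _ => _) = fun x => f x + (-1) * g x).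
  by rewrite cintegralD ?cintegralZ ?mulN1r//; exact: cintegrableZ.
by apply/funext => x; rewrite mulN1r.
Qed.

Lemma cintegral0 : cintegral (fun _ : Rd => 0 : C) = 0.
Proof. by apply: complex_eq; rewrite /cintegral/= Rintegral_cst// mul0r. Qed.

Lemma cintegral_sum (I : Type) (s : seq I) (F : I -> Rd -> C) :
  (forall i, cintegrable (F i)) ->
  cintegral (fun x => \sum_(i <- s) F i x) = \sum_(i <- s) cintegral (F i).
Proof.
move=> mF; elim: s => [|i s ih].
  by under eq_fun do rewrite big_nil; rewrite big_nil cintegral0.
under eq_fun do rewrite big_cons; rewrite cintegralD ?ih ?big_cons//.
exact: cintegrable_sum.
Qed.

Lemma L1norm_ge0 f : 0 <= L1norm f.
Proof. by apply: Rintegral_ge0 => x _; exact: normc_ge0. Qed.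

(* The factor 2 comes from estimating the real and imaginary parts separately. *)
Lemma normc_cintegral_le f : cintegrable f -> normc (cintegral f) <= 2 * L1norm f.
Proof.
move=> /[dup] /cintegrable_normc h [f1 f2].
rewrite (le_trans (normc_le_ReIm _))//= (_ : 2 = 1 + 1)// mulrDl mul1r lerD//.
- apply: (le_trans (le_normr_Rintegral _ _)) => //.
  apply: le_Rintegral => // [|x _]; last exact: Re_le_normc.
  exact: (@integrable_norm _ _ _ _ _ (fun x => Re (f x))).
- apply: (le_trans (le_normr_Rintegral _ _)) => //.
  apply: le_Rintegral => // [|x _]; last exact: Im_le_normc.
  exact: (@integrable_norm _ _ _ _ _ (fun x => Im (f x))).
Qed.

Lemma le_L1norm f (u : Rd -> R) : cmeasurable f -> mu.-integrable setT (EFin \o u) ->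
  (forall x, normc (f x) <= u x) -> L1norm f <= \int[mu]_x u x.
Proof.
move=> mf iu fu; apply: le_Rintegral => //.
exact: cintegrable_normc (cintegrable_dom mf iu fu).
Qed.

(** Reduces to nonnegative functions through the positive and negative parts of the real and
    imaginary parts; their integrals are finite, which allows the subtraction. *)
Lemma cintegral_affine (c : R) (b : Rd) f : c != 0 -> cintegrable f ->
  cintegrable (fun x => f (c *: x + b)) /\
  cintegral (fun x => f (c *: x + b)) = (`|c| ^- d)%:C * cintegral f.
Proof.
move=> c0 /[dup] /cintegrable_measurable mf /[dup] fi [f1 f2].
have maff := measurable_rV_affine c b.
have key (u : Rd -> R) : mu.-integrable setT (EFin \o u) ->
    mu.-integrable setT (fun x => (u (c *: x + b))%:E) /\
    \int[mu]_x u (c *: x + b) = `|c| ^- d * \int[mu]_x u x.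
  move=> iu; have mu' := measurable_int _ iu.
  have mu1 : measurable_fun setT u by exact/measurable_EFinP.
  split.
    apply/integrableP; split.
      by apply/measurable_EFinP; exact: (measurableT_comp mu1).
    rewrite (@ge0_integral_rV_affine R d c b (fun x => `|(u x)%:E|%E))//.
      move/integrableP: iu => [_ iu].
      by rewrite lte_mul_pinfty// lee_fin invr_ge0 exprn_ge0.
    by apply: measurableT_comp.
  rewrite /Rintegral [X in fine X = _]integralE [X in _ = _ * fine X]integralE.
  have e1 : (\int[mu]_x (fun x => (u (c *: x + b)%R)%:E)^\+ x =
      (`|c| ^- d)%:E * \int[mu]_x (EFin \o u)^\+ x)%E.
    transitivity (\int[mu]_x ((EFin \o u)^\+ (c *: x + b)%R))%E.
      by apply: eq_integral => x _; rewrite ?funeposE ?funenegE.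
    by apply: ge0_integral_rV_affine => //; exact: measurable_funepos.
  have e2 : (\int[mu]_x (fun x => (u (c *: x + b)%R)%:E)^\- x =
      (`|c| ^- d)%:E * \int[mu]_x (EFin \o u)^\- x)%E.
    transitivity (\int[mu]_x ((EFin \o u)^\- (c *: x + b)%R))%E.
      by apply: eq_integral => x _; rewrite ?funeposE ?funenegE.
    by apply: ge0_integral_rV_affine => //; exact: measurable_funeneg.
  rewrite e1 e2.
  have p1 : (\int[mu]_x (EFin \o u)^\+ x)%E \is a fin_num.
    by apply: integrable_fin_num => //; exact: integrable_funepos.
  have p2 : (\int[mu]_x (EFin \o u)^\- x)%E \is a fin_num.
    by apply: integrable_fin_num => //; exact: integrable_funeneg.
  rewrite -(fineK p1) -(fineK p2) -!EFinM -!EFinB/=.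
  by rewrite mulrBr.
have [i1 e1] := key _ f1; have [i2 e2] := key _ f2.
split; first by split.
apply: complex_eq; rewrite ?cReM ?cImM/= ?mul0r ?subr0 ?addr0.
- exact: e1.
- exact: e2.
Qed.

End complex_integral.

(** * Locally integrable functions *)

Section local_integrability.
Context {R : realType} {d : nat}.
Local Notation Rd := 'rV[R]_d.
Local Notation C := R[i].
Local Notation mu := (@lebesgue_rV R d).
Local Notation Re := (@complex.Re R).
Local Notation Im := (@complex.Im R).
Local Notation normc := (@Normc.normc R).
Implicit Types (f g h phi : Rd -> C) (r : R).

Definition locmass h r : R := \int[mu]_(x in cball r) normc (h x).

Lemma locmass_ge0 h r : 0 <= locmass h r.
Proof. by apply: Rintegral_ge0 => x _; exact: normc_ge0. Qed.

Lemma L1loc_measurable h : L1loc h -> cmeasurable h. Proof. by case. Qed.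

Lemma L1loc_integrable h (K : set Rd) : L1loc h -> compact K ->
  mu.-integrable K (fun x => (normc (h x))%:E).
Proof.
move=> [mh hK] cK; have mK := compact_measurable_rV cK.
apply/integrableP; split.
  by apply/measurable_EFinP; apply: measurable_funTS; exact: measurable_normc.
under eq_integral do rewrite abse_EFin ger0_norm ?normc_ge0//.
exact: hK.
Qed.

(** The integrand is dominated by M |h| cut off to the ball, where |h| has finite mass. The bound is
    uniform over all [phi] of that size and support, which the continuity arguments exploit. *)
Lemma L1loc_pairing h phi r (M : R) : L1loc h -> cmeasurable phi ->
    supported r phi -> (forall x, normc (phi x) <= M) ->
  cintegrable (fun x => h x * phi x) /\
  L1norm (fun x => h x * phi x) <= M * locmass h r.
Proof.
move=> Lh mp sp pM; have mh := L1loc_measurable Lh.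
have M0 : 0 <= M by rewrite (le_trans _ (pM 0))// normc_ge0.
pose u := (fun x => M * normc (h x)) \_ (cball r) : Rd -> R.
have iu0 : mu.-integrable (cball r) (EFin \o (fun x => M * normc (h x))).
  rewrite (_ : EFin \o _ = fun x => (M%:E * (normc (h x))%:E)%E)//.
  apply: integrableZl => //; first exact: measurable_cball.
  by apply: L1loc_integrable => //; exact: cball_compact.
have iu : mu.-integrable setT (EFin \o u).
  rewrite /u -restrict_EFin.
  by apply/(integrable_mkcond _ (@measurable_cball R d r)).
have hu x : normc (h x * phi x) <= u x.
  rewrite Normc.normcM /u patchE; case: ifPn => xr.
    by rewrite mulrC ler_wpM2r// normc_ge0.
  rewrite sp ?Normc.normc0 ?mulr0// ltNge.
  by apply: contra xr => xr; rewrite inE.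
have mhp : cmeasurable (fun x => h x * phi x) by exact: cmeasurableM.
split; first exact: cintegrable_dom iu hu.
rewrite (le_trans (le_L1norm mhp iu hu))// /u -Rintegral_mkcond RintegralZl//.
  exact: measurable_cball.
by apply: L1loc_integrable => //; exact: cball_compact.
Qed.

Lemma regular_dist_bound h phi r (M : R) : L1loc h -> cmeasurable phi ->
    supported r phi -> (forall x, normc (phi x) <= M) ->
  normc (regular_dist h phi) <= 2 * (M * locmass h r).
Proof.
move=> Lh mp sp pM; have [ih le] := L1loc_pairing Lh mp sp pM.
by rewrite (le_trans (normc_cintegral_le ih))// ler_pM2l.
Qed.

Lemma ae_normc_L1loc g h : cmeasurable g -> L1loc h ->
  {ae mu, forall x, normc (g x) <= normc (h x)} -> L1loc g.
Proof.
move=> mg [mh Lh] gh; split => // K cK; have mK := compact_measurable_rV cK.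
apply: le_lt_trans (Lh K cK); apply: ae_ge0_le_integral => //.
- by move=> x _; rewrite lee_fin normc_ge0.
- by apply: measurable_funTS; apply/measurable_EFinP; exact: measurable_normc.
- by move=> x _; rewrite lee_fin normc_ge0.
- by apply: measurable_funTS; apply/measurable_EFinP; exact: measurable_normc.
- by apply: filterS gh => x le _; rewrite lee_fin.
Qed.

Lemma L1locD g h : L1loc g -> L1loc h -> L1loc (fun x => g x + h x).
Proof.
move=> Lg Lh; have mg := L1loc_measurable Lg; have mh := L1loc_measurable Lh.
split; first exact: cmeasurableD.
move=> K cK; have mK := compact_measurable_rV cK.
have : mu.-integrable K (fun x => (normc (g x))%:E + (normc (h x))%:E)%E.
  by apply: integrableD => //; exact: L1loc_integrable.
move/integrable_lty => /(_ mK); apply: le_lt_trans; apply: ge0_le_integral => //.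
- by move=> x _; rewrite lee_fin normc_ge0.
- apply: measurable_funTS; apply/measurable_EFinP; apply: measurable_normc.
  exact: cmeasurableD.
- apply: measurable_funTS; apply: emeasurable_funD; apply/measurable_EFinP; exact: measurable_normc.
- by move=> x _; rewrite -EFinD lee_fin le_normcD.
Qed.

Lemma L1locZ (a : C) h : L1loc h -> L1loc (fun x => a * h x).
Proof.
move=> Lh; have mh := L1loc_measurable Lh; split; first exact: cmeasurableZ.
move=> K cK; have mK := compact_measurable_rV cK.
under eq_integral do rewrite Normc.normcM EFinM.
have : mu.-integrable K (fun x => (normc a)%:E * (normc (h x))%:E)%E.
  by apply: integrableZl => //; exact: L1loc_integrable.
by move/integrable_lty => /(_ mK).
Qed.

Lemma ccontinuousP f : ccontinuous f <-> (forall x e, 0 < e ->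
  exists2 dl, 0 < dl & forall y, `|x - y| < dl -> normc (f x - f y) <= e).
Proof.
split=> [[f1 f2] x e e0|h].
  have e2 : 0 < e / 2 by rewrite divr_gt0.
  have /cvgrPdist_le/(_ _ e2)/nbhs_ballP[d1 /= d10 h1] := f1 x.
  have /cvgrPdist_le/(_ _ e2)/nbhs_ballP[d2 /= d20 h2] := f2 x.
  exists (Num.min d1 d2); first by rewrite lt_min d10.
  move=> y; rewrite lt_min => /andP[xy1 xy2].
  rewrite (le_trans (normc_le_ReIm _))// cReD cImD cReN cImN (splitr e) lerD//.
    by apply: h1; rewrite -ball_normE.
  by apply: h2; rewrite -ball_normE.
split=> x; apply/(@cvgrPdist_le _ _ _ (nbhs x) (nbhs_filter x)) => e e0; have [dl dl0 hdl] := h x e e0;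
  apply/nbhs_ballP; exists dl => //= y; rewrite -ball_normE/= => /hdl.
  by apply: le_trans; rewrite -cReN -cReD Re_le_normc.
by apply: le_trans; rewrite -cImN -cImD Im_le_normc.
Qed.

Lemma ccontinuousB f g : ccontinuous f -> ccontinuous g ->
  ccontinuous (fun x => f x - g x).
Proof.
move=> /ccontinuousP hf /ccontinuousP hg; apply/ccontinuousP => x e e0.
have e2 : 0 < e / 2 by rewrite divr_gt0.
have [d1 d10 h1] := hf x _ e2; have [d2 d20 h2] := hg x _ e2.
exists (Num.min d1 d2); first by rewrite lt_min d10.
move=> y; rewrite lt_min => /andP[xy1 xy2].
rewrite (_ : _ - _ = (f x - f y) - (g x - g y)); last by ring.
rewrite (le_trans (le_normcD _ _))// normcN (splitr e) lerD//.
  exact: h1.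
exact: h2.
Qed.

Lemma ccontinuous_comp f (p : Rd -> Rd) : continuous p -> ccontinuous f ->
  ccontinuous (f \o p).
Proof.
move=> cp [f1 f2]; split => x.
- by apply: (@continuous_comp _ _ _ p (fun x => Re (f x))); [exact: cp|exact: (f1 (p x))].
- by apply: (@continuous_comp _ _ _ p (fun x => Im (f x))); [exact: cp|exact: (f2 (p x))].
Qed.

Lemma continuous_normc f : ccontinuous f -> continuous (fun x => normc (f x)).
Proof.
move=> [f1 f2] x; under eq_fun do rewrite normcE_sqrt.
apply: (@continuous_comp _ _ _ (fun x => Re (f x) ^+ 2 + Im (f x) ^+ 2)).
  apply: (@continuousD _ _ _ (fun x => Re (f x) ^+ 2) (fun x => Im (f x) ^+ 2)).
    by apply: (@continuous_comp _ _ _ (fun x => Re (f x)) (fun t => t ^+ 2)); [exact: f1|exact: exprn_continuous].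
  by apply: (@continuous_comp _ _ _ (fun x => Im (f x)) (fun t => t ^+ 2)); [exact: f2|exact: exprn_continuous].
exact: sqrt_continuous.
Qed.

Lemma ccontinuous_bounded f (K : set Rd) : ccontinuous f -> compact K ->
  exists M, 0 <= M /\ forall x, K x -> normc (f x) <= M.
Proof.
move=> /continuous_normc cf cK.
have : compact ((fun x => normc (f x)) @` K).
  by apply: continuous_compact => //; exact: continuous_subspaceT.
move=> /compact_bounded[M [_ hM]]; exists (`|M| + 1); split; first by rewrite addr_ge0.
move=> x Kx; rewrite -[leLHS]ger0_norm ?normc_ge0//.
apply: (hM (`|M| + 1)); last by exists x.
by rewrite (le_lt_trans (ler_norm M))// ltrDl.
Qed.

Lemma ccontinuous_L1loc f : ccontinuous f -> L1loc f.
Proof.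
move=> cf; have mf := ccontinuous_measurable cf.
split=> // K cK; have mK := compact_measurable_rV cK.
have [M [M0 fM]] := ccontinuous_bounded cf cK.
have [r [_ Kr]] := compact_sub_cball cK.
apply: (@le_lt_trans _ _ (\int[mu]_(x in K) M%:E)%E).
  apply: ge0_le_integral => //.
  - by move=> x _; rewrite lee_fin normc_ge0.
  - by apply: measurable_funTS; apply/measurable_EFinP; exact: measurable_normc.
rewrite integral_cst// lte_mul_pinfty//; apply: le_lt_trans (mu_cball_lty r).
by apply: le_measure; rewrite ?inE//; exact: measurable_cball.
Qed.

Lemma supported_bounded f r : ccontinuous f -> supported r f ->
  exists M, 0 <= M /\ forall x, normc (f x) <= M.
Proof.
move=> cf sf; have [M [M0 fM]] := ccontinuous_bounded cf (@cball_compact R d r).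
exists M; split => // x; have [xr|xr] := leP `|x| r; first exact: fM.
by rewrite sf// Normc.normc0.
Qed.

(** Heine's argument on the ball of radius r + 1. Beyond it, both points lie outside the support as
    soon as their distance is at most 1. *)
Lemma continuous_unif (u : Rd -> R) r : continuous u ->
    (forall x, r < `|x| -> u x = 0) ->
  forall e, 0 < e -> exists2 dl, 0 < dl &
    forall x y, `|x - y| <= dl -> `|u x - u y| <= e.
Proof.
move=> cu su e e0.
have /compact_near_coveringP/(_ R 0^'+
    (fun dl x => forall y, `|x - y| <= dl -> `|u x - u y| <= e)) := @cball_compact R d (r + 1).
case.
- move=> x _; have /cvgrPdist_le/(_ (e / 2)) := cu x.
  rewrite divr_gt0// => /(_ isT) /nbhs_ballP[eta /= eta0 heta].
  exists (ball x (eta / 2), [set t | t < eta / 2]).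
    split; first by apply: nbhsx_ballx; rewrite divr_gt0.
    by apply: nbhs_right_lt; rewrite divr_gt0.
  move=> [x' dl] /= []; rewrite -ball_normE/= => xx' ld y xy.
  have h1 : `|u x - u x'| <= e / 2.
    by apply: heta; rewrite -ball_normE/= (lt_le_trans xx')// ler_pdivrMr// ler_peMr ?ler1n// ltW.
  have h2 : `|u x - u y| <= e / 2.
    apply: heta; rewrite -ball_normE/= (le_lt_trans (ler_distD x' _ _))//.
    by rewrite (splitr eta) ltrD// (le_lt_trans xy).
  rewrite (le_trans (ler_distD (u x) _ _))// (splitr e) lerD//.
  by rewrite distrC.
- move=> dl0 /= dl00 hdl.
  pose dl := Num.min (dl0 / 2) 1.
  have dlp : 0 < dl by rewrite lt_min divr_gt0//=.
  have dlin : forall x, `|x| <= r + 1 -> forall y, `|x - y| <= dl -> `|u x - u y| <= e.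
    apply: (hdl dl) => //=; rewrite sub0r normrN gtr0_norm//.
    by rewrite gt_min ltr_pdivrMr// ltr_pMr// ltr1n.
  exists dl => // x y xy; have [xr|xr] := leP `|x| (r + 1); first exact: dlin.
  have yr : r < `|y|.
    have : `|x| <= `|x - y| + `|y| by rewrite -{1}(subrK y x) ler_normD.
    have : dl <= 1 by rewrite ge_min lexx orbT.
    by lra.
  by rewrite !su ?subrr ?normr0 ?ltW// (lt_trans _ xr)// ltrDl.
Qed.

Lemma ccontinuous_unif f r : ccontinuous f -> supported r f ->
  forall e, 0 < e -> exists2 dl, 0 < dl &
    forall x y, `|x - y| <= dl -> normc (f x - f y) <= e.
Proof.
move=> [f1 f2] sf e e0; have e2 : 0 < e / 2 by rewrite divr_gt0.
have s1 x : r < `|x| -> Re (f x) = 0 by move=> /sf ->.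
have s2 x : r < `|x| -> Im (f x) = 0 by move=> /sf ->.
have [d1 d10 h1] := continuous_unif f1 s1 e2.
have [d2 d20 h2] := continuous_unif f2 s2 e2.
exists (Num.min d1 d2); first by rewrite lt_min d10.
move=> x y; rewrite le_min => /andP[xy1 xy2].
rewrite (le_trans (normc_le_ReIm _))// cReD cImD cReN cImN (splitr e) lerD//.
  exact: h1.
exact: h2.
Qed.

End local_integrability.

(** * Test functions *)

Section smooth.
Context {R : realType} {d : nat}.
Local Notation Rd := 'rV[R]_d.
Local Notation C := R[i].
Local Notation Re := (@complex.Re R).
Local Notation Im := (@complex.Im R).
Local Notation normc := (@Normc.normc R).
Local Notation e_ i := (delta_mx ord0 i : Rd).
Implicit Types (f g h phi psi : Rd -> C) (r : R) (s : seq 'I_d).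

Lemma is_deriveP (V : normedModType R) (u : V -> R) (x v : V) (l : R) :
  is_derive x v u l <-> (forall e, 0 < e -> exists2 dl, 0 < dl &
    forall t : R, t != 0 -> `|t| < dl -> `|t^-1 * (u (t *: v + x) - u x) - l| <= e).
Proof.
pose q := fun t : R => t^-1 *: ((u \o shift x) (t *: v) - u x).
have -> : is_derive x v u l <-> q t @[t --> 0^'] --> l.
  split=> [[dv <-]|ql]; first exact: dv.
  by apply: DeriveDef; [apply: (cvgP l); exact: ql|exact/cvg_lim/ql].
split=> [/cvgrPdist_le h e e0|h].
  have [dl /= dl0 hdl] := h e e0; exists dl => // t t0 tdl.
  by rewrite distrC; apply: hdl => //=; rewrite sub0r normrN.
apply/cvgrPdist_le => e e0; have [dl dl0 hdl] := h e e0.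
exists dl => //= t /=; rewrite sub0r normrN => tdl t0.
by rewrite distrC; exact: hdl.
Qed.

(* [g] is the partial derivative of [f] in direction [i]. *)
Definition cdiff (i : 'I_d) f g := forall x e, 0 < e -> exists2 dl, 0 < dl &
  forall t : R, t != 0 -> `|t| < dl ->
    normc (t^-1%:C * (f (t *: e_ i + x) - f x) - g x) <= e.

Lemma cdiffP i f g : cdiff i f g <->
  forall x, is_derive x (e_ i) (fun y => Re (f y)) (Re (g x)) /\
            is_derive x (e_ i) (fun y => Im (f y)) (Im (g x)).
Proof.
split=> [h x|h x e e0].
  split; apply/is_deriveP => e e0; have [dl dl0 hdl] := h x e e0;
    exists dl => // t t0 /(hdl t t0); apply: le_trans.
    apply: le_trans (Re_le_normc _).
    by rewrite cReD cReM !cReD !cReN/= mul0r subr0.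
  apply: le_trans (Im_le_normc _).
  by rewrite cImD cImM !cImD !cImN/= mul0r addr0.
have [/is_deriveP h1 /is_deriveP h2] := h x.
have e2 : 0 < e / 2 by rewrite divr_gt0.
have [d1 d10 {}h1] := h1 _ e2; have [d2 d20 {}h2] := h2 _ e2.
exists (Num.min d1 d2); first by rewrite lt_min d10.
move=> t t0; rewrite lt_min => /andP[td1 td2].
rewrite (le_trans (normc_le_ReIm _))// (splitr e) lerD//.
  apply: le_trans (h1 t t0 td1).
  by rewrite cReD cReM !cReD !cReN/= mul0r subr0.
apply: le_trans (h2 t t0 td2).
by rewrite cImD cImM !cImD !cImN/= mul0r addr0.
Qed.

Lemma cpartials_cat s1 s2 f : cpartials (s1 ++ s2) f = cpartials s1 (cpartials s2 f).
Proof. by apply/funext => x; rewrite /cpartials /partials !foldr_cat. Qed.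

Lemma cpartials_nil f : cpartials [::] f = f.
Proof. by apply/funext => x; rewrite /cpartials/=; case: (f x). Qed.

Lemma csmooth_continuous f s : csmooth f -> ccontinuous (cpartials s f).
Proof. by move=> [f1 f2]; split; [exact: (f1 s).1|exact: (f2 s).1]. Qed.

Lemma csmooth_ccontinuous f : csmooth f -> ccontinuous f.
Proof. by move=> /(csmooth_continuous [::]); rewrite cpartials_nil. Qed.

Lemma csmooth_cdiff f s i : csmooth f ->
  cdiff i (cpartials s f) (cpartials (i :: s) f).
Proof.
move=> [f1 f2]; apply/cdiffP => x; split.
  by apply: derivableP; exact: (f1 s).2.
by apply: derivableP; exact: (f2 s).2.
Qed.

(** Smoothness is checked by proposing all iterated derivatives at once, one for each word of
    directions; by induction on the word they are the true ones. Affine images, linear combinations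
    and convolutions have an obvious such family. *)
Lemma csmooth_intro f (F : seq 'I_d -> Rd -> C) : F [::] = f ->
    (forall s, ccontinuous (F s)) ->
    (forall s i, cdiff i (F s) (F (i :: s))) ->
  csmooth f /\ forall s, cpartials s f = F s.
Proof.
move=> F0 cF dF.
have E s : partials s (fun y => Re (f y)) = (fun y => Re (F s y)) /\
           partials s (fun y => Im (f y)) = (fun y => Im (F s y)).
  elim: s => [|i s [ih1 ih2]]; first by rewrite /= F0.
  have /cdiffP dFs := dF s i; split; apply/funext => x /=.
    by rewrite ih1 /partial; have [[_ ->] _] := dFs x.
  by rewrite ih2 /partial; have [_ [_ ->]] := dFs x.
split; last first.
  by move=> s; apply/funext => x; rewrite /cpartials (E s).1 (E s).2; case: (F s x).
split=> s; rewrite ?(E s).1 ?(E s).2; split; [exact: (cF s).1| |exact: (cF s).2|].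
- by move=> i x; have /cdiffP/(_ x)[[? _] _] := dF s i.
- by move=> i x; have /cdiffP/(_ x)[_ [? _]] := dF s i.
Qed.

Lemma csmooth_partials f s : csmooth f -> csmooth (cpartials s f).
Proof.
move=> sf; apply: (@csmooth_intro _ (fun s' => cpartials (s' ++ s) f) _ _ _).1 => //.
- by move=> s'; exact: csmooth_continuous.
- by move=> s' i; exact: csmooth_cdiff.
Qed.

Lemma cdiff_lin i f g f' g' (a : C) : cdiff i f f' -> cdiff i g g' ->
  cdiff i (fun x => a * f x + g x) (fun x => a * f' x + g' x).
Proof.
move=> hf hg x e e0; have e2 : 0 < e / 2 by rewrite divr_gt0.
have a0 : 0 < normc a + 1 by rewrite ltr_wpDl// normc_ge0.
have e2a : 0 < e / 2 / (normc a + 1) by rewrite divr_gt0.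
have [d1 d10 h1] := hf x _ e2a; have [d2 d20 h2] := hg x _ e2.
exists (Num.min d1 d2); first by rewrite lt_min d10.
move=> t t0; rewrite lt_min => /andP[td1 td2].
rewrite (_ : _ - _ = a * (t^-1%:C * (f (t *: e_ i + x) - f x) - f' x) +
  (t^-1%:C * (g (t *: e_ i + x) - g x) - g' x)); last by ring.
rewrite (le_trans (le_normcD _ _))// (splitr e) lerD//; last exact: h2.
rewrite Normc.normcM (le_trans (ler_wpM2l (normc_ge0 a) (h1 _ t0 td1)))//.
by rewrite mulrCA ger_pMr// ler_pdivrMr// mul1r lerDl.
Qed.

Lemma ccontinuous_lin (a : C) f g : ccontinuous f -> ccontinuous g ->
  ccontinuous (fun x => a * f x + g x).
Proof.
move=> /ccontinuousP hf /ccontinuousP hg; apply/ccontinuousP => x e e0.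
have e2 : 0 < e / 2 by rewrite divr_gt0.
have a0 : 0 < normc a + 1 by rewrite ltr_wpDl// normc_ge0.
have e2a : 0 < e / 2 / (normc a + 1) by rewrite divr_gt0.
have [d1 d10 h1] := hf x _ e2a; have [d2 d20 h2] := hg x _ e2.
exists (Num.min d1 d2); first by rewrite lt_min d10.
move=> y; rewrite lt_min => /andP[xy1 xy2].
rewrite (_ : _ - _ = a * (f x - f y) + (g x - g y)); last by ring.
rewrite (le_trans (le_normcD _ _))// (splitr e) lerD//; last exact: h2.
rewrite Normc.normcM (le_trans (ler_wpM2l (normc_ge0 a) (h1 _ xy1)))//.
by rewrite mulrCA ger_pMr// ler_pdivrMr// mul1r lerDl.
Qed.

Lemma csmooth_lin (a : C) f g : csmooth f -> csmooth g ->
  csmooth (fun x => a * f x + g x) /\ forall s,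
  cpartials s (fun x => a * f x + g x) =
  fun x => a * cpartials s f x + cpartials s g x.
Proof.
move=> sf sg; apply: csmooth_intro => //.
- by rewrite !cpartials_nil.
- by move=> s; apply: ccontinuous_lin; exact: csmooth_continuous.
- by move=> s i; apply: cdiff_lin; exact: csmooth_cdiff.
Qed.

Lemma cdiff0 i : cdiff i (fun=> 0) (fun=> 0).
Proof.
move=> x e e0; exists 1 => // t _ _.
by rewrite !subr0 mulr0 Normc.normc0 ltW.
Qed.

Lemma ccontinuous_cst (a : C) : ccontinuous (fun _ : Rd => a).
Proof. by apply/ccontinuousP => x e e0; exists 1 => // y _; rewrite subrr Normc.normc0 ltW. Qed.

Lemma csmooth0 : csmooth (fun _ : Rd => 0 : C) /\
  forall s, cpartials s (fun _ : Rd => 0 : C) = fun=> 0.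
Proof.
apply: (@csmooth_intro _ (fun _ _ => 0)) => // [s|s i]; last exact: cdiff0.
exact: ccontinuous_cst.
Qed.

Lemma cdiff_affine i f f' (c : R) (b : Rd) : c != 0 -> cdiff i f f' ->
  cdiff i (fun x => f (c *: x + b)) (fun x => c%:C * f' (c *: x + b)).
Proof.
move=> c0 hf x e e0; have c0' : 0 < `|c| by rewrite normr_gt0.
have ec : 0 < e / `|c| by rewrite divr_gt0.
have [d1 d10 h1] := hf (c *: x + b) _ ec.
exists (d1 / `|c|); first by rewrite divr_gt0.
move=> t t0; rewrite ltr_pdivlMr// => td.
have ct0 : c * t != 0 by rewrite mulf_neq0.
have := h1 (c * t) ct0; rewrite normrM mulrC => /(_ td) h.
rewrite (_ : c *: (t *: e_ i + x) + b = (c * t) *: e_ i + (c *: x + b)); last first.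
  by rewrite scalerDr scalerA addrA.
rewrite (_ : _ - _ = c%:C * ((c * t)^-1%:C * (f ((c * t) *: e_ i + (c *: x + b)) - f (c *: x + b)) - f' (c *: x + b))); last first.
  rewrite [RHS]mulrBr; congr (_ - _); rewrite [RHS]mulrA -rmorphM/=; congr (_%:C * _).
  by rewrite invfM mulrA divff// mul1r.
by rewrite Normc.normcM normc_real mulrC -ler_pdivlMr.
Qed.

Lemma continuous_affine (c : R) (b : Rd) : continuous (fun x : Rd => c *: x + b).
Proof.
move=> x; apply: (@continuousD _ _ _ (fun x : Rd => c *: x) (fun=> b)).
  exact: scaler_continuous.
exact: cst_continuous.
Qed.

Lemma csmooth_affine f (c : R) (b : Rd) : c != 0 -> csmooth f ->
  csmooth (fun x => f (c *: x + b)) /\ forall s,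
  cpartials s (fun x => f (c *: x + b)) =
  fun x => (c ^+ size s)%:C * cpartials s f (c *: x + b).
Proof.
move=> c0 sf; apply: csmooth_intro => //.
- by apply/funext => x; rewrite expr0 mul1r cpartials_nil.
- move=> s; rewrite (_ : (fun _ => _) = fun x : Rd => (c ^+ size s)%:C * (cpartials s f \o (fun x => c *: x + b)) x + 0).
    apply: ccontinuous_lin; last exact: ccontinuous_cst.
    apply: ccontinuous_comp; first exact: continuous_affine.
    exact: csmooth_continuous.
  by apply/funext => x; rewrite addr0.
- move=> s i; have := cdiff_lin (c ^+ size s)%:C (cdiff_affine b c0 (csmooth_cdiff s i sf)) (cdiff0 i).
  congr cdiff; apply/funext => x; rewrite ?addr0//.
  by rewrite ?addr0 mulrA -rmorphM/= exprSr.
Qed.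

(** Off the closed ball of radius [r] a short step in any direction stays off it, so the difference
    quotients vanish. *)
Lemma supported_cdiff i f g r : cdiff i f g -> supported r f -> supported r g.
Proof.
move=> hf sf x rx; apply: Normc.eq0_normc; apply/eqP; rewrite eq_le normc_ge0 andbT.
apply/ler_addgt0Pl => e e0; rewrite addr0.
have [dl dl0 hdl] := hf x e e0.
have ei : 0 < `|e_ i| + 1 by rewrite ltr_wpDl.
(* The second bound gives t |e_i| < |x| - r, so that x + t e_i does not enter the ball; the 1 added
   to |e_i| makes the divisor visibly positive. *)
pose t := Num.min (dl / 2) ((`|x| - r) / (`|e_ i| + 1) / 2).
have t0 : 0 < t by rewrite lt_min !divr_gt0// subr_gt0.
have := hdl t (lt0r_neq0 t0); rewrite (sf x)// (sf (t *: _ + x)).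
  rewrite subr0 mulr0 sub0r normcN; apply.
  by rewrite gtr0_norm// gt_min ltr_pdivrMr// ltr_pMr// ltr1n.
have : `|x| <= `|t *: e_ i + x| + `|t *: e_ i|.
  by rewrite -{1}(addKr (t *: e_ i) x) addrC (le_trans (ler_normB _ _)).
rewrite normrZ (gtr0_norm t0).
have : t * `|e_ i| < `|x| - r.
  apply: (@le_lt_trans _ _ (t * (`|e_ i| + 1))); first by rewrite ler_pM2l// lerDl.
  rewrite -ltr_pdivlMr// gt_min; apply/orP; right.
  by rewrite ltr_pdivrMr// ltr_pMr ?ltr1n// divr_gt0// subr_gt0.
lra.
Qed.

Lemma supported_partials f s r : csmooth f -> supported r f ->
  supported r (cpartials s f).
Proof.
move=> sf spf; elim: s => [|i s ih]; first by rewrite cpartials_nil.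
exact: supported_cdiff (csmooth_cdiff s i sf) ih.
Qed.

(** Supports are tracked by a radius instead of a compact set, so that those of reflections, dilates
    and convolutions are computed by arithmetic. *)
Definition ctest r f := csmooth f /\ supported r f.

Lemma test_funP f : test_fun f <-> exists r, 0 < r /\ ctest r f.
Proof.
split=> [[K [cK [sf fK]]]|[r [r0 [sf fr]]]].
  have [r [r0 Kr]] := compact_sub_cball cK; exists r; split => //; split => // x rx.
  by apply: fK => /Kr; rewrite /cball/= leNgt rx.
exists (cball r); split; first exact: cball_compact.
by split => // x /negP; rewrite -ltNge; exact: fr.
Qed.

Lemma ctest_test_fun r f : ctest r f -> test_fun f.
Proof.
move=> [sf fr]; apply/test_funP; exists (`|r| + 1); split; first by rewrite ltr_wpDl.
by split => // x rx; apply: fr; rewrite (le_lt_trans (ler_norm r))// (lt_trans _ rx)// ltrDl.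
Qed.

Lemma ctest_le r r' f : r <= r' -> ctest r f -> ctest r' f.
Proof. by move=> rr [sf fr]; split => // x r'x; apply: fr; exact: le_lt_trans r'x. Qed.

Lemma ctest_partials r f s : ctest r f -> ctest r (cpartials s f).
Proof. by move=> [sf fr]; split; [exact: csmooth_partials|exact: supported_partials]. Qed.

Lemma ctest_lin r (a : C) f g : ctest r f -> ctest r g -> ctest r (fun x => a * f x + g x).
Proof.
move=> [sf fr] [sg gr]; split; first exact: (csmooth_lin a sf sg).1.
by move=> x rx; rewrite fr// gr// mulr0 addr0.
Qed.

Lemma ctest0 r : ctest r (fun=> 0).
Proof. by split => //; exact: csmooth0.1. Qed.

Lemma ctest_affine r f (c : R) (b : Rd) : c != 0 -> ctest r f ->
  ctest ((r + `|b|) / `|c|) (fun x => f (c *: x + b)).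
Proof.
move=> c0 [sf fr]; split; first exact: (csmooth_affine b c0 sf).1.
move=> x; rewrite ltr_pdivrMr ?normr_gt0// mulrC -normrZ => h.
apply: fr; have : `|c *: x| <= `|c *: x + b| + `|b|.
  by rewrite -{1}(addrK b (c *: x)) (le_trans (ler_normB _ _)).
lra.
Qed.

Lemma ctest_sum r (I : Type) (l : seq I) (F : I -> Rd -> C) :
  (forall i, ctest r (F i)) -> ctest r (fun x => \sum_(i <- l) F i x).
Proof.
move=> hF; elim: l => [|i l ih].
  by under eq_fun do rewrite big_nil; exact: ctest0.
under eq_fun do rewrite big_cons; rewrite (_ : (fun _ => _) = fun x => 1 * F i x + \sum_(j <- l) F j x).
  exact: ctest_lin.
by apply/funext => x; rewrite mul1r.
Qed.

Lemma cpartials_sum r (I : Type) (l : seq I) (F : I -> Rd -> C) s :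
  (forall i, ctest r (F i)) -> cpartials s (fun x => \sum_(i <- l) F i x) =
    fun x => \sum_(i <- l) cpartials s (F i) x.
Proof.
move=> hF; elim: l => [|i l ih].
  under eq_fun do rewrite big_nil; under [RHS]eq_fun do rewrite big_nil.
  exact: csmooth0.2.
under eq_fun do rewrite big_cons; under [RHS]eq_fun do rewrite big_cons.
rewrite (_ : (fun _ => _) = fun x => 1 * F i x + \sum_(j <- l) F j x).
  rewrite (csmooth_lin 1 (hF i).1 (ctest_sum l hF).1).2 ih.
  by apply/funext => x; rewrite mul1r.
by apply/funext => x; rewrite mul1r.
Qed.

(** Mean value theorem on the segment from x to x + t e_i, then uniform continuity of the partial
    derivative, which again has compact support. The uniformity in x allows differentiation under
    the integral of a convolution. *)
Lemma cdiff_unif i r f : ctest r f -> forall e, 0 < e -> exists2 dl, 0 < dl &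
  forall t : R, t != 0 -> `|t| < dl -> forall x,
    normc (t^-1%:C * (f (t *: e_ i + x) - f x) - cpartials [:: i] f x) <= e.
Proof.
move=> [sf fr] e e0; have e2 : 0 < e / 2 by rewrite divr_gt0.
have [dl dl0 hdl] := ccontinuous_unif (csmooth_continuous [:: i] sf)
  (supported_partials [:: i] sf fr) e2.
have ei : 0 < `|e_ i| + 1 by rewrite ltr_wpDl.
exists (dl / (`|e_ i| + 1)); first by rewrite divr_gt0.
move=> t t0; rewrite ltr_pdivlMr// => tdl x.
(* Stated for real functions, because the intermediate points for the real and the imaginary part
   differ. *)
have key (u v : Rd -> R) : continuous u -> (forall y, is_derive y (e_ i) u (v y)) ->
    (forall x y, `|x - y| <= dl -> `|v x - v y| <= e / 2) ->
    `|t^-1 * (u (t *: e_ i + x) - u x) - v x| <= e / 2.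
  move=> cu dv hv.
  pose p := fun z : R => u (z *: e_ i + x).
  have dp (z : R) : is_derive z 1 p (v (z *: e_ i + x)).
    apply/is_deriveP => e' e'0; have /is_deriveP/(_ _ e'0)[d' d'0 hd'] := dv (z *: e_ i + x).
    exists d' => // z' z'0 z'd; have := hd' z' z'0 z'd.
    by rewrite /p addrA -scalerDl [_ *: 1]mulr1.
  have cp : continuous p.
    by move=> z; apply/differentiable_continuous/derivable1_diffP; case: (dp z).
  have [z zt ->] : exists2 z, `|z| <= `|t| & u (t *: e_ i + x) - u x = v (z *: e_ i + x) * t.
    have p0 : p 0 = u x by rewrite /p scale0r add0r.
    rewrite -p0 -/(p t); have [tn|tp|/eqP] := ltgtP t 0; last by rewrite (negbTE t0).
    - have [z zin ez] := MVT tn (fun x _ => dp x) (continuous_subspaceT cp).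
      move: zin; rewrite in_itv/= => /andP[z1 z2]; exists z.
        by rewrite !ltr0_norm// lerN2 ltW.
      by rewrite -opprB ez sub0r mulrN opprK.
    - have [z zin ez] := MVT tp (fun x _ => dp x) (continuous_subspaceT cp).
      move: zin; rewrite in_itv/= => /andP[z1 z2]; exists z.
        by rewrite !gtr0_norm// ltW.
      by rewrite ez subr0.
  rewrite mulrCA mulVf// mulr1 hv// addrK normrZ ltW//.
  rewrite (le_lt_trans _ tdl)// ler_pM//.
  by rewrite ?lerDl// ler_wpDr.
have /cdiffP hd := csmooth_cdiff [::] i sf.
rewrite (le_trans (normc_le_ReIm _))// (splitr e) lerD//.
- rewrite cReD cReM !cReD !cReN/= mul0r subr0.
  apply: (key (fun x => Re (f x)) (fun x => Re (cpartials [:: i] f x))).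
  + exact: (csmooth_ccontinuous sf).1.
  + by move=> y; exact: (hd y).1.
  + move=> y z yz; apply: le_trans (hdl _ _ yz).
    by rewrite -cReN -cReD Re_le_normc.
- rewrite cImD cImM !cImD !cImN/= mul0r addr0.
  apply: (key (fun x => Im (f x)) (fun x => Im (cpartials [:: i] f x))).
  + exact: (csmooth_ccontinuous sf).2.
  + by move=> y; exact: (hd y).2.
  + move=> y z yz; apply: le_trans (hdl _ _ yz).
    by rewrite -cImN -cImD Im_le_normc.
Qed.

End smooth.

(** * Convolution of functions *)

Section convolution.
Context {R : realType} {d : nat}.
Local Notation Rd := 'rV[R]_d.
Local Notation C := R[i].
Local Notation e_ i := (delta_mx ord0 i : Rd).
Local Notation conv := (@Defs.conv R d).
Implicit Types (f g h phi psi : Rd -> C) (r : R) (s : seq 'I_d).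

Lemma subrVE (x y : Rd) : x - y = (-1) *: y + x.
Proof. by rewrite scaleN1r addrC. Qed.

Lemma ccontinuous_reflect f (x : Rd) : ccontinuous f -> ccontinuous (fun y => f (x - y)).
Proof.
move=> cf; rewrite (_ : (fun _ => _) = f \o (fun y => (-1) *: y + x)).
  by apply: ccontinuous_comp => //; exact: continuous_affine.
by apply/funext => y /=; rewrite -subrVE.
Qed.

Lemma supported_reflect f r (x : Rd) : supported r f -> supported (r + `|x|) (fun y => f (x - y)).
Proof.
move=> fr y ry; apply: fr; have : `|y| <= `|x - y| + `|x|.
  by rewrite -{1}(subKr x y) (le_trans (ler_normB _ _))// addrC.
by lra.
Qed.

Arguments supported_reflect {f r} x _.

Lemma csmooth_reflect f (x : Rd) : csmooth f -> csmooth (fun y => f (x - y)) /\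
  forall s, cpartials s (fun y => f (x - y)) =
    fun y => ((-1) ^+ size s)%:C * cpartials s f (x - y).
Proof.
move=> sf; have n1 : -1 != 0 :> R by rewrite oppr_eq0 oner_eq0.
have -> : (fun y => f (x - y)) = (fun y => f ((-1) *: y + x)).
  by apply/funext => y; rewrite subrVE.
have [h1 h2] := csmooth_affine x n1 sf; split => // s; rewrite h2.
by apply/funext => y; rewrite subrVE.
Qed.

Lemma ctest_reflect f r (x : Rd) : ctest r f -> ctest (r + `|x|) (fun y => f (x - y)).
Proof. by move=> [sf fr]; split; [exact: (csmooth_reflect x sf).1|exact: supported_reflect]. Qed.

(** The substitution t = x - y turns the integral defining [conv] into the pairing of [h] with phi(x
    - .), the form that makes sense for distributions. *)
Lemma conv_pairing h phi r (x : Rd) : L1loc h -> ccontinuous phi -> supported r phi ->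
  cintegrable (fun y => h y * phi (x - y)) /\
  cintegrable (fun t => h (x - t) * phi t) /\
  conv h phi x = cintegral (fun y => h y * phi (x - y)).
Proof.
move=> Lh cp sp; have [M [M0 hM]] := supported_bounded cp sp.
have cp' := ccontinuous_reflect x cp.
have [i1 _] := L1loc_pairing Lh (ccontinuous_measurable cp') (supported_reflect x sp) (fun y => hM (x - y)).
have n1 : -1 != 0 :> R by rewrite oppr_eq0 oner_eq0.
have [i2 e2] := cintegral_affine x n1 i1.
have E : (fun t => h (x - t) * phi t) = (fun y => h (-1 *: y + x) * phi (x - (-1 *: y + x))).
  by apply/funext => t; rewrite -subrVE subKr.
split => //; split; first by rewrite E.
by rewrite /conv E e2 normrN1 expr1n invr1 mul1r.
Qed.

Lemma conv_regular h phi r : L1loc h -> ccontinuous phi -> supported r phi ->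
  conv h phi = dconv (regular_dist h) phi.
Proof. by move=> Lh cp sp; apply/funext => x; have [_ [_ ->]] := conv_pairing x Lh cp sp. Qed.

Lemma convC phi psi r r' : ccontinuous phi -> supported r phi ->
  ccontinuous psi -> supported r' psi -> conv phi psi = conv psi phi.
Proof.
move=> cp sp cq sq; apply/funext => x.
have [_ [_ ->]] := conv_pairing x (ccontinuous_L1loc cp) cq sq.
by rewrite /conv; congr cintegral; apply/funext => t; rewrite mulrC.
Qed.

Lemma conv_supported phi psi r r' : supported r phi -> supported r' psi ->
  supported (r + r') (conv phi psi).
Proof.
move=> sp sq x rx; rewrite /conv (_ : (fun _ => _) = fun=> 0) ?cintegral0//.
apply/funext => t; have [tr|tr] := leP `|t| r'; last by rewrite sq// mulr0.
rewrite sp ?mul0r//; have : `|x| <= `|x - t| + `|t| by rewrite -{1}(subrK t x) ler_normD.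
by lra.
Qed.

Lemma regular_distB h phi psi r : L1loc h -> ccontinuous phi -> supported r phi ->
  ccontinuous psi -> supported r psi ->
  regular_dist h (fun y => phi y - psi y) = regular_dist h phi - regular_dist h psi.
Proof.
move=> Lh cp sp cq sq; rewrite /regular_dist.
have [M [_ hM]] := supported_bounded cp sp; have [M' [_ hM']] := supported_bounded cq sq.
have [i1 _] := L1loc_pairing Lh (ccontinuous_measurable cp) sp hM.
have [i2 _] := L1loc_pairing Lh (ccontinuous_measurable cq) sq hM'.
by rewrite -cintegralB//; congr cintegral; apply/funext => x; rewrite mulrBr.
Qed.

Lemma supported_le r r' f : r <= r' -> supported r f -> supported r' f.
Proof. by move=> rr' sf x r'x; apply: sf; exact: le_lt_trans r'x. Qed.

Lemma locmass_bound (m e : R) : 0 <= m -> 0 < e -> 2 * (e / (2 * m + 1) * m) <= e.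
Proof.
move=> m0 e0; have m1 : 0 < 2 * m + 1 by lra.
rewrite (_ : _ * _ = e * ((2 * m) / (2 * m + 1))); last by field; rewrite gt_eqF.
by rewrite ger_pMr// ler_pdivrMr// mul1r lerDl.
Qed.

Lemma ccontinuous_conv h phi r : L1loc h -> ccontinuous phi -> supported r phi ->
  ccontinuous (conv h phi).
Proof.
move=> Lh cp sp; apply/ccontinuousP => x e e0.
(* For |x - y| < 1 both phi(x - .) and phi(y - .) are supported in this ball, so a single mass
   bounds all the pairings. *)
pose m := locmass h (r + (`|x| + 1)).
have m0 : 0 <= m by exact: locmass_ge0.
have e1 : 0 < e / (2 * m + 1) by rewrite divr_gt0// ltr_wpDl// mulr_ge0.
have [dl dl0 hdl] := ccontinuous_unif cp sp e1.
exists (Num.min dl 1); first by rewrite lt_min dl0/=.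
move=> y; rewrite lt_min => /andP[xy1 xy2].
have yx : `|y| <= `|x| + 1.
  have : `|y| <= `|x - y| + `|x| by rewrite -{1}(subKr x y) (le_trans (ler_normB _ _))// addrC.
  by lra.
have s1 : supported (r + (`|x| + 1)) (fun z => phi (x - z)).
  by apply: (supported_le _ (supported_reflect x sp)); rewrite lerD2l lerDl.
have s2 : supported (r + (`|x| + 1)) (fun z => phi (y - z)).
  by apply: (supported_le _ (supported_reflect y sp)); rewrite lerD2l.
have c1 := ccontinuous_reflect x cp; have c2 := ccontinuous_reflect y cp.
rewrite (conv_regular Lh cp sp) /dconv -(regular_distB Lh c1 s1 c2 s2).
apply: (le_trans _ (locmass_bound m0 e0)).
apply: regular_dist_bound => //.
- exact: ccontinuous_measurable (ccontinuousB c1 c2).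
- by move=> z rz; rewrite s1// s2// subr0.
- move=> z; apply: hdl.
  by rewrite (_ : _ - _ = x - y) ?ltW// opprB addrA subrK.
Qed.

(** The difference quotient of the convolution is the pairing of [h] with that of [phi], which
    converges uniformly while the supports stay in a fixed ball. *)
Lemma cdiff_conv h phi r i : L1loc h -> ctest r phi ->
  cdiff i (conv h phi) (conv h (cpartials [:: i] phi)).
Proof.
move=> Lh tp x e e0; have [sp rp] := tp.
pose m := locmass h (r + (`|x| + 1)).
have m0 : 0 <= m by exact: locmass_ge0.
have e1 : 0 < e / (2 * m + 1) by rewrite divr_gt0// ltr_wpDl// mulr_ge0.
have [dl dl0 hdl] := cdiff_unif i tp e1.
have ei : 0 < `|e_ i| + 1 by rewrite ltr_wpDl.
exists (Num.min dl (1 / (`|e_ i| + 1))); first by rewrite lt_min dl0/= divr_gt0.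
move=> t t0; rewrite lt_min ltr_pdivlMr// => /andP[td1 td2].
pose y := t *: e_ i + x.
have yx : `|y| <= `|x| + 1.
  rewrite (le_trans (ler_normD _ _))// addrC lerD2l normrZ (le_trans _ (ltW td2))//.
  by rewrite ler_wpM2l// lerDl.
have cp := csmooth_ccontinuous sp.
have s1 : supported (r + (`|x| + 1)) (fun z => phi (x - z)).
  by apply: (supported_le _ (supported_reflect x rp)); rewrite lerD2l lerDl.
have s2 : supported (r + (`|x| + 1)) (fun z => phi (y - z)).
  by apply: (supported_le _ (supported_reflect y rp)); rewrite lerD2l.
have c1 := ccontinuous_reflect x cp; have c2 := ccontinuous_reflect y cp.
have [sp' rp'] := ctest_partials [:: i] tp.
have cp' := csmooth_ccontinuous sp'.
have s3 : supported (r + (`|x| + 1)) (fun z => cpartials [:: i] phi (x - z)).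
  by apply: (supported_le _ (supported_reflect x rp')); rewrite lerD2l lerDl.
have c3 := ccontinuous_reflect x cp'.
rewrite (conv_regular Lh cp rp) (conv_regular Lh cp' rp') /dconv -/y.
rewrite -(regular_distB Lh c2 s2 c1 s1).
have c21 := ccontinuousB c2 c1.
have s21 : supported (r + (`|x| + 1)) (fun z => phi (y - z) - phi (x - z)).
  by move=> z rz; rewrite s1// s2// subr0.
have E : t^-1%:C * regular_dist h (fun z => phi (y - z) - phi (x - z)) =
         regular_dist h (fun z => t^-1%:C * (phi (y - z) - phi (x - z))).
  rewrite /regular_dist -cintegralZ.
    by congr cintegral; apply/funext => z; rewrite mulrCA.
  have [M [_ hM]] := supported_bounded c21 s21.
  by have [] := L1loc_pairing Lh (ccontinuous_measurable c21) s21 hM.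
have c4 : ccontinuous (fun z => t^-1%:C * (phi (y - z) - phi (x - z))).
  have := ccontinuous_lin t^-1%:C c21 (ccontinuous_cst 0).
  by congr ccontinuous; apply/funext => z; rewrite addr0.
have s4 : supported (r + (`|x| + 1)) (fun z => t^-1%:C * (phi (y - z) - phi (x - z))).
  by move=> z rz; rewrite s21// mulr0.
rewrite E -(regular_distB Lh c4 s4 c3 s3).
apply: (le_trans _ (locmass_bound m0 e0)).
apply: regular_dist_bound => //.
- exact: ccontinuous_measurable (ccontinuousB c4 c3).
- by move=> z rz; rewrite s4// s3// subr0.
- by move=> z; have := hdl t t0 td1 (x - z); rewrite /y addrA.
Qed.

Lemma csmooth_conv h phi r : L1loc h -> ctest r phi ->
  csmooth (conv h phi) /\
  forall s, cpartials s (conv h phi) = conv h (cpartials s phi).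
Proof.
move=> Lh tp; apply: csmooth_intro; first by rewrite cpartials_nil.
- move=> s; have [sp rp] := ctest_partials s tp.
  exact: ccontinuous_conv (csmooth_ccontinuous sp) rp.
- move=> s i; have := cdiff_conv i Lh (ctest_partials s tp).
  by rewrite -cpartials_cat.
Qed.

Lemma ctest_conv phi psi r r' : ctest r phi -> ctest r' psi -> ctest (r + r') (conv phi psi).
Proof.
move=> [sp rp] tq; split; last exact: conv_supported rp tq.2.
exact: (csmooth_conv (ccontinuous_L1loc (csmooth_ccontinuous sp)) tq).1.
Qed.

Lemma conv_ctestC phi psi r r' : ctest r phi -> ctest r' psi -> conv phi psi = conv psi phi.
Proof.
move=> [/csmooth_ccontinuous cp rp] [/csmooth_ccontinuous cq rq].
exact: convC cp rp cq rq.
Qed.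

(** [csmooth_conv] puts derivatives on the second factor; commutativity exchanges the factors and
    lets the rest fall on the first. *)
Lemma cpartials_conv phi psi r r' s1 s2 : ctest r phi -> ctest r' psi ->
  cpartials (s1 ++ s2) (conv phi psi) = conv (cpartials s1 phi) (cpartials s2 psi).
Proof.
move=> tp tq; have Lp := ccontinuous_L1loc (csmooth_ccontinuous tp.1).
rewrite cpartials_cat (csmooth_conv Lp tq).2.
have tq2 := ctest_partials s2 tq.
have Lq := ccontinuous_L1loc (csmooth_ccontinuous tq2.1).
rewrite (conv_ctestC tp tq2) (csmooth_conv Lq tp).2.
exact: conv_ctestC tq2 (ctest_partials s1 tp).
Qed.

(** Mixed derivatives of a convolution commute because the convolution does: one word falls on each
    factor, and the factors are exchanged. This is how words are brought to the order prescribed by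
    a multi-index. *)
Lemma cpartials_convC phi psi r r' s1 s2 : ctest r phi -> ctest r' psi ->
  cpartials (s1 ++ s2) (conv phi psi) = cpartials (s2 ++ s1) (conv phi psi).
Proof.
move=> tp tq; rewrite (cpartials_conv _ _ tp tq).
rewrite (conv_ctestC (ctest_partials s1 tp) (ctest_partials s2 tq)).
by rewrite -(cpartials_conv _ _ tq tp) (conv_ctestC tp tq).
Qed.

End convolution.

Arguments supported_reflect {R d f r} x _.

(** * Convolution of distributions with test functions *)

Section distributions.
Context {R : realType} {d : nat}.
Local Notation Rd := 'rV[R]_d.
Local Notation C := R[i].
Local Notation mu := (@lebesgue_rV R d).
Local Notation normc := (@Normc.normc R).
Local Notation conv := (@Defs.conv R d).
Implicit Types (f g h phi psi theta : Rd -> C) (r : R) (s : seq 'I_d).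
Implicit Types (T : @functional R d) (alpha : {ffun 'I_d -> nat}).

Definition word alpha : seq 'I_d := flatten [seq nseq (alpha i) i | i <- enum 'I_d].

Lemma cderivE alpha f : cderiv alpha f = cpartials (word alpha) f.
Proof. by []. Qed.

Lemma size_word alpha : size (word alpha) = mdeg alpha.
Proof.
rewrite /word /mdeg size_flatten /shape -map_comp sumnE big_map big_enum/=.
by apply: eq_bigr => i _; rewrite size_nseq.
Qed.

Lemma dist_lin T (a : C) r phi psi : is_distribution T -> ctest r phi -> ctest r psi ->
  T (fun x => a * phi x + psi x) = a * T phi + T psi.
Proof. by move=> [h _] /ctest_test_fun tp /ctest_test_fun tq; exact: h. Qed.

Lemma dist0 T : is_distribution T -> T (fun=> 0) = 0.
Proof.
move=> hT; have := dist_lin (-1) hT (@ctest0 R d 0) (@ctest0 R d 0).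
by under eq_fun do rewrite mulr0 addr0; rewrite mulN1r addNr.
Qed.

Lemma distB T r phi psi : is_distribution T -> ctest r phi -> ctest r psi ->
  T (fun x => phi x - psi x) = T phi - T psi.
Proof.
move=> hT tp tq; have := dist_lin (-1) hT tq tp; rewrite mulN1r addrC => <-.
by congr T; apply/funext => x; rewrite mulN1r addrC.
Qed.

Lemma dist_sum T r (I : Type) (l : seq I) (c : I -> C) (F : I -> Rd -> C) :
  is_distribution T -> (forall i, ctest r (F i)) ->
  T (fun x => \sum_(i <- l) c i * F i x) = \sum_(i <- l) c i * T (F i).
Proof.
move=> hT hF; elim: l => [|i l ih].
  by under eq_fun do rewrite big_nil; rewrite big_nil dist0.
under eq_fun do rewrite big_cons; rewrite big_cons -ih (dist_lin (c i) hT (hF i))//.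
apply: ctest_sum => j; have := ctest_lin (c j) (hF j) (@ctest0 R d r).
by congr ctest; apply/funext => x; rewrite addr0.
Qed.

(** Replaces the seminorm, a supremum, by any pointwise bound [e]. Words of length at most N cover
    the multi-indices, and a nonnegative constant allows the bound to be enlarged. *)
Lemma dist_bound T r : is_distribution T -> exists (N : nat) (c : R), 0 <= c /\
  forall phi e, ctest r phi ->
    (forall s x, (size s <= N)%N -> normc (cpartials s phi x) <= e) ->
    normc (T phi) <= c * e.
Proof.
move=> [_ /(_ (cball r) (@cball_compact R d r))[N [c h]]].
exists N, `|c|; split => // phi e [sp rp] he.
have tp : test_on (cball r) phi.
  by split => // x /negP; rewrite -ltNge; exact: rp.
apply: (le_trans (h _ tp)).
pose S := [set t | exists alpha x, (mdeg alpha <= N)%N /\ t = normc (cderiv alpha phi x)].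
have Se t : S t -> t <= e.
  by move=> [alpha [x [aN ->]]]; apply: he; rewrite size_word.
have S0 : S !=set0.
  exists (normc (cderiv [ffun=> 0%N] phi 0)), [ffun=> 0%N], 0; split => //.
  by rewrite /mdeg big1// => i _; rewrite ffunE.
have le1 : test_norm N phi <= e by apply: ge_sup.
have le0 : 0 <= test_norm N phi.
  have [t St] := S0; apply: (@le_trans _ _ t).
    by have [alpha [x [_ ->]]] := St; exact: normc_ge0.
  by apply: ub_le_sup => //; exists e.
apply: (@le_trans _ _ (`|c| * test_norm N phi)); first by rewrite ler_wpM2r// ler_norm.
by rewrite ler_wpM2l.
Qed.

Lemma regular_dist_lin h r (a : C) phi psi : L1loc h ->
  ccontinuous phi -> supported r phi -> ccontinuous psi -> supported r psi ->
  regular_dist h (fun x => a * phi x + psi x) = a * regular_dist h phi + regular_dist h psi.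
Proof.
move=> Lh cp sp cq sq; rewrite /regular_dist.
have [M [_ hM]] := supported_bounded cp sp; have [M' [_ hM']] := supported_bounded cq sq.
have [i1 _] := L1loc_pairing Lh (ccontinuous_measurable cp) sp hM.
have [i2 _] := L1loc_pairing Lh (ccontinuous_measurable cq) sq hM'.
rewrite -cintegralZ// -cintegralD//; last exact: cintegrableZ.
by congr cintegral; apply/funext => x; ring.
Qed.

(** The order is 0: on each ball, twice the mass of |h| serves as the constant. *)
Lemma regular_dist_distribution h : L1loc h -> is_distribution (regular_dist h).
Proof.
move=> Lh; split.
  move=> a phi psi /test_funP[r1 [r10 t1]] /test_funP[r2 [r20 t2]].
  have [sp rp] : ctest (r1 + r2) phi by apply: ctest_le t1; rewrite lerDl ltW.
  have [sq rq] : ctest (r1 + r2) psi by apply: ctest_le t2; rewrite lerDr ltW.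
  exact: (regular_dist_lin a Lh (csmooth_ccontinuous sp) rp (csmooth_ccontinuous sq) rq).
move=> K cK; have [r [r0 Kr]] := compact_sub_cball cK.
exists 0%N, (2 * locmass h r) => phi [sp Kp].
have rp : supported r phi.
  by move=> x rx; apply: Kp => /Kr; rewrite /cball/= leNgt rx.
have cp := csmooth_ccontinuous sp.
rewrite -mulrA (mulrC (locmass _ _)).
apply: regular_dist_bound => //; first exact: ccontinuous_measurable.
have [M [M0 hM]] := supported_bounded cp rp.
have E alpha : (mdeg alpha <= 0)%N -> cderiv alpha phi = phi.
  by rewrite -size_word leqn0 size_eq0 => /eqP w0; rewrite cderivE w0 cpartials_nil.
move=> x; apply: ub_le_sup.
  by exists M => t [alpha [y [a0 ->]]]; rewrite E.
have m0 : (@mdeg d [ffun=> 0%N] <= 0)%N.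
  by rewrite /mdeg big1// => i _; rewrite ffunE.
by exists [ffun=> 0%N], x; split => //; rewrite E.
Qed.

Lemma finite_min n (P : 'I_n -> R -> Prop) :
    (forall i a b, a <= b -> P i b -> P i a) ->
    (forall i, exists2 a, 0 < a & P i a) ->
  exists2 a, 0 < a & forall i, P i a.
Proof.
move=> Pmon hP.
have /choice[a ha] : forall i, exists a, 0 < a /\ P i a.
  by move=> i; have [a a0 Pa] := hP i; exists a.
have h0 (J : seq 'I_n) : exists2 b, 0 < b & forall i, i \in J -> P i b.
  elim: J => [|j J [b b0 hb]]; first by exists 1.
  exists (Num.min b (a j)); first by rewrite lt_min b0; have [] := ha j.
  move=> i; rewrite inE => /orP[/eqP ->|iJ].
    by apply: Pmon (ha j).2; rewrite ge_min lexx orbT.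
  by apply: Pmon (hb i iJ); rewrite ge_min lexx.
have [b b0 hb] := h0 (enum 'I_n); exists b => // i; apply: hb.
by rewrite mem_enum.
Qed.

Lemma ctest_unif N r phi : ctest r phi -> forall e, 0 < e -> exists2 dl, 0 < dl &
  forall s, (size s <= N)%N -> forall x y, `|x - y| <= dl ->
    normc (cpartials s phi x - cpartials s phi y) <= e.
Proof.
elim: N r phi => [|N ih] r phi tp e e0.
  have [dl dl0 hdl] := ccontinuous_unif (csmooth_ccontinuous tp.1) tp.2 e0.
  by exists dl => // s; rewrite leqn0 size_eq0 => /eqP ->; rewrite cpartials_nil.
have [dl dl0 hdl] := ih r phi tp e e0.
have [dl' dl'0 hdl'] := @finite_min d (fun i a => forall s, (size s <= N)%N -> forall x y, `|x - y| <= a ->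
    normc (cpartials s (cpartials [:: i] phi) x - cpartials s (cpartials [:: i] phi) y) <= e)
    (fun i a b ab H s sN x y xy => H s sN x y (le_trans xy ab))
    (fun i => ih r _ (ctest_partials [:: i] tp) e e0).
exists (Num.min dl dl'); first by rewrite lt_min dl0.
(* The last letter of a word is the derivative applied first; the others act on a first partial of
   [phi], to which the induction hypothesis applies. *)
case/lastP => [_ x y|s i].
  by rewrite le_min => /andP[xy _]; exact: hdl.
rewrite size_rcons ltnS => sN x y; rewrite le_min => /andP[_ xy].
by rewrite -cats1 cpartials_cat; exact: hdl'.
Qed.

(** The derivatives of phi(x - .) - phi(y - .) up to the local order of [T] are uniformly small, and
    one ball contains the supports for all points of norm at most rho. *)
Lemma dconv_unif T phi r : is_distribution T -> ctest r phi ->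
  forall rho e, 0 < e -> exists2 dl, 0 < dl & forall x y, `|x| <= rho -> `|y| <= rho ->
    `|x - y| <= dl -> normc (dconv T phi x - dconv T phi y) <= e.
Proof.
move=> hT tp rho e e0.
have [N [c [c0 hc]]] := dist_bound (r + rho) hT.
have e1 : 0 < e / (c + 1) by rewrite divr_gt0// ltr_wpDl.
have [dl dl0 hdl] := ctest_unif N tp e1.
exists dl => // x y xr yr xy; rewrite /dconv.
have tx : ctest (r + rho) (fun z => phi (x - z)).
  by apply: ctest_le (ctest_reflect x tp); rewrite lerD2l.
have ty : ctest (r + rho) (fun z => phi (y - z)).
  by apply: ctest_le (ctest_reflect y tp); rewrite lerD2l.
rewrite -(distB hT tx ty).
apply: (@le_trans _ _ (c * (e / (c + 1)))); last first.
  by rewrite mulrCA ger_pMr// ler_pdivrMr ?ltr_wpDl// mul1r lerDl.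
apply: hc.
  have := ctest_lin (-1) ty tx; congr ctest.
  by apply/funext => z; rewrite mulN1r addrC.
move=> s z sN.
have -> : cpartials s (fun z => phi (x - z) - phi (y - z)) z =
   ((-1) ^+ size s)%:C * (cpartials s phi (x - z) - cpartials s phi (y - z)).
  have -> : (fun z => phi (x - z) - phi (y - z)) = (fun z => (-1) * phi (y - z) + phi (x - z)).
    by apply/funext => z'; rewrite mulN1r addrC.
  rewrite (csmooth_lin (-1) ty.1 tx.1).2 (csmooth_reflect x tp.1).2 (csmooth_reflect y tp.1).2.
  by ring.
rewrite Normc.normcM normc_real normrX normrN1 expr1n mul1r.
by apply: hdl => //; rewrite (_ : _ - _ = x - y)// opprB addrA subrK.
Qed.

Lemma ccontinuous_dconv T phi : is_distribution T -> test_fun phi -> ccontinuous (dconv T phi).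
Proof.
move=> hT /test_funP[r [r0 tp]]; apply/ccontinuousP => x e e0.
have [dl dl0 hdl] := dconv_unif hT tp (`|x| + 1) e0.
exists (Num.min dl 1); first by rewrite lt_min dl0/=.
move=> y; rewrite lt_min => /andP[xy1 xy2]; apply: hdl; rewrite ?lerDl//; last exact: ltW.
have : `|y| <= `|x - y| + `|x| by rewrite -{1}(subKr x y) (le_trans (ler_normB _ _))// addrC.
by lra.
Qed.

(* The nodes and coefficients depend on the mesh [dl] only, not on [G]: in [dist_conv] the
   same sum is applied to all derivatives of the parametrized test function. *)
Lemma riemann_sum theta r : ccontinuous theta -> supported r theta ->
  forall dl, 0 < dl -> exists l : seq (C * Rd), (forall p, p \in l -> `|p.2| <= r) /\
  forall G e, ccontinuous G -> 0 <= e ->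
    (forall x a, `|x| <= r -> `|a| <= r -> `|x - a| <= dl -> normc (G x - G a) <= e) ->
    normc (cintegral (fun x => G x * theta x) - \sum_(p <- l) p.1 * G p.2) <= 2 * (e * L1norm theta).
Proof.
move=> ct st dl dl0.
(* The nodes are the centres of a finite subcover of the ball by balls of radius dl. *)
have [l [lr lcov]] : exists l : seq Rd, (forall a, a \in l -> `|a| <= r) /\
    forall x, `|x| <= r -> exists2 a, a \in l & `|x - a| < dl.
  have := @cball_compact R d r; rewrite compact_cover => /(_ _ (cball r) (fun a => ball a dl)).
  case.
  - by move=> a _; exact: ball_open.
  - by move=> x xr; exists x => //; exact: ballxx.
  - move=> D DK hD; exists (finmap.enum_fset D); split.
      by move=> a /DK; rewrite inE.
    move=> x /hD[a aD]; rewrite -ball_normE/= => xa; exists a => //.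
    by rewrite distrC.
(* Hats of radius dl around the nodes; divided by their sum they form a partition of unity on the
   ball. The coefficient of a node will be the integral of its share of [theta]. *)
pose q (a x : Rd) : R := Num.max 0 (dl - `|x - a|).
have q0 a x : 0 <= q a x by rewrite le_max lexx.
pose Q x := \sum_(a <- l) q a x.
(* Far from all nodes Q x = 0 and the quotient is 0 by the convention on inverses, so the share of a
   node lies between 0 and 1 everywhere. *)
pose p a x : R := q a x / Q x.
have Q0 x : 0 <= Q x by apply: sumr_ge0.
have Qp x : `|x| <= r -> 0 < Q x.
  move=> /lcov[a al xa]; rewrite /Q (big_rem a al)/= ltr_pwDl ?sumr_ge0//.
  by rewrite lt_max subr_gt0 xa orbT.
have p0 a x : 0 <= p a x by rewrite divr_ge0.
have p1 a x : a \in l -> p a x <= 1.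
  move=> al; have [Qx|Qx] := eqVneq (Q x) 0; first by rewrite /p Qx invr0 mulr0.
  rewrite ler_pdivrMr ?lt_neqAle ?Q0 ?andbT 1?eq_sym// mul1r /Q (big_rem a al)/= lerDl.
  exact: sumr_ge0.
have psum x : `|x| <= r -> \sum_(a <- l) p a x = 1.
  by move=> xr; rewrite /p -mulr_suml divff// gt_eqF// Qp.
have mq a : measurable_fun setT (q a).
  apply: measurable_maxr => //; apply: measurable_funB => //.
  apply: (@continuous_measurable_rV R d (fun x => `|x - a|)) => x.
  apply: (@continuous_comp _ _ _ (fun x : Rd => x - a) (fun y : Rd => `|y|)).
    have := @continuous_affine R d 1 (- a) x.
    by under eq_fun do rewrite scale1r.
  exact: norm_continuous.
have mQ : measurable_fun setT Q by apply: measurable_sum.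
have mp a : measurable_fun setT (p a).
  apply: measurable_funM => //.
  (* Inversion is measurable as the power -1, which agrees with it on nonnegative numbers. *)
  rewrite (_ : (fun _ => _) = fun x => Q x `^ (-1)).
    exact: (measurableT_comp (@measurable_powR R (-1))).
  by apply/funext => x; rewrite powR_inv1.
have mt := ccontinuous_measurable ct.
have [M [M0 hM]] := supported_bounded ct st.
have one_loc : L1loc (fun _ : Rd => 1 : C) by exact/ccontinuous_L1loc/ccontinuous_cst.
have it : cintegrable theta.
  have [h _] := L1loc_pairing one_loc mt st hM.
  by move: h; under eq_fun do rewrite mul1r.
have ip a : a \in l -> cintegrable (fun x => (p a x)%:C * theta x).
  move=> al; apply: (@cintegrable_dom _ _ _ (fun x => normc (theta x))).
  - by apply: cmeasurableM => //; exact: cmeasurable_real.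
  - exact: cintegrable_normc.
  - move=> x; rewrite Normc.normcM normc_real ger0_norm// ler_piMl ?normc_ge0//.
    exact: p1.
exists [seq (cintegral (fun x => (p a x)%:C * theta x), a) | a <- l]; split.
  by move=> _ /mapP[a al ->] /=; exact: lr.
move=> G e cG e0 hG; rewrite big_map/=.
have iG : cintegrable (fun x => G x * theta x).
  by have [] := L1loc_pairing (ccontinuous_L1loc cG) mt st hM.
pose c a x := if a \in l then (p a x)%:C * theta x else 0.
have ic a : cintegrable (c a).
  by rewrite /c; have [al|al] := boolP (a \in l); [exact: ip|exact: cintegrable0].
have -> : \sum_(a <- l) cintegral (fun x => (p a x)%:C * theta x) * G a =
    cintegral (fun x => \sum_(a <- l) G a * c a x).
  rewrite cintegral_sum; last by move=> a; exact: cintegrableZ.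
  rewrite !big_seq; apply: eq_bigr => a al; rewrite cintegralZ// mulrC /c.
  by under [in RHS]eq_fun do rewrite al.
rewrite -cintegralB//; last by apply: cintegrable_sum => a; exact: cintegrableZ.
have iD : cintegrable (fun x => G x * theta x - \sum_(a <- l) G a * c a x).
  by apply: cintegrableB => //; apply: cintegrable_sum => a; exact: cintegrableZ.
apply: (le_trans (normc_cintegral_le iD)); rewrite ler_pM2l//.
have -> : e * L1norm theta = \int[mu]_x (e * normc (theta x)).
  by rewrite RintegralZl//; exact: cintegrable_normc.
apply: le_L1norm; first exact: cintegrable_measurable.
  rewrite (_ : EFin \o _ = fun x => (e%:E * (normc (theta x))%:E)%E)//.
  by apply: integrableZl => //; exact: cintegrable_normc.
move=> x; have [xr|xr] := leP `|x| r; last first.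
  rewrite /c (st x xr) !mulr0 big1 ?subrr ?Normc.normc0 ?mulr0//.
  by move=> a _; case: ifP => _; rewrite ?mulr0.
have -> : G x * theta x - \sum_(a <- l) G a * c a x =
    (\sum_(a <- l) (p a x)%:C * (G x - G a)) * theta x.
  rewrite mulr_suml.
  have -> : G x * theta x = \sum_(a <- l) (p a x)%:C * G x * theta x.
    by rewrite -!mulr_suml -rmorph_sum/= psum// mul1r.
  rewrite -sumrB !big_seq; apply: eq_bigr => a al.
  by rewrite /c al; ring.
rewrite Normc.normcM ler_wpM2r ?normc_ge0// (le_trans (normc_sum _ _ _))//.
rewrite -[leRHS]mul1r -(psum x xr) mulr_suml big_seq [leRHS]big_seq ler_sum// => a al.
rewrite Normc.normcM normc_real ger0_norm//.
(* A node at distance at least dl has weight 0, so only values of [G] at points closer than dl are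
   compared. *)
have [xa|xa] := leP dl `|x - a|.
  by rewrite /p /q max_l ?subr_le0// !mul0r.
by rewrite ler_wpM2l// hG// ?lr// ltW.
Qed.

(* [T] commutes with Riemann sums, and the Riemann sums converge in D. *)
Lemma dist_conv T phi theta r r' : is_distribution T -> ctest r phi -> ctest r' theta ->
  regular_dist (dconv T phi) theta =
  T (fun y => cintegral (fun x => phi (x - y) * theta x)).
Proof.
move=> hT tp tt.
have ct := csmooth_ccontinuous tt.1.
have cT := ccontinuous_dconv hT (ctest_test_fun tp).
have [N [c [c0 hc]]] := dist_bound (r + `|r'|) hT.
apply/eqP; rewrite -subr_eq0; apply/eqP/Normc.eq0_normc/eqP.
rewrite eq_le normc_ge0 andbT; apply/ler_addgt0Pl => e e0; rewrite addr0.
pose m := L1norm theta; have m0 : 0 <= m by exact: L1norm_ge0.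
have k0 : 0 < 2 * (m + c * m) + 1 by rewrite ltr_wpDl// mulr_ge0// addr_ge0// mulr_ge0.
have e1 : 0 < e / (2 * (m + c * m) + 1) by rewrite divr_gt0.
set e' := e / _ in e1.
have [d1 d10 h1] := dconv_unif hT tp r' e1.
have [d2 d20 h2] := ctest_unif N tp e1.
have dl0 : 0 < Num.min d1 d2 by rewrite lt_min d10.
have [l [lr hl]] := riemann_sum ct tt.2 dl0.
have r'0 : r' <= `|r'| by rewrite ler_norm.
have H1 := hl (dconv T phi) e' cT (ltW e1).
have {}H1 : normc (regular_dist (dconv T phi) theta - \sum_(p <- l) p.1 * dconv T phi p.2) <= 2 * (e' * m).
  apply: H1 => x a xr ar; rewrite le_min => /andP[xa _]; exact: h1.
(* The parametrized integral is the convolution of [theta] with the reflection of [phi]; so it is a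
   test function of y, and its derivatives fall on [phi]. *)
pose rp := fun t => phi (0 - t).
have trp : ctest r rp by have := ctest_reflect 0 tp; rewrite normr0 addr0.
have PE s y : cintegral (fun x => cpartials s phi (x - y) * theta x) =
    ((-1) ^+ size s)%:C * conv theta (cpartials s rp) y.
  have tsp := ctest_partials s trp.
  have [i1 [_ ->]] := conv_pairing y (ccontinuous_L1loc ct) (csmooth_ccontinuous tsp.1) tsp.2.
  rewrite -cintegralZ//; congr cintegral; apply/funext => x.
  rewrite (csmooth_reflect 0 tp.1).2 sub0r opprB (mulrC (theta x)) !mulrA.
  by rewrite -rmorphM/= -expr2 -exprM mulnC exprM sqrrN expr1n expr1n mul1r.
have PE0 : (fun y => cintegral (fun x => phi (x - y) * theta x)) = conv theta rp.
  by apply/funext => y; have := PE [::] y; rewrite /= expr0 !cpartials_nil mul1r.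
have tP : ctest (r + `|r'|) (conv theta rp).
  by apply: ctest_le (ctest_conv tt trp); rewrite addrC lerD2l.
(* Zero off the list, so that a single support radius serves for all indices. *)
pose F (p : C * Rd) := if p \in l then (fun y => phi (p.2 - y)) else fun=> 0.
have tF p : ctest (r + `|r'|) (F p).
  rewrite /F; case: ifPn => [pl|_]; last exact: ctest0.
  by apply: ctest_le (ctest_reflect p.2 tp); rewrite lerD2l (le_trans (lr p pl)).
have tcF p : ctest (r + `|r'|) (fun y => p.1 * F p y).
  have := ctest_lin p.1 (tF p) (@ctest0 R d (r + `|r'|)).
  by congr ctest; apply/funext => x; rewrite addr0.
have tS := ctest_sum l tcF.
have ES : \sum_(p <- l) p.1 * dconv T phi p.2 = T (fun y => \sum_(p <- l) p.1 * F p y).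
  rewrite (dist_sum l (fun p => p.1) hT tF) !big_seq; apply: eq_bigr => p pl.
  by rewrite /F pl.
have H2 : normc (T (conv theta rp) - \sum_(p <- l) p.1 * dconv T phi p.2) <= c * (2 * (e' * m)).
  rewrite ES -(distB hT tP tS); apply: hc.
    have := ctest_lin (-1) tS tP; congr ctest.
    by apply/funext => z; rewrite mulN1r addrC.
  move=> s y sN.
  have -> : (fun y => conv theta rp y - \sum_(p <- l) p.1 * F p y) =
     (fun y => -1 * (\sum_(p <- l) p.1 * F p y) + conv theta rp y).
    by apply/funext => z; rewrite mulN1r addrC.
  rewrite (csmooth_lin (-1) tS.1 tP.1).2 (cpartials_sum l s tcF).
  rewrite (csmooth_conv (ccontinuous_L1loc ct) trp).2.
  have -> : conv theta (cpartials s rp) y =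
     ((-1) ^+ size s)%:C * cintegral (fun x => cpartials s phi (x - y) * theta x).
    rewrite PE mulrA -rmorphM/= -expr2 -exprM mulnC exprM sqrrN expr1n expr1n.
    by rewrite mul1r.
  have -> : \sum_(p <- l) cpartials s (fun y => p.1 * F p y) y =
     ((-1) ^+ size s)%:C * \sum_(p <- l) p.1 * cpartials s phi (p.2 - y).
    rewrite big_distrr/= !big_seq; apply: eq_bigr => p pl; rewrite /F pl.
    have := (csmooth_lin p.1 (ctest_reflect p.2 tp).1 (@ctest0 R d 0).1).2 s.
    under eq_fun do rewrite addr0; move=> ->.
    by rewrite (csmooth_reflect p.2 tp.1).2 csmooth0.2 addr0 mulrCA.
  rewrite mulN1r addrC -mulrBr Normc.normcM normc_real normrX normrN1 expr1n mul1r.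
  apply: (hl (fun x => cpartials s phi (x - y))).
  - have := ccontinuous_comp (@continuous_affine R d 1 (- y)) (csmooth_continuous s tp.1).
    by congr ccontinuous; apply/funext => x /=; rewrite scale1r.
  - exact: ltW.
  - move=> x a _ _; rewrite le_min => /andP[_ xa]; apply: h2 => //.
    by rewrite (_ : _ - _ = x - a)// opprB addrA subrK.
rewrite PE0 (_ : _ - _ = (regular_dist (dconv T phi) theta - \sum_(p <- l) p.1 * dconv T phi p.2) -
  (T (conv theta rp) - \sum_(p <- l) p.1 * dconv T phi p.2)); last by ring.
rewrite (le_trans (le_normcD _ _))// normcN (le_trans (lerD H1 H2))//.
rewrite (_ : _ + _ = e' * (2 * (m + c * m))); last by ring.
rewrite /e' -mulrA ger_pMr// mulrC ler_pdivrMr// mul1r lerDl//.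
Qed.

End distributions.

(** * Approximate identities *)

Section approximation.
Context {R : realType} {d : nat}.
Local Notation Rd := 'rV[R]_d.
Local Notation C := R[i].
Local Notation mu := (@lebesgue_rV R d).
Local Notation Re := (@complex.Re R).
Local Notation Im := (@complex.Im R).
Local Notation normc := (@Normc.normc R).
Local Notation conv := (@Defs.conv R d).
Implicit Types (f g h phi psi theta rho : Rd -> C) (r : R) (s : seq 'I_d) (j : nat).
Implicit Types (T : @functional R d) (alpha : {ffun 'I_d -> nat}).

Definition flip phi : Rd -> C := fun x => phi (- x).

Lemma flipE phi : flip phi = fun x => phi (0 - x).
Proof. by apply/funext => x; rewrite sub0r. Qed.

Lemma ctest_flip r phi : ctest r phi -> ctest r (flip phi).
Proof. by rewrite flipE => /(ctest_reflect 0); rewrite normr0 addr0. Qed.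

Lemma cpartials_flip r phi s : ctest r phi ->
  cpartials s (flip phi) = fun x => ((-1) ^+ size s)%:C * flip (cpartials s phi) x.
Proof. by move=> tp; rewrite !flipE (csmooth_reflect 0 tp.1).2. Qed.

(** The adjoint form of the interchange: it reduces statements on T * phi to statements on
    convolutions of test functions. *)
Lemma dist_conv_flip T phi theta r r' : is_distribution T -> ctest r phi -> ctest r' theta ->
  regular_dist (dconv T phi) theta = T (conv theta (flip phi)).
Proof.
move=> hT tp tt; rewrite (dist_conv hT tp tt); congr T; apply/funext => y.
have tf := ctest_flip tp.
have [_ [_ ->]] := conv_pairing y (ccontinuous_L1loc (csmooth_ccontinuous tt.1))
  (csmooth_ccontinuous tf.1) tf.2.
by congr cintegral; apply/funext => x; rewrite /flip opprB mulrC.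
Qed.

(** At a point x the left side pairs T * phi with psi(x - .), to which [dist_conv] applies; the
    inner integral is then a translate of the one defining phi * psi. *)
Lemma dconv_conv T phi psi r r' : is_distribution T -> ctest r phi -> ctest r' psi ->
  conv (dconv T phi) psi = dconv T (conv phi psi).
Proof.
move=> hT tp tq; apply/funext => x.
have LT := ccontinuous_L1loc (ccontinuous_dconv hT (ctest_test_fun tp)).
have cq := csmooth_ccontinuous tq.1.
have [_ [_ ->]] := conv_pairing x LT cq tq.2.
have := dist_conv hT tp (ctest_reflect x tq); rewrite /regular_dist => ->.
rewrite /dconv; congr T; apply/funext => y.
have cp := csmooth_ccontinuous tp.1.
have [_ [_ ->]] := conv_pairing (x - y) (ccontinuous_L1loc cp) cq tq.2.
have tp' := ctest_affine (- y) (oner_neq0 R) tp.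
have n1 : 1 != 0 :> R by rewrite oner_neq0.
have [M [M0 hM]] := supported_bounded cq tq.2.
have [i1 _] := L1loc_pairing (ccontinuous_L1loc cp)
   (ccontinuous_measurable (ccontinuous_reflect (x - y) cq)) (supported_reflect (x - y) tq.2)
   (fun z => hM (x - y - z)).
have [_ e2] := cintegral_affine (- y) n1 i1.
rewrite normr1 expr1n invr1 mul1r in e2; rewrite -e2; congr cintegral.
by apply/funext => z; rewrite scale1r; congr (_ * psi _); rewrite opprB addrA subrK.
Qed.

Lemma two_powC n : (2 : C) ^+ n = ((2 : R) ^+ n)%:C.
Proof. by rewrite rmorphXn/= rmorph_nat. Qed.

Lemma two_pow_gt0 n : 0 < (2 : R) ^+ n. Proof. by rewrite exprn_gt0. Qed.

Lemma two_pow_neq0 n : (2 : R) ^+ n != 0. Proof. by rewrite gt_eqF// two_pow_gt0. Qed.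

Lemma dilateE phi j : dilate phi j =
  fun x => (2 ^+ (j * d))%:C * phi ((2 : R) ^+ j *: x + 0).
Proof. by apply/funext => x; rewrite /dilate two_powC addr0. Qed.

Lemma cpartials_dilate r phi j s : ctest r phi ->
  cpartials s (dilate phi j) = fun x => ((2 ^+ j) ^+ size s)%:C * dilate (cpartials s phi) j x.
Proof.
move=> tp; have ta := ctest_affine 0 (two_pow_neq0 j) tp.
have -> : dilate phi j = fun x => (2 ^+ (j * d))%:C * phi ((2 : R) ^+ j *: x + 0) + 0.
  by rewrite dilateE; under [RHS]eq_fun do rewrite addr0.
rewrite (csmooth_lin _ ta.1 csmooth0.1).2 csmooth0.2.
rewrite (csmooth_affine 0 (two_pow_neq0 j) tp.1).2 dilateE.
by apply/funext => x; rewrite addr0 mulrCA.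
Qed.

Lemma ctest_dilate_sharp r phi j : ctest r phi -> ctest (r / 2 ^+ j) (dilate phi j).
Proof.
move=> tp; have := ctest_affine 0 (two_pow_neq0 j) tp.
rewrite normr0 addr0 gtr0_norm ?two_pow_gt0// => ta.
have := ctest_lin (2 ^+ (j * d))%:C ta (@ctest0 R d _); rewrite dilateE.
by congr ctest; apply/funext => x; rewrite addr0.
Qed.

(** Dilation by 2^j shrinks supports, so one radius serves for all scales. Together with the
    invariance of the L^1 norm this makes the convolution estimates uniform in j. *)
Lemma ctest_dilate r phi j : 0 <= r -> ctest r phi -> ctest r (dilate phi j).
Proof.
move=> r0 tp; apply: ctest_le (ctest_dilate_sharp j tp).
by rewrite ler_pdivrMr ?two_pow_gt0// ler_peMr// exprn_ege1// ler1n.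
Qed.

Lemma cintegral_dilate phi j : cintegrable phi ->
  cintegrable (dilate phi j) /\ cintegral (dilate phi j) = cintegral phi.
Proof.
move=> ip; rewrite dilateE; have [i1 e1] := cintegral_affine 0 (two_pow_neq0 j) ip.
split; first exact: cintegrableZ.
rewrite cintegralZ// e1 gtr0_norm ?two_pow_gt0// mulrA -rmorphM/= -exprM.
by rewrite divff ?mul1r// two_pow_neq0.
Qed.

Lemma L1norm_cintegral phi : L1norm phi = Re (cintegral (fun x => (normc (phi x))%:C)).
Proof. by []. Qed.

Lemma cintegrable_ctest r phi : ctest r phi -> cintegrable phi.
Proof.
move=> [/csmooth_ccontinuous cp sp]; have [M [M0 hM]] := supported_bounded cp sp.
have one_loc : L1loc (fun _ : Rd => 1 : C) by exact/ccontinuous_L1loc/ccontinuous_cst.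
have [h _] := L1loc_pairing one_loc (ccontinuous_measurable cp) sp hM.
by move: h; under eq_fun do rewrite mul1r.
Qed.

Lemma cintegrable_abs phi : cintegrable phi -> cintegrable (fun x => (normc (phi x))%:C).
Proof.
move=> /cintegrableP[mp ip]; split => //=; exact: integrable0.
Qed.

Lemma L1norm_dilate phi j : cintegrable phi -> L1norm (dilate phi j) = L1norm phi.
Proof.
move=> /cintegrable_abs ip; rewrite !L1norm_cintegral -(cintegral_dilate j ip).2.
congr (Re (cintegral _)); apply/funext => x.
rewrite /dilate Normc.normcM two_powC normc_real ger0_norm ?exprn_ge0//.
by rewrite rmorphM.
Qed.

Lemma L1norm_flip phi : cintegrable phi -> L1norm (flip phi) = L1norm phi.
Proof.
move=> /cintegrable_abs ip; rewrite !L1norm_cintegral.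
have n1 : -1 != 0 :> R by rewrite oppr_eq0 oner_eq0.
have [_ ] := cintegral_affine 0 n1 ip.
rewrite normrN1 expr1n invr1 mul1r => <-.
by congr (Re (cintegral _)); apply/funext => x; rewrite scaleN1r addr0.
Qed.

Lemma cintegral_flip phi : cintegrable phi -> cintegral (flip phi) = cintegral phi.
Proof.
move=> ip; have n1 : -1 != 0 :> R by rewrite oppr_eq0 oner_eq0.
have [_ ] := cintegral_affine 0 n1 ip.
rewrite normrN1 expr1n invr1 mul1r => <-.
by congr cintegral; apply/funext => x; rewrite scaleN1r addr0.
Qed.

Lemma flip_dilate phi j : flip (dilate phi j) = dilate (flip phi) j.
Proof. by apply/funext => x; rewrite /flip /dilate scalerN. Qed.

Lemma dilate_conv r r' phi psi j : ctest r phi -> ctest r' psi ->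
  dilate (conv phi psi) j = conv (dilate phi j) (dilate psi j).
Proof.
move=> tp tq; apply/funext => x.
have Lp := ccontinuous_L1loc (csmooth_ccontinuous tp.1).
have [_ [i1 _]] := conv_pairing ((2 : R) ^+ j *: x) Lp (csmooth_ccontinuous tq.1) tq.2.
have [i2 e2] := cintegral_affine 0 (two_pow_neq0 j) i1.
rewrite (dilateE (conv phi psi)) /= addr0 [in RHS]/Defs.conv.
have -> : (fun t => dilate phi j (x - t) * dilate psi j t) =
  fun t => (2 ^+ (j * d) * 2 ^+ (j * d))%:C *
   (phi (2 ^+ j *: x - (2 ^+ j *: t + 0)) * psi (2 ^+ j *: t + 0)).
  apply/funext => t; rewrite !dilateE !addr0 scalerBr rmorphM/=; ring.
rewrite cintegralZ// e2 gtr0_norm ?two_pow_gt0// mulrA -rmorphM/= -exprM.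
by rewrite mulfK// two_pow_neq0.
Qed.

(** As [rho] has integral 1, the difference is the integral of (u(x - t) - u(x)) rho_j(t), where t
    stays within dl. *)
Lemma normc_conv_sub_le u rho r j e dl : ccontinuous u -> ctest r rho -> cintegral rho = 1 ->
    r / 2 ^+ j <= dl -> (forall x y, `|x - y| <= dl -> normc (u x - u y) <= e) ->
  forall x, normc (conv u (dilate rho j) x - u x) <= 2 * (e * L1norm rho).
Proof.
move=> cu tr r1 rdl hu x.
have td := ctest_dilate_sharp j tr.
have ir := cintegrable_ctest td.
have [_ d1] := cintegral_dilate j (cintegrable_ctest tr).
have [_ [i1 _]] := conv_pairing x (ccontinuous_L1loc cu) (csmooth_ccontinuous td.1) td.2.
have -> : conv u (dilate rho j) x - u x =
    cintegral (fun t => u (x - t) * dilate rho j t - u x * dilate rho j t).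
  rewrite cintegralB//; last exact: cintegrableZ.
  by rewrite cintegralZ// d1 r1 mulr1.
have ii : cintegrable (fun t => u (x - t) * dilate rho j t - u x * dilate rho j t).
  by apply: cintegrableB => //; exact: cintegrableZ.
apply: (le_trans (normc_cintegral_le ii)); rewrite ler_pM2l//.
rewrite -(L1norm_dilate j (cintegrable_ctest tr)) /L1norm -RintegralZl//; last exact: cintegrable_normc.
apply: le_L1norm; first exact: cintegrable_measurable.
  rewrite (_ : EFin \o _ = fun x => (e%:E * (normc (dilate rho j x))%:E)%E)//.
  by apply: integrableZl => //; exact: cintegrable_normc.
move=> t; rewrite -mulrBl Normc.normcM; have [tr1|tr1] := leP `|t| (r / 2 ^+ j).
  rewrite ler_wpM2r ?normc_ge0// hu// addrAC subrr sub0r normrN.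
  exact: le_trans tr1 rdl.
by rewrite td.2// Normc.normc0 !mulr0.
Qed.

Lemma div_two_pow_small r dl : 0 < dl -> exists j0, forall j, (j0 <= j)%N -> r / 2 ^+ j <= dl.
Proof.
move=> dl0; pose k := Num.ceil (`|r| / dl).
exists `|k|%N => j kj; rewrite ler_pdivrMr ?two_pow_gt0//.
apply: (le_trans (ler_norm r)); rewrite mulrC -ler_pdivrMr//.
apply: (le_trans (Num.Theory.ceil_ge _)); rewrite -/k.
apply: (@le_trans _ _ (`|k|%N%:R)).
  by rewrite -[leRHS]/((`|k|%N : int)%:~R) ler_int abszE ler_norm.
rewrite (le_trans (y := j%:R)) ?ler_nat// -natrX ler_nat ltnW//.
exact: ltn_expl.
Qed.

Lemma absorb_le (k e : R) : 0 <= k -> 0 < e -> k * (e / (k + 1)) <= e.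
Proof.
move=> k0 e0; rewrite mulrCA ger_pMr// ler_pdivrMr ?ltr_wpDl//.
by rewrite mul1r lerDl.
Qed.

Lemma continuous_max (u v : Rd -> R) : continuous u -> continuous v ->
  continuous (fun x => Num.max (u x) (v x)).
Proof.
move=> cu cv x.
rewrite (_ : (fun _ => _) = fun x => 2^-1 * (u x + v x + `|u x - v x|)).
  pose F := nbhs_filter x.
  apply: (@cvgM _ _ _ F); first exact: cst_continuous.
  apply: (@cvgD _ _ _ _ F).
    by apply: (@cvgD _ _ _ _ F); [exact: cu|exact: cv].
  by apply: (@cvg_norm _ _ _ _ F); apply: (@cvgB _ _ _ _ F); [exact: cu|exact: cv].
by apply/funext => y; rewrite maxr_absE mulrC.
Qed.

Lemma continuous_min (u v : Rd -> R) : continuous u -> continuous v ->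
  continuous (fun x => Num.min (u x) (v x)).
Proof.
move=> cu cv x.
rewrite (_ : (fun _ => _) = fun x => - Num.max (- u x) (- v x)).
  apply: (@continuousN _ _ _ (fun x => Num.max (- u x) (- v x))).
  apply: continuous_max => y; apply: continuousN; [exact: cu|exact: cv].
by apply/funext => y; rewrite oppr_max !opprK.
Qed.

(** By [dist_conv_flip] the pairing is [T] at the convolution of [theta] with the reflected
    mollifier, whose derivatives converge uniformly to those of [theta] inside a fixed ball. This
    weak limit identifies the sums of the telescoping series. *)
Lemma dconv_approx T rho r theta r' : is_distribution T -> ctest r rho -> 0 <= r -> cintegral rho = 1 ->
  ctest r' theta -> forall e, 0 < e -> exists j0, forall j, (j0 <= j)%N ->
    normc (regular_dist (dconv T (dilate rho j)) theta - T theta) <= e.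
Proof.
move=> hT tr r0 r1 tt e e0.
have [N [c [c0 hc]]] := dist_bound (r' + r) hT.
pose m := L1norm rho; have m0 : 0 <= m by exact: L1norm_ge0.
have k0 : 0 < 2 * (c * m) + 1 by rewrite ltr_wpDl// mulr_ge0// mulr_ge0.
have e1 : 0 < e / (2 * (c * m) + 1) by rewrite divr_gt0.
have [dl dl0 hdl] := ctest_unif N tt e1.
have [j0 hj0] := div_two_pow_small r dl0.
exists j0 => j jj0.
have td := ctest_dilate j r0 tr.
rewrite (dist_conv_flip hT td tt) flip_dilate.
have tf := ctest_flip tr; have tdf := ctest_dilate j r0 tf.
have tc := ctest_conv tt tdf.
have tt' : ctest (r' + r) theta by apply: ctest_le tt; rewrite lerDl.
rewrite -(distB hT tc tt').
apply: (@le_trans _ _ (c * (2 * (e / (2 * (c * m) + 1) * m)))); last first.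
  rewrite (_ : c * (2 * (_ * m)) = 2 * (c * m) * (e / (2 * (c * m) + 1))).
    by apply: absorb_le => //; rewrite mulr_ge0// mulr_ge0.
  by ring.
have Ef : cintegral (flip rho) = 1 by rewrite cintegral_flip//; exact: cintegrable_ctest tr.
apply: hc.
  have := ctest_lin (-1) tt' tc; congr ctest.
  by apply/funext => z; rewrite mulN1r addrC.
move=> s x sN.
have -> : (fun x => conv theta (dilate (flip rho) j) x - theta x) =
   (fun x => -1 * theta x + conv theta (dilate (flip rho) j) x).
  by apply/funext => z; rewrite mulN1r addrC.
rewrite (csmooth_lin (-1) tt.1 tc.1).2 -[s in X in _ + X]cats0 (cpartials_conv _ _ tt tdf).
rewrite cpartials_nil mulN1r addrC.
rewrite [X in _ <= _ * (_ * X)](_ : m = L1norm (flip rho)); last first.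
  by rewrite (L1norm_flip (cintegrable_ctest tr)).
apply: (normc_conv_sub_le (dl := dl) _ tf) => //; first exact: csmooth_continuous tt.1.
- exact: hj0.
- by move=> y z yz; exact: hdl.
Qed.

(** Mollifying [g] gives test functions that converge to it uniformly, with supports in a fixed ball
    on which |h| has finite mass. *)
Lemma regular_dist_approx rho r : ctest r rho -> 0 <= r -> cintegral rho = 1 ->
  forall h, L1loc h -> (forall theta, test_fun theta -> regular_dist h theta = 0) ->
  forall g r', ccontinuous g -> supported r' g -> regular_dist h g = 0.
Proof.
move=> tr r0 r1 h Lh h0 g r' cg sg; apply/Normc.eq0_normc/eqP.
rewrite eq_le normc_ge0 andbT; apply/ler_addgt0Pl => e e0; rewrite addr0.
pose m := 2 * L1norm rho; have m0 : 0 <= m by rewrite mulr_ge0// L1norm_ge0.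
pose b := locmass h (r' + r); have b0 : 0 <= b by exact: locmass_ge0.
have k0 : 0 < 2 * (m * b) + 1 by rewrite ltr_wpDl// mulr_ge0// mulr_ge0.
have e1 : 0 < e / (2 * (m * b) + 1) by rewrite divr_gt0.
have [dl dl0 hdl] := ccontinuous_unif cg sg e1.
have [j hj] := div_two_pow_small r dl0.
have td := ctest_dilate j r0 tr.
have Lg := ccontinuous_L1loc cg.
have tc : ctest (r' + r) (conv g (dilate rho j)).
  by split; [exact: (csmooth_conv Lg td).1|exact: conv_supported sg td.2].
have sg' : supported (r' + r) g by apply: supported_le sg; rewrite lerDl.
have cc := csmooth_ccontinuous tc.1.
rewrite -normcN -sub0r -(h0 _ (ctest_test_fun tc)) -(regular_distB Lh cc tc.2 cg sg').
apply: (@le_trans _ _ (2 * ((2 * (e / (2 * (m * b) + 1) * L1norm rho)) * b))); last first.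
  rewrite (_ : 2 * (2 * (_ * _) * b) = 2 * (m * b) * (e / (2 * (m * b) + 1))).
    by apply: absorb_le => //; rewrite mulr_ge0// mulr_ge0.
  by move: (e / _) => k; rewrite /m; ring.
apply: regular_dist_bound => //.
- exact: ccontinuous_measurable (ccontinuousB cc cg).
- by move=> z rz; rewrite tc.2// sg'// subr0.
- by apply: (normc_conv_sub_le cg tr r1 (hj j (leqnn j))) => y z yz; exact: hdl.
Qed.

Definition positivity_set (A : set Rd) :=
  exists2 u : Rd -> R, continuous u & A = [set x | 0 < u x].

Lemma positivity_set_measurable A : positivity_set A -> measurable A.
Proof.
move=> [u cu ->]; apply: open_measurable_rV.
rewrite (_ : mkset _ = u @^-1` `]0, +oo[%classic); last first.
  by apply/seteqP; split => x /=; rewrite in_itv/= andbT.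
by apply: open_comp => [x _|]; [exact: cu|exact: interval_open].
Qed.

(* The positivity sets of continuous functions form a pi-system, to which Dynkin's theorem
   applies. *)
Lemma measurable_positivity_setE : measurable = <<s positivity_set >>.
Proof.
apply/seteqP; split; last first.
  by apply: smallest_sub; [exact: sigma_algebra_measurable|exact: positivity_set_measurable].
apply: smallest_sub; first exact: smallest_sigma_algebra.
move=> A; rewrite -bigcup_seq => -[i _ [B mB <-]].
have : measurable_fun [set: g_sigma_algebraType positivity_set]
    (fun x : g_sigma_algebraType positivity_set => (x : Rd) ord0 i).
  apply: (measurability _ (RGenOInfty.measurableE R)) => _ [_ [a ->] <-].
  apply: sub_sigma_algebra; rewrite setTI; exists (fun x : Rd => x ord0 i - a).
    move=> x; apply: (@continuousB _ _ _ (fun x : Rd => x ord0 i) (fun=> a)).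
      exact: coord_continuous.
    exact: cst_continuous.
  by apply/seteqP; split => x /=; rewrite in_itv/= andbT subr_gt0.
by move=> /(_ measurableT _ mB).
Qed.

(** It suffices that the integral of [H] over every measurable set vanishes, and by Dynkin's theorem
    only positivity sets of continuous functions matter: their indicators are limits of continuous
    functions with values in [0, 1]. *)
Lemma ae_eq0_continuous (H : Rd -> R) : mu.-integrable setT (EFin \o H) ->
    (forall g : Rd -> R, continuous g -> (forall x, 0 <= g x <= 1) ->
      \int[mu]_x (H x * g x) = 0) ->
  {ae mu, forall x, H x = 0}.
Proof.
move=> iH H0; have mH : measurable_fun setT H by apply/measurable_EFinP; exact: (measurable_int _ iH).
have intE (g : Rd -> R) : measurable_fun setT g -> (forall x, 0 <= g x <= 1) ->
    mu.-integrable setT (fun x => (H x * g x)%:E).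
  move=> mg hg; apply: le_integrable iH => //.
    by apply/measurable_EFinP; exact: measurable_funM.
  move=> x _ /=; rewrite lee_fin normrM; have /andP[g0 g1] := hg x.
  by rewrite (ger0_norm g0) ler_piMr.
have HE (g : Rd -> R) : continuous g -> (forall x, 0 <= g x <= 1) -> (\int[mu]_x (H x * g x)%:E = 0)%E.
  move=> cg hg; have := H0 g cg hg; rewrite /Rintegral => h0.
  rewrite -[LHS]fineK ?h0//; apply: integrable_fin_num => //.
  by apply: intE => //; exact: continuous_measurable_rV.
have P (A : set Rd) : measurable A -> (\int[mu]_(x in A) (H x)%:E = 0)%E.
  rewrite measurable_positivity_setE.
  apply: (@dynkin_induction _ _ _ (fun A => (\int[mu]_(x in A) (H x)%:E = 0)%E)
    measurable_positivity_setE).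
  - move=> _ _ [u cu ->] [v cv ->]; exists (fun x => Num.min (u x) (v x)).
      exact: continuous_min.
    by apply/seteqP; split => x /=; rewrite lt_min => /andP.
  - have := HE (fun=> 1); under eq_integral do rewrite mulr1; apply.
      by move=> x; exact: cst_continuous.
    by move=> x; rewrite ler01 lexx.
  - move=> {}A [u cu AE].
    (* As m grows this tends to 1 where u > 0, and it is 0 elsewhere; |H| is the dominating
       function. *)
    pose g (m : nat) x := Num.min 1 (m%:R * Num.max 0 (u x)).
    have cg m : continuous (g m).
      apply: continuous_min => x; first exact: cst_continuous.
      apply: (@cvgM _ _ _ (nbhs_filter x)); first exact: cst_continuous.
      by apply: continuous_max => // y; exact: cst_continuous.
    have hg m x : 0 <= g m x <= 1.
      by rewrite ge_min lexx/= andbT le_min ler01/= mulr_ge0// le_max lexx.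
    have mA : measurable A by apply: positivity_set_measurable; exists u.
    rewrite integral_mkcond.
    have : (\int[mu]_x (H x * g m x)%:E @[m --> \oo] --> \int[mu]_x ((EFin \o H) \_ A) x)%E.
      apply: (@dominated_cvg _ _ _ _ _ measurableT _ _ (fun x => `|H x|%:E)).
      - move=> m; apply/measurable_EFinP/measurable_funM => //.
        exact: continuous_measurable_rV.
      - move=> x _; rewrite patchE; apply: cvg_near_cst; case: ifPn => [|xA].
          rewrite inE AE /= => ux; near=> m; rewrite /g (max_r (ltW ux)) min_l ?mulr1//.
          rewrite -ler_pdivrMr// mul1r; near: m; exact: nbhs_infty_ger.
        have ux : u x <= 0 by rewrite leNgt; apply: contra xA => ux; rewrite inE AE.
        by apply: nearW => m; rewrite /g max_l// mulr0 min_r// mulr0.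
      - by [].
      - exact: (@integrable_norm _ _ _ _ _ H).
      - move=> m x _; rewrite lee_fin normrM; have /andP[g0 g1] := hg m x.
        by rewrite (ger0_norm g0) ler_piMr.
    under eq_fun do rewrite HE//.
    by move=> /(cvg_unique _ (cvg_cst _)) <-.
  - move=> S mS S0.
    have : (\int[mu]_(x in S `|` ~` S) (H x)%:E =
        \int[mu]_(x in S) (H x)%:E + \int[mu]_(x in ~` S) (H x)%:E)%E.
      apply: integral_setU => //; first exact: measurableC.
        by rewrite setUv; exact/measurable_EFinP.
      by apply/disj_setPS; rewrite setICr.
    rewrite setUv S0 add0e => <-.
    have := HE (fun=> 1); under eq_integral do rewrite mulr1; apply.
      by move=> x; exact: cst_continuous.
    by move=> x; rewrite ler01 lexx.
  - move=> F mF tF F0; rewrite integral_bigcup//.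
      by apply: eseries0 => i _ _; exact: F0.
    apply: (integrableS measurableT) => //; exact: bigcupT_measurable.
have : ae_eq mu setT (EFin \o H) (EFin \o (fun=> 0)).
  apply: integral_ae_eq => //; first exact: measurable_cst.
  by move=> A _ mA; rewrite (P A mA) integral0.
by apply: filterS => x /(_ I) [].
Unshelve. all: by end_near.
Qed.

(* [rho] is any test function of integral 1; the MDFP provides one, so that no bump function
   has to be constructed. *)
Lemma regular_dist_eq0 rho r : ctest r rho -> 0 <= r -> cintegral rho = 1 ->
  forall h, L1loc h -> (forall theta, test_fun theta -> regular_dist h theta = 0) ->
  {ae mu, forall x, h x = 0}.
Proof.
move=> tr r0 r1 h Lh h0; have [mR mI] := L1loc_measurable Lh.
(* Cut-offs equal to 1 on the ball of radius n and to 0 off that of radius n + 1: [h] is only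
   locally integrable, whereas [ae_eq0_continuous] asks for integrability. *)
pose k (n : nat) (x : Rd) : R := Num.max 0 (Num.min 1 (n%:R + 1 - `|x|)).
have ck n : continuous (k n).
  apply: continuous_max; first by move=> x; exact: cst_continuous.
  apply: continuous_min => x; first exact: cst_continuous.
  apply: (@cvgB _ _ _ _ (nbhs_filter x)); first exact: cst_continuous.
  exact: norm_continuous.
have hk n x : 0 <= k n x <= 1.
  by rewrite le_max lexx/= ge_max ler01/= ge_min lexx.
have sk n x : n%:R + 1 < `|x| -> k n x = 0.
  by move=> nx; rewrite /k max_l// ge_min subr_le0 (ltW nx) orbT.
have Lk n (g : Rd -> R) : continuous g -> (forall x, 0 <= g x <= 1) ->
   [/\ ccontinuous (fun x => (k n x * g x)%:C), supported (n%:R + 1) (fun x => (k n x * g x)%:C) &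
   forall x, normc (k n x * g x)%:C <= 1].
  move=> cg hg; split.
  - split => /= x; last exact: cst_continuous.
    by apply: (@cvgM _ _ _ (nbhs_filter x)); [exact: ck|exact: cg].
  - by move=> x nx; rewrite sk// mul0r.
  - move=> x; rewrite normc_real normrM.
    have /andP[k0 k1] := hk n x; have /andP[g0 g1] := hg x.
    by rewrite !ger0_norm// mulr_ile1.
have pairing n (g : Rd -> R) : continuous g -> (forall x, 0 <= g x <= 1) ->
    cintegrable (fun x => h x * (k n x * g x)%:C) /\ cintegral (fun x => h x * (k n x * g x)%:C) = 0.
  move=> cg hg; have [c1 c2 c3] := Lk n g cg hg.
  have [i1 _] := L1loc_pairing Lh (ccontinuous_measurable c1) c2 c3; split => //.
  exact: (regular_dist_approx tr r0 r1 Lh h0 c1 c2).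
have one (g : Rd -> R) : g = (fun=> 1) -> continuous g /\ forall x : Rd, 0 <= g x <= 1.
  by move=> ->; split => x; [exact: cst_continuous|rewrite ler01 lexx].
have [c1 h1] := one _ erefl.
have aeR n : {ae mu, forall x, Re (h x) * k n x = 0}.
  apply: ae_eq0_continuous.
    have [[i1 _] _] := pairing n _ c1 h1; move: i1; apply: eq_integrable => // x _.
    by rewrite cReM/= mulr0 subr0 mulr1.
  move=> g cg hg; have [_ ] := pairing n g cg hg; move/(congr1 Re) => /=.
  by under eq_Rintegral do rewrite cReM/= mulr0 subr0 mulrA.
have aeI n : {ae mu, forall x, Im (h x) * k n x = 0}.
  apply: ae_eq0_continuous.
    have [[_ i1] _] := pairing n _ c1 h1; move: i1; apply: eq_integrable => // x _.
    by rewrite cImM/= mulr0 add0r mulr1.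
  move=> g cg hg; have [_ ] := pairing n g cg hg; move/(congr1 Im) => /=.
  by under eq_Rintegral do rewrite cImM/= mulr0 add0r mulrA.
have : {ae mu, forall x, forall n, Re (h x) * k n x = 0 /\ Im (h x) * k n x = 0}.
  by apply: ae_foralln => n; move: (aeR n) (aeI n); apply: filterS2.
apply: filterS => x hx.
pose n := `|Num.ceil `|x| |%N.
have kn : k n x = 1.
  rewrite /k max_r.
    rewrite min_l// lerBrDl lerD2r.
    apply: (le_trans (Num.Theory.ceil_ge _)).
    by rewrite -[leRHS]/((n : int)%:~R) ler_int /n abszE ler_norm.
  rewrite le_min ler01/= subr_ge0 (le_trans (Num.Theory.ceil_ge _))//.
  rewrite ler_wpDr//.
  by rewrite -[leRHS]/((n : int)%:~R) ler_int /n abszE ler_norm.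
by have [] := hx n; rewrite kn !mulr1 => a b; exact: complex_eq.
Qed.

End approximation.

(** * Weights *)

Section weights.
Context {R : realType} {d : nat}.
Local Notation Rd := 'rV[R]_d.
Implicit Types (w : nat -> Rd -> R).

(** Each square is at most 1/(d + 1), and there are d of them. This crude bound avoids the square
    root of d and a division by 0. *)
Lemma norm2_le1 (y : Rd) : (forall i, `|y ord0 i| <= d.+1%:R^-1) -> norm2 y <= 1.
Proof.
move=> hy; rewrite /norm2 -[leRHS]sqrtr1 ler_wsqrtr//.
have d0 : 0 < d.+1%:R :> R by rewrite ltr0n.
have i1 : d.+1%:R^-1 <= 1 :> R by rewrite invf_le1// ler1n.
apply: (@le_trans _ _ (\sum_(i < d) d.+1%:R^-1)).
  apply: ler_sum => i _; rewrite -real_normK ?num_real// expr2.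
  apply: (le_trans _ (hy i)); rewrite ler_piMl//.
  exact: le_trans (hy i) i1.
rewrite sumr_const card_ord -[_ *+ d]mulr_natl ler_pdivrMr// mul1r ler_nat//.
Qed.

(** A shift of norm at most [r] is cut into N equal shifts of Euclidean norm at most 1, and (wM) is
    applied N times; index and constant depend on r and n only. *)
Lemma weight_shift w : weight_system w -> wM w -> forall r n, exists m (A : R), 0 < A /\
  forall x t : Rd, `|t| <= r -> w n x <= A * w m (x - t).
Proof.
move=> hw hwM r n.
have step N : forall n, exists m (A : R), 0 < A /\
    forall x y, norm2 y <= 1 -> w n (x + N%:R *: y) <= A * w m x.
  elim: N => [|N ih] k.
    by exists k, 1; split => // x y _; rewrite scale0r addr0 mul1r.
  have [m [A [A0 hA]]] := ih k; have [m' [_ [c [c0 hc]]]] := hwM m.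
  exists m', (A * c); split; first by rewrite mulr_gt0.
  move=> x y y1; rewrite -[N.+1]add1n natrD scalerDl scale1r addrA.
  apply: (le_trans (hA _ _ y1)); rewrite -mulrA ler_pM2l//; exact: hc.
(* For N at least |r| (d + 1) the coordinates of t / N are at most 1/(d + 1), as [norm2_le1] asks;
   the successor keeps N positive. *)
pose N := `|Num.ceil (`|r| * d.+1%:R)|.+1%N.
have N0 : 0 < N%:R :> R by rewrite ltr0n.
have hN : `|r| * d.+1%:R <= N%:R.
  apply: (le_trans (Num.Theory.ceil_ge _)).
  apply: (@le_trans _ _ (`|Num.ceil (`|r| * d.+1%:R)|%N%:R)); last by rewrite ler_nat.
  rewrite -[leRHS]/((`|Num.ceil (`|r| * d.+1%:R)|%N : int)%:~R).
  by rewrite ler_int abszE ler_norm.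
have [m [A [A0 hA]]] := step N n; exists m, A; split => // x t tr.
rewrite (_ : x = (x - t) + N%:R *: (N%:R^-1 *: t)) ?[X in _ <= _ * w m X](_ : _ = x - t).
- apply: hA; apply: norm2_le1 => i; rewrite mxE normrM gtr0_norm ?invr_gt0//.
  rewrite ler_pdivrMl// ler_pdivlMr ?ltr0n//.
  apply: le_trans hN; rewrite ler_wpM2r//.
  apply: (le_trans (rV_coord_le_norm t i)); exact: le_trans tr (ler_norm r).
- by rewrite scalerA divff ?gt_eqF// scale1r subrK.
- by rewrite scalerA divff ?gt_eqF// scale1r subrK.
Qed.

End weights.

(** * The spaces E^n_w *)

Section weighted_spaces.
Context {R : realType} {d : nat}.
Local Notation Rd := 'rV[R]_d.
Local Notation C := R[i].
Local Notation Re := (@complex.Re R).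
Local Notation mu := (@lebesgue_rV R d).
Local Notation normc := (@Normc.normc R).
Variables (E : completeNormedModType C) (rep : E -> Rd -> C).
Hypotheses (hE : TIBF rep) (hsolid : is_solid rep).
Implicit Types (f g h phi psi theta : Rd -> C) (r : R) (s : seq 'I_d) (j : nat).
Implicit Types (T S : @functional R d) (alpha : {ffun 'I_d -> nat}) (w : Rd -> R) (u v : E).

Lemma norm_cnorm u : `|u| = (cnorm u)%:C.
Proof. by rewrite /cnorm; apply: complex_eq => //=; rewrite ger0_Im. Qed.

Lemma cnorm_ge0 u : 0 <= cnorm u.
Proof. by rewrite -ler0c -norm_cnorm. Qed.

Lemma cnormD u v : cnorm (u + v) <= cnorm u + cnorm v.
Proof. by rewrite -lecR rmorphD/= -!norm_cnorm ler_normD. Qed.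

Lemma cnormZ (a : C) u : cnorm (a *: u) = normc a * cnorm u.
Proof.
by apply: complexI; rewrite rmorphM/= -!norm_cnorm normrZ normrcE.
Qed.

Lemma cnorm0 : cnorm (0 : E) = 0.
Proof. by apply: complexI; rewrite -norm_cnorm normr0. Qed.

(* [T] is in E^n_w, with norm at most [c]. *)
Definition Enb (n : nat) w (c : R) T := forall alpha, (mdeg alpha <= n)%N ->
  exists u, weighted_deriv rep w alpha T u /\ cnorm u <= c.

Lemma Enb_le n n' w c c' T : (n' <= n)%N -> c <= c' -> Enb n w c T -> Enb n' w c' T.
Proof.
move=> nn cc hT a an; have [u [h1 h2]] := hT a (leq_trans an nn).
by exists u; split => //; exact: le_trans cc.
Qed.

Lemma ctest_cderiv r alpha theta : ctest r theta -> ctest r (cderiv alpha theta).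
Proof. exact: ctest_partials. Qed.

Lemma test_fun_cderiv alpha theta : test_fun theta -> test_fun (cderiv alpha theta).
Proof. by move=> /test_funP[r [_ /(ctest_cderiv alpha)/ctest_test_fun]]. Qed.

Lemma Enb_deq n w c T S : deq T S -> Enb n w c T -> Enb n w c S.
Proof.
move=> TS hT a an; have [u [[h [Lh Th ru]] uc]] := hT a an.
exists u; split => //; exists h; split => // theta tt.
by rewrite -Th// /dderiv TS//; exact: test_fun_cderiv.
Qed.

Lemma regular_dist_linl (a : C) h g theta : L1loc h -> L1loc g -> test_fun theta ->
  regular_dist (fun x => a * h x + g x) theta = a * regular_dist h theta + regular_dist g theta.
Proof.
move=> Lh Lg /test_funP[r [_ [/csmooth_ccontinuous ct st]]].
have [M [_ hM]] := supported_bounded ct st.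
have [i1 _] := L1loc_pairing Lh (ccontinuous_measurable ct) st hM.
have [i2 _] := L1loc_pairing Lg (ccontinuous_measurable ct) st hM.
rewrite /regular_dist -cintegralZ// -cintegralD//; last exact: cintegrableZ.
by congr cintegral; apply/funext => x; ring.
Qed.

Lemma L1loc_lin (a : C) h g : L1loc h -> L1loc g -> L1loc (fun x => a * h x + g x).
Proof. by move=> Lh Lg; apply: L1locD => //; exact: L1locZ. Qed.

Lemma weighted_deriv_lin w alpha T S u v (a : C) :
  weighted_deriv rep w alpha T u -> weighted_deriv rep w alpha S v ->
  weighted_deriv rep w alpha (fun phi => a * T phi + S phi) (a *: u + v).
Proof.
move=> [h [Lh Th ru]] [g [Lg Sg rv]].
exists (fun x => a * h x + g x); split; first exact: L1loc_lin.
  move=> theta tt; rewrite regular_dist_linl// -Th// -Sg// /dderiv.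
  by ring.
move: (TIBF_linear hE a u v) ru rv; apply: filterS3 => x + + + _.
by move=> -> // -> // -> //; ring.
Qed.

Lemma Enb_lin n w c c' T S (a : C) : Enb n w c T -> Enb n w c' S ->
  Enb n w (normc a * c + c') (fun phi => a * T phi + S phi).
Proof.
move=> hT hS b bn; have [u [Tu uc]] := hT b bn; have [v [Sv vc]] := hS b bn.
exists (a *: u + v); split; first exact: weighted_deriv_lin.
by rewrite (le_trans (cnormD _ _))// cnormZ lerD// ler_wpM2l// normc_ge0.
Qed.

Lemma L1loc0 : L1loc (fun _ : Rd => 0 : C).
Proof. exact/ccontinuous_L1loc/ccontinuous_cst. Qed.

Lemma regular_dist0 theta : regular_dist (fun _ : Rd => 0 : C) theta = 0.
Proof. by rewrite /regular_dist; under eq_fun do rewrite mul0r; rewrite cintegral0. Qed.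

Lemma rep0 : {ae mu, forall x, rep 0 x = 0}.
Proof.
have := TIBF_linear hE (-1) 0 0; rewrite scaler0 addr0.
by apply: filterS => x /(_ I) ->; rewrite mulN1r addNr.
Qed.

Lemma Enb0 n w : Enb n w 0 (fun=> 0).
Proof.
move=> a _; exists 0; rewrite cnorm0; split => //.
exists (fun=> 0); split; first exact: L1loc0.
  by move=> theta _; rewrite /dderiv mulr0 regular_dist0.
by apply: filterS rep0 => x -> _; rewrite mul0r.
Qed.

Lemma Enb_sum n w (c : nat -> R) (T : nat -> @functional R d) K :
  (forall k, Enb n w (c k) (T k)) ->
  Enb n w (\sum_(k < K) c k) (fun phi => \sum_(k < K) T k phi).
Proof.
move=> hT; elim: K => [|K ih].
  rewrite big_ord0; under eq_fun do rewrite big_ord0; exact: Enb0.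
rewrite big_ord_recr/= addrC -[c K]mul1r -[1]Normc.normc1.
rewrite (_ : (fun phi => _) = fun phi => 1 * T K phi + \sum_(k < K) T k phi).
  exact: Enb_lin.
by apply/funext => phi; rewrite big_ord_recr/= addrC mul1r.
Qed.

(** * Uniqueness of weighted derivatives and bounded sets of E^oo_W *)

Section uniqueness.
Variables (rho : Rd -> C) (r0 : R).
Hypotheses (trho : ctest r0 rho) (r00 : 0 <= r0) (irho : cintegral rho = 1).

(** Two densities of the same derivative agree almost everywhere by [regular_dist_eq0], and an
    element of [E] is determined by its representative. *)
Lemma weighted_deriv_unique w alpha T u v :
  weighted_deriv rep w alpha T u -> weighted_deriv rep w alpha T v -> u = v.
Proof.
move=> [h [Lh Th ru]] [g [Lg Tg rv]].
have Lhg := L1loc_lin (-1) Lh Lg.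
have : {ae mu, forall x, -1 * h x + g x = 0}.
  apply: (regular_dist_eq0 trho r00 irho) => // theta tt.
  by rewrite regular_dist_linl// -Th// -Tg// mulN1r addNr.
move=> hg; apply: (TIBF_injective hE); move: hg ru rv; apply: filterS3 => x.
rewrite mulN1r addrC => /subr0_eq hg hu hv _.
by rewrite hu// hv// hg.
Qed.

Lemma En_Enb n w T : En rep n w T -> exists M, Enb n w M T.
Proof.
move=> [_ hT].
(* The entries of a multi-index of degree at most n are at most n, so functions into ['I_n.+1]
   enumerate finitely many candidates; the sum of their bounds serves for all. *)
pose toN (b : {ffun 'I_d -> 'I_n.+1}) : {ffun 'I_d -> nat} := [ffun i => b i : nat].
have /choice[c hc] : forall b, exists c : R, 0 <= c /\ ((mdeg (toN b) <= n)%N ->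
    exists u, weighted_deriv rep w (toN b) T u /\ cnorm u <= c).
  move=> b; have [bn|bn] := boolP (mdeg (toN b) <= n)%N; last by exists 0; split.
  have [u hu] := hT _ bn; exists (cnorm u); split; first exact: cnorm_ge0.
  by move=> _; exists u.
exists (\sum_b c b) => a an.
have ai i : (a i < n.+1)%N.
  rewrite ltnS (leq_trans _ an)// /mdeg (bigD1 i)//= leq_addr//.
have E' : toN [ffun i => Ordinal (ai i)] = a.
  by apply/ffunP => i; rewrite !ffunE.
have [_ ] := hc [ffun i => Ordinal (ai i)]; rewrite E' => /(_ an)[u [hu uc]].
exists u; split => //; apply: (le_trans uc).
rewrite (bigD1 [ffun i => Ordinal (ai i)])//= lerDl sumr_ge0// => b _.
by have [] := hc b.
Qed.

(** By uniqueness, every element over which the supremum ranges is the one whose norm [Enb]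
    bounds. *)
Lemma Enb_norm n w T M : Enb n w M T -> En_norm rep n w T <= M.
Proof.
move=> hT; apply: ge_sup.
  have [|u [hu _]] := hT [ffun=> 0%N].
    by rewrite /mdeg big1// => i _; rewrite ffunE.
  exists (cnorm u), [ffun=> 0%N], u; split => //.
  by rewrite /mdeg big1// => i _; rewrite ffunE.
move=> _ [a [u [an hu ->]]]; have [v [hv vM]] := hT a an.
by rewrite (weighted_deriv_unique hu hv).
Qed.

Lemma norm_Enb n w T M : En rep n w T -> En_norm rep n w T <= M -> Enb n w M T.
Proof.
move=> hT nM a an; have [u hu] := hT.2 a an; exists u; split => //.
apply: le_trans nM; apply: ub_le_sup; last by exists a, u.
(* A supremum dominates its set only when the set is bounded above; the finiteness of the set of
   multi-indices provides such a bound. *)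
have [M' hM'] := En_Enb hT; exists M' => _ [b [v [bn hv ->]]].
by have [v' [hv' v'M]] := hM' b bn; rewrite (weighted_deriv_unique hv hv').
Qed.

(** From here on bounded sets are described by elements of [E] with norm bounds, which are easier to
    add and to pass to the limit than suprema. *)
Lemma Eoo_boundedP (w : nat -> Rd -> R) (B : set (@functional R d)) :
  Eoo_bounded rep w B <-> (forall T, B T -> is_distribution T) /\
    forall n, exists M, forall T, B T -> Enb n (w n) M T.
Proof.
split=> [[BE hB]|[dB hB]].
  split; first by move=> T /BE /(_ 0%N I)[].
  move=> n; have [M hM] := hB n; exists M => T BT.
  by apply: norm_Enb; [exact: BE|exact: hM].
split=> [T BT n _|n].
  split; first exact: dB.
  move=> a an; have [M hM] := hB n; have [u [hu _]] := hM T BT a an.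
  by exists u.
by have [M hM] := hB n; exists M => T BT; apply: Enb_norm; exact: hM.
Qed.

End uniqueness.

(** A weight is Borel only up to a null set. The maximum of its Borel version with 1 is still a
    version, and is invertible everywhere. *)
Lemma weight_version w : is_weight w -> exists v : Rd -> R,
  [/\ measurable_fun setT v, forall x, 1 <= v x & {ae mu, forall x, w x = v x}].
Proof.
move=> [[v [mv wv]] w1 _]; exists (fun x => Num.max 1 (v x)); split.
- exact: measurable_maxr.
- by move=> x; rewrite le_max lexx.
- by apply: filterS wv => x /(_ I) wv; rewrite -wv max_r.
Qed.

(* The distributional sum [S] of an absolutely convergent series of E^n_w is in E^n_w. *)
Lemma Enb_lim n w (c : nat -> R) (c1 : R) (T : nat -> @functional R d) S :
    is_weight w -> (forall k, 0 <= c k) -> (forall K, \sum_(k < K) c k <= c1) ->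
    (forall k, Enb n w (c k) (T k)) ->
    (forall theta, test_fun theta -> forall e, 0 < e -> exists K0, forall K, (K0 <= K)%N ->
      normc (\sum_(k < K) T k theta - S theta) <= e) ->
  Enb n w c1 S.
Proof.
move=> hw c0 cs hT hS a an.
have [v [mv v1 wv]] := weight_version hw.
have /choice[u hu] : forall k, exists u, weighted_deriv rep w a (T k) u /\ cnorm u <= c k.
  by move=> k; exact: hT.
(* Partial sums in [E] of the derivatives of order [a]. Their increments are dominated by those of
   the bounds [c k], so they form a Cauchy sequence. *)
pose U K : E := \sum_(k < K) u k.
have dU K L : (L <= K)%N -> cnorm (U K - U L) <= \sum_(k < K) c k - \sum_(k < L) c k.
  move=> LK; rewrite -(subnKC LK); move: (K - L)%N => m; rewrite /U.
  rewrite !big_split_ord/= [X in cnorm X]addrAC subrr add0r [leRHS]addrAC subrr add0r.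
  elim/big_ind2 : _ => //; first by rewrite cnorm0.
    by move=> x1 x2 y1 y2 h1 h2; rewrite (le_trans (cnormD _ _))// lerD.
  by move=> i _; exact: (hu _).2.
have csn : {homo (fun K => \sum_(k < K) c k) : x y / (x <= y)%N >-> x <= y}.
  move=> x y xy; rewrite -(subnKC xy) big_split_ord/= lerDl sumr_ge0//.
have cscvg : cvgn (fun K => \sum_(k < K) c k).
  apply: nondecreasing_is_cvgn; first by move=> x y xy; exact: csn.
  by exists c1 => _ [K _ <-].
have tail e : 0 < e -> exists L, forall K, (L <= K)%N ->
    \sum_(k < K) c k - \sum_(k < L) c k < e.
  move=> e0; have e2 : 0 < e / 2 by rewrite divr_gt0.
  have /cvgrPdist_lt/(_ _ e2)[L _ hL] := cscvg.
  exists L => K LK; have h1 := hL L (leqnn L); have h2 := hL K LK.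
  set l := lim _ in h1 h2.
  rewrite (_ : _ - _ = (l - \sum_(k < L) c k) - (l - \sum_(k < K) c k)); last by ring.
  rewrite (splitr e); apply: (le_lt_trans (ler_norm _)).
  by rewrite (le_lt_trans (ler_normB _ _))// ltrD.
have /cauchy_cvgP/cvg_ex[/= V UV] : cauchy (U @ \oo).
  apply: cauchy_exP => e e0.
  (* Radii are positive elements of R[i], hence real. *)
  have ee : e = (Re e)%:C by apply: complex_eq => //=; rewrite ger0_Im// ltW.
  have e0' : 0 < Re e by rewrite -ltcR -ee.
  have [L hL] := tail _ e0'; exists (U L); exists L => // K /= LK.
  rewrite -ball_normE/= distrC norm_cnorm ee ltcR.
  exact: le_lt_trans (dU _ _ LK) (hL _ LK).
have limV e : 0 < e -> exists L, forall K, (L <= K)%N -> cnorm (V - U K) <= e.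
  move=> e0; have e0C : 0 < e%:C by rewrite ltcR.
  have /cvgrPdist_lt/(_ _ e0C)[L _ hL] := UV.
  exists L => K LK; have := hL K LK; rewrite /= norm_cnorm ltcR => h; exact: ltW.
have cU K : cnorm (U K) <= c1.
  apply: le_trans (cs K); have := dU K 0%N (leq0n K).
  by rewrite /U !big_ord0 !subr0.
have cV : cnorm V <= c1.
  apply/ler_addgt0Pl => e e0; have [L hL] := limV e e0.
  rewrite -(subrK (U L) V) (le_trans (cnormD _ _))// lerD//.
  exact: hL.
exists V; split => //.
have LV := TIBF_L1loc hE V.
(* The limit divided by the weight is the candidate for the derivative of [S]; as the weight is at
   least 1, it is locally integrable. *)
pose h x := rep V x * ((v x)^-1)%:C.
have v0 x : 0 < v x by exact: lt_le_trans (v1 x).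
have mvi : measurable_fun setT (fun x => (v x)^-1).
  rewrite (_ : (fun _ => _) = fun x => v x `^ (-1)).
    exact: (measurableT_comp (@measurable_powR R (-1))).
  by apply/funext => x; rewrite powR_inv1// ltW.
have Lh : L1loc h.
  apply: (ae_normc_L1loc _ LV).
    apply: cmeasurableM; [exact: L1loc_measurable|exact: cmeasurable_real].
  apply: aeW => x; rewrite /h normc_prod_real ler_piMr ?normc_ge0//.
  by rewrite ger0_norm ?invf_le1// invr_ge0 ltW.
exists h; split => //; last first.
  apply: filterS wv => x -> _; rewrite /h -mulrA -rmorphM/= mulVf ?mulr1//.
  by rewrite gt_eqF.
have /choice[g hg] : forall k, exists g, [/\ L1loc g, deq (dderiv a (T k)) (regular_dist g) &
    rep (u k) = (fun x => g x * (w x)%:C) %[ae mu]].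
  by move=> k; exact: (hu k).1.
have repU K : {ae mu, forall x, rep (U K) x = (\sum_(k < K) g k x) * (v x)%:C}.
  elim: K => [|K ih].
    rewrite /U big_ord0; apply: filterS rep0 => x ->; rewrite big_ord0 mul0r//.
  rewrite /U big_ord_recr/= -/(U K) addrC -[u K]scale1r.
  have [_ _ rg] := hg K.
  have rg' : {ae mu, forall x, rep (u K) x = g K x * (v x)%:C}.
    by move: rg wv; apply: filterS2 => x + <-; exact.
  move: (TIBF_linear hE 1 (u K) (U K)) ih rg'; apply: filterS3 => x h1 h2 h3.
  rewrite big_ord_recr/= h1// h2 h3; ring.
have LgK K : L1loc (fun x => \sum_(k < K) g k x).
  elim: K => [|K ih]; first by under eq_fun do rewrite big_ord0; exact: L1loc0.
  under eq_fun do rewrite big_ord_recr/= addrC.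
  by apply: L1locD => //; have [] := hg K.
have regK K theta : test_fun theta -> regular_dist (fun x => \sum_(k < K) g k x) theta =
    \sum_(k < K) regular_dist (g k) theta.
  move=> tt; elim: K => [|K ih].
    by under eq_fun do rewrite big_ord0; rewrite big_ord0 regular_dist0.
  under eq_fun do rewrite big_ord_recr/= addrC -[g K _]mul1r.
  have [Lg _ _] := hg K.
  by rewrite (regular_dist_linl _ Lg (LgK K) tt) ih big_ord_recr/= mul1r addrC.
(* Both sides are compared with the densities of the partial sums. These tend to the derivative of
   [S] on test functions, by the premise on [S], and to [h] in L^1 of each ball, by the continuity
   of the embedding of [E]. *)
move=> theta tt; apply/eqP; rewrite -subr_eq0; apply/eqP/Normc.eq0_normc/eqP.
rewrite eq_le normc_ge0 andbT; apply/ler_addgt0Pl => e e0; rewrite addr0.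
have [r [r0 [st rt]]] := (test_funP theta).1 tt.
have ct := csmooth_ccontinuous st.
have [M [M0 hM]] := supported_bounded ct rt.
have [ck hck] := TIBF_continuous hE (@cball_compact R d r).
have e2 : 0 < e / 2 by rewrite divr_gt0.
(* M bounds [theta], |ck| is the embedding constant for the ball, and 2 comes from
   [normc_cintegral_le]. *)
pose q := 2 * (M * `|ck|); have q0 : 0 <= q by rewrite mulr_ge0// mulr_ge0.
have e3 : 0 < e / 2 / (q + 1) by rewrite divr_gt0// ltr_wpDl.
have [L hL] := limV _ e3.
have [K0 hK0] := hS _ (test_fun_cderiv a tt) _ e2.
pose K := maxn L K0.
have H1 : normc (dderiv a S theta - regular_dist (fun x => \sum_(k < K) g k x) theta) <= e / 2.
  rewrite regK//.
  have -> : \sum_(k < K) regular_dist (g k) theta = (-1) ^+ mdeg a * \sum_(k < K) T k (cderiv a theta).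
    by rewrite big_distrr/=; apply: eq_bigr => k _; have [_ <-] := hg k.
  rewrite /dderiv -mulrBr Normc.normcM.
  have -> : (-1) ^+ mdeg a = ((-1) ^+ mdeg a)%:C :> C by rewrite rmorphXn/= rmorphN1.
  rewrite normc_real normrX normrN1 expr1n mul1r normcB.
  by apply: hK0; rewrite leq_maxr.
have H2 : normc (regular_dist (fun x => \sum_(k < K) g k x) theta - regular_dist h theta) <= e / 2.
  have -> : regular_dist (fun x => \sum_(k < K) g k x) theta - regular_dist h theta =
     regular_dist (fun x => -1 * h x + \sum_(k < K) g k x) theta.
    by rewrite regular_dist_linl// mulN1r addrC.
  have LD := L1loc_lin (-1) Lh (LgK K).
  apply: (le_trans (regular_dist_bound LD (ccontinuous_measurable ct) rt hM)).
  have lm : locmass (fun x => -1 * h x + \sum_(k < K) g k x) r <= `|ck| * (e / 2 / (q + 1)).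
    apply: (@le_trans _ _ (\int[mu]_(x in cball r) normc (rep (V - U K) x))).
      rewrite /locmass /Rintegral fine_le//.
      - apply: integrable_fin_num; first exact: measurable_cball.
        by apply: L1loc_integrable => //; exact: cball_compact.
      - apply: integrable_fin_num; first exact: measurable_cball.
        by apply: L1loc_integrable; [exact: (TIBF_L1loc hE)|exact: cball_compact].
      apply: ae_ge0_le_integral => //.
      - exact: measurable_cball.
      - by move=> x _; rewrite lee_fin normc_ge0.
      - apply: measurable_funTS; apply/measurable_EFinP; apply: measurable_normc.
        exact: L1loc_measurable.
      - by move=> x _; rewrite lee_fin normc_ge0.
      - apply: measurable_funTS; apply/measurable_EFinP; apply: measurable_normc.
        exact: (L1loc_measurable (TIBF_L1loc hE _)).
      move: (TIBF_linear hE (-1) (U K) V) (repU K).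
      apply: filterS2 => x h1 h2 _; rewrite lee_fin.
      rewrite (_ : V - U K = -1 *: U K + V); last by rewrite scaleN1r addrC.
      rewrite h1// h2.
      have -> : -1 * ((\sum_(k < K) g k x) * (v x)%:C) + rep V x =
          - ((-1 * h x + \sum_(k < K) g k x) * (v x)%:C).
        rewrite /h; have : ((v x)^-1)%:C * (v x)%:C = 1 by rewrite -rmorphM/= mulVf// gt_eqF.
        move: ((v x)^-1)%:C (v x)%:C => p p' pp.
        rewrite mulrDl -mulrA -mulrA pp; ring.
      (* A weight of at least 1 only enlarges the modulus, so the unweighted difference is dominated
         by the representative of [V - U K]. *)
      by rewrite normcN normc_prod_real ler_peMr ?normc_ge0// (le_trans (v1 x))// ler_norm.
    apply: (le_trans (hck _)); apply: (le_trans (ler_wpM2r (cnorm_ge0 _) (ler_norm ck))).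
    by rewrite ler_wpM2l// hL// leq_maxl.
  apply: (@le_trans _ _ (q * (e / 2 / (q + 1)))); last exact: absorb_le.
  by rewrite /q -2!mulrA ler_pM2l// ler_wpM2l.
rewrite (_ : _ - _ = (dderiv a S theta - regular_dist (fun x => \sum_(k < K) g k x) theta) +
  (regular_dist (fun x => \sum_(k < K) g k x) theta - regular_dist h theta)); last by ring.
by rewrite (le_trans (le_normcD _ _))// (splitr e) lerD.
Qed.

End weighted_spaces.

(** * Convolution in E^n_w *)

Section weighted_convolution.
Context {R : realType} {d : nat}.
Local Notation Rd := 'rV[R]_d.
Local Notation C := R[i].
Local Notation mu := (@lebesgue_rV R d).
Local Notation normc := (@Normc.normc R).
Local Notation conv := (@Defs.conv R d).
Variables (E : completeNormedModType C) (rep : E -> Rd -> C).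
Hypotheses (hE : TIBF rep) (hsolid : is_solid rep).
Local Notation Enb := (Enb rep).
Implicit Types (f g h phi psi theta : Rd -> C) (r : R) (s : seq 'I_d) (j : nat).
Implicit Types (T S : @functional R d) (alpha : {ffun 'I_d -> nat}) (w : Rd -> R) (u v : E).

(** Reflection preserves null sets by the change of variables. An almost everywhere property thus
    passes to the integrand of a convolution, at every point x. *)
Lemma ae_reflect (P : Rd -> Prop) (x : Rd) : {ae mu, forall y, P y} ->
  {ae mu, forall t, P (x - t)}.
Proof.
move=> [N [mN N0 PN]].
have n1 : -1 != 0 :> R by rewrite oppr_eq0 oner_eq0.
have maff := @measurable_rV_affine R d (-1) x.
have mN' : measurable ((fun t : Rd => -1 *: t + x) @^-1` N).
  by rewrite -[X in measurable X]setTI; exact: maff.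
exists ((fun t : Rd => -1 *: t + x) @^-1` N); split => //.
- have mi : measurable_fun setT (fun y : Rd => (\1_N y : R)%:E).
    by apply/measurable_EFinP; exact: measurable_indic.
  have := ge0_integral_rV_affine x n1 mi (fun y => _); rewrite integral_indic// setIT.
  move=> H; move: (H (fun y => ltac:(by rewrite lee_fin))) => {H}.
  rewrite (_ : (\int[mu]_y (\1_N y)%:E = 0)%E) ?mule0//.
  by rewrite integral_indic// setIT.
- by move=> t /= Pt; apply: PN => /= Pt'; apply: Pt; rewrite subrVE.
Qed.

(* By solidity [|h| w] is in [E], and [w' |h * phi| <= A (|h| w) * |phi|]. *)
Lemma weighted_conv h u w w' phi r (A : R) : L1loc h ->
    rep u = (fun x => h x * (w x)%:C) %[ae mu] -> is_weight w -> is_weight w' ->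
    ctest r phi -> 0 < A -> (forall x t, `|t| <= r -> w' x <= A * w (x - t)) ->
  exists u', rep u' = (fun x => conv h phi x * (w' x)%:C) %[ae mu] /\
    cnorm u' <= 2 * A * (cnorm u * L1norm phi).
Proof.
move=> Lh ru [_ w1 _] hw' tp A0 hA.
have cp := csmooth_ccontinuous tp.1.
have ip := cintegrable_ctest tp.
have Lu := TIBF_L1loc hE u.
have Lau : L1loc (fun x => (normc (rep u x))%:C).
  apply: (ae_normc_L1loc _ Lu); first by apply: cmeasurable_real; apply: measurable_normc; exact: L1loc_measurable.
  by apply: aeW => x; rewrite normc_real ger0_norm ?normc_ge0.
have [u1 [ru1 nu1]] : exists u1, rep u1 = (fun x => (normc (rep u x))%:C) %[ae mu] /\ cnorm u1 <= cnorm u.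
  apply: hsolid => //; apply: aeW => x.
  by rewrite normc_real ger0_norm ?normc_ge0.
pose phi1 x := (normc (phi x))%:C : C.
have [int1 [v [rv nv]]] := TIBF_module hE u1 (cintegrable_abs ip).
have L1phi : L1norm phi1 = L1norm phi.
  by rewrite /L1norm; apply: eq_Rintegral => x _; rewrite normc_real ger0_norm ?normc_ge0.
have [v' [mv' v'1 wv']] := weight_version hw'.
(* A is the cost of shifting the weight and 2 that of [normc_cintegral_le]; [v] represents the
   convolution of |h| w with |phi|. *)
pose v2 : E := (2 * A)%:C *: v + 0.
pose g x := conv h phi x * (v' x)%:C.
have mg : cmeasurable g.
  apply: cmeasurableM; last exact: cmeasurable_real.
  exact: ccontinuous_measurable (ccontinuous_conv Lh cp tp.2).
have w0 x : 0 <= w x by exact: le_trans (w1 x).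
have rh : {ae mu, forall y, rep u1 y = (normc (h y) * w y)%:C}.
  move: ru ru1; apply: filterS2 => y h1 h2; rewrite h2// h1// normc_prod_real.
  by rewrite (ger0_norm (w0 y)).
have key : {ae mu, forall x, normc (g x) <= normc (rep v2 x)}.
  have rv2 : {ae mu, forall x, rep v2 x = (2 * A)%:C * conv (rep u1) phi1 x}.
    move: (TIBF_linear hE (2 * A)%:C v 0) rv (rep0 hE); apply: filterS3 => x h1 h2 h3.
    by rewrite h1// h2// h3 addr0.
  move: wv' rv2 int1; apply: filterS3 => x wx -> ix.
  rewrite /g -wx !Normc.normcM !normc_real.
  have w'0 : 0 <= w' x by rewrite wx (le_trans _ (v'1 x)).
  have A2 : 0 <= 2 * A by rewrite mulr_ge0// ltW.
  rewrite (ger0_norm w'0) (ger0_norm A2) -[leRHS]mulrA.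
  have [_ [i2 _]] := conv_pairing x Lh cp tp.2.
  apply: (@le_trans _ _ (2 * L1norm (fun t => h (x - t) * phi t) * w' x)).
    by rewrite ler_wpM2r// normc_cintegral_le.
  rewrite -mulrA ler_pM2l//.
  have [ire _] := ix.
  have aeq : {ae mu, forall t, rep u1 (x - t) * phi1 t = (normc (h (x - t)) * w (x - t) * normc (phi t))%:C}.
    by apply: filterS (ae_reflect x rh) => t ->; rewrite /phi1 [RHS]rmorphM.
  (* This integrand is nonnegative almost everywhere, so its L^1 norm is the real part of the
     convolution, which the modulus dominates. *)
  apply: (@le_trans _ _ (A * L1norm (fun t => rep u1 (x - t) * phi1 t))); last first.
    rewrite ler_pM2l// (le_trans _ (Re_le_normc _))// (le_trans _ (ler_norm _))//.
    rewrite /Defs.conv /cintegral/= /L1norm le_eqVlt; apply/orP; left; apply/eqP.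
    rewrite /Rintegral; congr fine; apply: ae_eq_integral => //.
    - by apply/measurable_EFinP; exact: measurable_normc (cintegrable_measurable ix).
    - by apply/measurable_EFinP; exact: (cintegrable_measurable ix).1.
    - apply: filterS aeq => t -> _; rewrite normc_real ger0_norm//.
      by rewrite mulr_ge0 ?normc_ge0// mulr_ge0 ?normc_ge0.
  have in2 := cintegrable_normc i2; have inx := cintegrable_normc ix.
  rewrite /L1norm -RintegralZr// -RintegralZl//.
  have in2' : mu.-integrable setT (EFin \o (fun t => normc (h (x - t) * phi t) * w' x)).
    rewrite (_ : EFin \o _ = fun t => ((w' x)%:E * (normc (h (x - t) * phi t))%:E)%E).
      exact: integrableZl.
    by apply/funext => t /=; rewrite mulrC.
  have inx' : mu.-integrable setT (EFin \o (fun t => A * normc (rep u1 (x - t) * phi1 t))).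
    rewrite (_ : EFin \o _ = fun t => (A%:E * (normc (rep u1 (x - t) * phi1 t))%:E)%E)//.
    exact: integrableZl.
  rewrite /Rintegral fine_le//; [exact: integrable_fin_num|exact: integrable_fin_num|].
  apply: ae_ge0_le_integral => //.
  - by move=> t _; rewrite lee_fin mulr_ge0 ?normc_ge0.
  - exact: (measurable_int _ in2').
  - by move=> t _; rewrite lee_fin mulr_ge0 ?normc_ge0// ltW.
  - exact: (measurable_int _ inx').
  apply: filterS aeq => t -> _; rewrite lee_fin normc_real.
  rewrite (ger0_norm (mulr_ge0 (mulr_ge0 (normc_ge0 _) (w0 _)) (normc_ge0 _))).
  rewrite Normc.normcM; have [tr|tr] := leP `|t| r; last first.
    by rewrite tp.2// Normc.normc0 !mulr0 mul0r.
  rewrite (_ : A * _ = normc (h (x - t)) * normc (phi t) * (A * w (x - t))); last by ring.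
  by rewrite ler_wpM2l ?mulr_ge0 ?normc_ge0// hA.
(* Solidity a second time: [g] belongs to [E] because of its majorant [v2]. *)
have Lg : L1loc g := ae_normc_L1loc mg (TIBF_L1loc hE v2) key.
have [u' [ru' nu']] := hsolid Lg key.
exists u'; split.
  by move: ru' wv'; apply: filterS2 => x h1 h2 _; rewrite h1// h2.
have A2 : 0 <= 2 * A by rewrite mulr_ge0// ltW.
apply: (le_trans nu'); rewrite /v2 addr0 cnormZ normc_real (ger0_norm A2).
by rewrite ler_wpM2l// (le_trans nv)// L1phi ler_wpM2r// L1norm_ge0.
Qed.

(* All derivatives fall on [T]; as the word [s] has even length, the signs cancel. The
   premise on [s] says that word ++ s is, up to reordering, the word of a multi-index. *)
Lemma Enb_conv n k w w' phi r (A c : R) T s : is_distribution T ->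
    is_weight w -> is_weight w' -> ctest r phi -> 0 < A ->
    (forall x t, `|t| <= r -> w' x <= A * w (x - t)) ->
    size s = k -> ~~ odd k ->
    (forall alpha, exists beta, mdeg beta = (mdeg alpha + k)%N /\
      forall phi psi r r', ctest r phi -> ctest r' psi ->
        cpartials (word alpha ++ s) (conv phi psi) = cpartials (word beta) (conv phi psi)) ->
    Enb (n + k) w c T ->
  Enb n w' (2 * A * L1norm phi * c) (regular_dist (dconv T (cpartials s phi))).
Proof.
move=> hT hw hw' tp A0 hA sk ek hs hn a an.
have [b [bk bE]] := hs a.
have [|u [[h [Lh Th ru]] uc]] := hn b; first by rewrite bk leq_add2r.
have [u' [ru' nu']] := weighted_conv Lh ru hw hw' tp A0 hA.
exists u'; split; last first.
  apply: (le_trans nu'); rewrite -[leRHS]mulrA ler_pM2l ?mulr_gt0// mulrC.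
  by rewrite ler_wpM2l// L1norm_ge0.
have cp := csmooth_ccontinuous tp.1.
(* [h] is the density of the derivative of [T] of order [b], that is, [a] together with [s]; so the
   derivative of order [a] of T convolved with the [s]-derivative of [phi] has density h * phi. *)
exists (conv h phi); split => //.
  exact/ccontinuous_L1loc/(ccontinuous_conv Lh cp tp.2).
move=> theta /test_funP[r' [r'0 tt]].
have tps := ctest_partials s tp.
have ttd := ctest_cderiv a tt.
have tf := ctest_flip tp.
rewrite (conv_regular Lh cp tp.2).
rewrite (dist_conv_flip (regular_dist_distribution Lh) tp tt).
have tcv := ctest_conv tt tf.
rewrite -(Th _ (ctest_test_fun tcv)) /dderiv (dist_conv_flip hT tps ttd).
have sgn : (-1) ^+ size s = 1 :> R by rewrite sk -signr_odd (negbTE ek).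
have -> : flip (cpartials s phi) = cpartials s (flip phi).
  by rewrite (cpartials_flip s tp) sgn; apply/funext => x; rewrite mul1r.
rewrite cderivE -(cpartials_conv _ _ tt tf) cderivE (bE _ _ _ _ tt tf) bk exprD.
by rewrite -[(-1) ^+ k]signr_odd (negbTE ek) mulr1.
Qed.

(** Two letters i are inserted in the block of i, which gives the word of a multi-index; on a
    convolution they may be moved from there to the end. *)
Lemma word_add2 alpha i : exists beta, mdeg beta = (mdeg alpha + 2)%N /\
  forall phi psi r r', ctest r phi -> ctest r' psi ->
    cpartials (word alpha ++ [:: i; i]) (conv phi psi) = cpartials (word beta) (conv phi psi).
Proof.
pose b : {ffun 'I_d -> nat} := [ffun k => (alpha k + (k == i).*2)%N].
exists b.
have [s1 [s2 [ws wb]]] : exists s1 s2, word alpha = s1 ++ s2 /\ word b = s1 ++ [:: i; i] ++ s2.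
  have iin : i \in enum 'I_d by rewrite mem_enum.
  have := enum_uniq 'I_d; rewrite /word; move: iin.
  elim: (enum 'I_d) => //= k l ih; rewrite inE => /orP[/eqP <-|il] /andP[kl ul].
    exists [::], (nseq (alpha i) i ++ flatten [seq nseq (alpha k) k | k <- l]); split => //.
    rewrite /= ffunE eqxx addnC /= ; congr [:: _, _ & _ ++ flatten _].
    apply/eq_in_map => k' k'l; rewrite ffunE; case: eqP => [k'i|_]; last by rewrite addn0.
    by move: kl; rewrite -k'i k'l.
  have [s1 [s2 [e1 e2]]] := ih il ul.
  have ki : k != i by apply: contraNneq kl => ->.
  exists (nseq (alpha k) k ++ s1), s2; rewrite e1 e2 ffunE (negbTE ki) addn0 !catA//.
split.
  by rewrite -!size_word ws wb !size_cat/= addnCA addnC.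
move=> phi psi r r' tp tq; rewrite ws wb -catA cpartials_cat.
by rewrite (cpartials_convC s2 [:: i; i] tp tq) -cpartials_cat.
Qed.

End weighted_convolution.

(** * Growth of families and the bootstrap *)

Section bounded_families.
Context {R : realType} {d : nat}.
Local Notation Rd := 'rV[R]_d.
Local Notation C := R[i].
Local Notation normc := (@Normc.normc R).
Local Notation conv := (@Defs.conv R d).
Variables (E : completeNormedModType C) (rep : E -> Rd -> C).
Hypotheses (hE : TIBF rep) (hsolid : is_solid rep).
Variable w : nat -> Rd -> R.
Hypotheses (hw : weight_system w) (hwM : wM w).
Local Notation Enb := (Enb rep).
Implicit Types (f g h phi psi theta : Rd -> C) (r : R) (s : seq 'I_d) (j : nat).
Implicit Types (T S : @functional R d) (alpha : {ffun 'I_d -> nat}).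

Lemma weight_mono m n x : (m <= n)%N -> w m x <= w n x.
Proof.
move=> mn; rewrite -(subnKC mn); elim: (n - m)%N => [|k ih]; first by rewrite addn0.
by rewrite addnS (le_trans ih)// hw.2.
Qed.

Lemma Enb_ge0 n (v : Rd -> R) c T : Enb n v c T -> 0 <= c.
Proof.
move=> /(_ [ffun=> 0%N])[|u [_ uc]]; last exact: le_trans (cnorm_ge0 u) uc.
by rewrite /mdeg big1// => i _; rewrite ffunE.
Qed.

Lemma Enb_scale n (v : Rd -> R) c T (a : C) : Enb n v c T -> Enb n v (normc a * c) (fun phi => a * T phi).
Proof.
move=> hT; rewrite -[normc a * c]addr0.
rewrite (_ : (fun phi => _) = fun phi => a * T phi + 0).
  by apply: Enb_lin => //; exact: Enb0.
by apply/funext => phi; rewrite addr0.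
Qed.

Lemma Enb_big n (v : Rd -> R) (I : Type) (l : seq I) (c : R) (T : I -> @functional R d) :
  (forall i, Enb n v c (T i)) ->
  Enb n v ((size l)%:R * c) (fun phi => \sum_(i <- l) T i phi).
Proof.
move=> hT; elim: l => [|i l ih].
  rewrite mul0r; under eq_fun do rewrite big_nil; exact: Enb0.
rewrite (_ : (fun phi => _) = fun phi => 1 * T i phi + \sum_(j <- l) T j phi).
  have := Enb_lin hE 1 (hT i) ih.
  by rewrite Normc.normc1 mul1r /= -natr1 mulrDl mul1r [_ + c]addrC.
by apply/funext => phi; rewrite big_cons mul1r.
Qed.

(* [F i = O(a i)] in E^oo_W. *)
Definition bounded_by (I : Type) (F : I -> @functional R d) (a : I -> R) :=
  forall n, exists c, 0 <= c /\ forall i, Enb n (w n) (c * a i) (F i).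

Lemma bounded_by_deq (I : Type) (F G : I -> @functional R d) (a b : I -> R) :
  (forall i, deq (F i) (G i)) -> (forall i, a i <= b i) -> bounded_by F a -> bounded_by G b.
Proof.
move=> FG ab hF n; have [c [c0 hc]] := hF n; exists c; split => // i.
apply: (Enb_le (leqnn n) _ (Enb_deq (FG i) (hc i))).
by rewrite ler_wpM2l.
Qed.

Lemma bounded_byD (I : Type) (F G : I -> @functional R d) (a : I -> R) :
  (forall i, 0 <= a i) -> bounded_by F a -> bounded_by G a ->
  bounded_by (fun i phi => F i phi + G i phi) a.
Proof.
move=> a0 hF hG n; have [c [c0 hc]] := hF n; have [c' [c'0 hc']] := hG n.
exists (c + c'); split; first exact: addr_ge0.
move=> i; have := Enb_lin hE 1 (hc i) (hc' i).
by rewrite Normc.normc1 mul1r -mulrDl; apply: Enb_deq => phi _; rewrite mul1r.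
Qed.

Lemma bounded_by_scale (I : Type) (F : I -> @functional R d) (a : I -> R) (b : I -> C) :
  bounded_by F a -> bounded_by (fun i phi => b i * F i phi) (fun i => normc (b i) * a i).
Proof.
move=> hF n; have [c [c0 hc]] := hF n; exists c; split => // i.
by rewrite mulrCA; exact: Enb_scale.
Qed.

(** The constant depends on the radius, the L^1 norm of [phi] and the weights, none of which sees
    the scale e i. Index and scale are kept apart because the bootstrap convolves the member J of a
    family with kernels of scale J + k. *)
Lemma bounded_by_conv (I : Type) (F : I -> @functional R d) (a : I -> R) (e : I -> nat) phi r k s :
    (forall i, is_distribution (F i)) -> (forall i, 0 <= a i) -> 0 <= r -> ctest r phi ->
    size s = k -> ~~ odd k ->
    (forall alpha, exists beta, mdeg beta = (mdeg alpha + k)%N /\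
      forall phi psi r r', ctest r phi -> ctest r' psi ->
        cpartials (word alpha ++ s) (conv phi psi) = cpartials (word beta) (conv phi psi)) ->
    bounded_by F a ->
  bounded_by (fun i => regular_dist (dconv (F i) (cpartials s (dilate phi (e i))))) a.
Proof.
move=> dF a0 r0 tp sk ek hs hF n.
have [m [A [A0 hA]]] := weight_shift hw hwM r n.
(* One index, large enough both for the k extra derivatives and for the shifted weight. *)
pose N := maxn (n + k) m.
have [c [c0 hc]] := hF N.
exists (2 * A * L1norm phi * c); split.
  by rewrite mulr_ge0// mulr_ge0 ?L1norm_ge0// mulr_ge0// ltW.
move=> i; rewrite -[_ * a i]mulrA -(L1norm_dilate (e i) (cintegrable_ctest tp)).
apply: (Enb_conv hE hsolid (dF i) (hw.1 N) (hw.1 n) (ctest_dilate (e i) r0 tp) A0 _ sk ek hs).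
  move=> x t tr; apply: (le_trans (hA x t tr)); rewrite ler_pM2l//.
  by apply: weight_mono; rewrite leq_maxr.
by apply: (Enb_le _ (lexx _) (hc i)); rewrite leq_maxl.
Qed.

Lemma bounded_by_conv0 (I : Type) (F : I -> @functional R d) (a : I -> R) (e : I -> nat) phi r :
    (forall i, is_distribution (F i)) -> (forall i, 0 <= a i) -> 0 <= r -> ctest r phi ->
    bounded_by F a ->
  bounded_by (fun i => regular_dist (dconv (F i) (dilate phi (e i)))) a.
Proof.
move=> dF a0 r0 tp hF.
have hs alpha : exists beta, mdeg beta = (mdeg alpha + 0)%N /\
    forall phi psi r r', ctest r phi -> ctest r' psi ->
      cpartials (word alpha ++ [::]) (conv phi psi) = cpartials (word beta) (conv phi psi).
  by exists alpha; rewrite addn0 cats0.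
apply: bounded_by_deq (bounded_by_conv e dF a0 r0 tp (erefl : size [::] = 0%N) isT hs hF) => //.
by move=> i theta _; rewrite cpartials_nil.
Qed.

Lemma ctest_laplacian r phi : ctest r phi -> ctest r (laplacian phi).
Proof. by move=> tp; apply: ctest_sum => i; exact: ctest_partials. Qed.

Lemma regular_dist_sum (I : Type) (l : seq I) (h : I -> Rd -> C) theta :
  (forall i, L1loc (h i)) -> test_fun theta ->
  regular_dist (fun x => \sum_(i <- l) h i x) theta = \sum_(i <- l) regular_dist (h i) theta /\
  L1loc (fun x => \sum_(i <- l) h i x).
Proof.
move=> Lh tt; elim: l => [|i l [ih1 ih2]].
  under eq_fun do rewrite big_nil; rewrite big_nil regular_dist0.
  by split => //; exact: L1loc0.
have -> : (fun x => \sum_(j <- (i :: l)) h j x) = fun x => 1 * h i x + \sum_(j <- l) h j x.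
  by apply/funext => x; rewrite big_cons mul1r.
split; last exact: L1loc_lin.
by rewrite regular_dist_linl// ih1 big_cons mul1r.
Qed.

Lemma dconv_sum T r (I : Type) (l : seq I) (F : I -> Rd -> C) :
  is_distribution T -> (forall i, ctest r (F i)) ->
  dconv T (fun x => \sum_(i <- l) F i x) = fun x => \sum_(i <- l) dconv T (F i) x.
Proof.
move=> hT hF; apply/funext => x.
have := @dist_sum R d T (r + `|x|) I l (fun=> 1) (fun i y => F i (x - y)) hT.
rewrite /dconv => H.
transitivity (\sum_(i <- l) 1 * T (fun y => F i (x - y))); last first.
  by apply: eq_bigr => i _; rewrite mul1r.
rewrite -H; last by move=> i; exact: ctest_reflect.
by congr T; apply/funext => y; apply: eq_bigr => i _; rewrite mul1r.
Qed.

Lemma dconv_lin T (a : C) r phi psi : is_distribution T -> ctest r phi -> ctest r psi ->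
  dconv T (fun x => a * phi x + psi x) = fun x => a * dconv T phi x + dconv T psi x.
Proof.
move=> hT tp tq; apply/funext => x; rewrite /dconv.
exact: (dist_lin a hT (ctest_reflect x tp) (ctest_reflect x tq)).
Qed.

Lemma L1loc_dconv T r phi : is_distribution T -> ctest r phi -> L1loc (dconv T phi).
Proof. by move=> hT /ctest_test_fun tp; exact/ccontinuous_L1loc/ccontinuous_dconv. Qed.

Lemma bounded_by_laplacian (I : Type) (F : I -> @functional R d) (a : I -> R) (e : I -> nat) phi r :
    (forall i, is_distribution (F i)) -> (forall i, 0 <= a i) -> 0 <= r -> ctest r phi ->
    bounded_by F a ->
  bounded_by (fun i => regular_dist (dconv (F i) (laplacian (dilate phi (e i))))) a.
Proof.
move=> dF a0 r0 tp hF n.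
have /choice[c hc] : forall k : 'I_d, exists c, 0 <= c /\ forall i, Enb n (w n) (c * a i)
    (regular_dist (dconv (F i) (cpartials [:: k; k] (dilate phi (e i))))).
  move=> k.
  have h := @bounded_by_conv I F a e phi r 2 [:: k; k] dF a0 r0 tp erefl isT
    (fun alpha => word_add2 alpha k) hF.
  exact: h n.
pose c1 := \sum_k c k.
have cc k : c k <= c1.
  by rewrite /c1 (bigD1 k)//= lerDl sumr_ge0// => k' _; have [] := hc k'.
have c10 : 0 <= c1 by apply: sumr_ge0 => k _; have [] := hc k.
exists ((size (index_enum 'I_d))%:R * c1); split; first by rewrite mulr_ge0.
move=> i; rewrite -mulrA.
have td := ctest_dilate (e i) r0 tp.
apply: Enb_deq (Enb_big (index_enum 'I_d) (c := c1 * a i)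
  (T := fun k => regular_dist (dconv (F i) (cpartials [:: k; k] (dilate phi (e i))))) _).
  move=> theta tt; rewrite (dconv_sum _ (dF i) (fun k => ctest_partials [:: k; k] td)).
  rewrite (regular_dist_sum _ _ tt).1// => k.
  exact: L1loc_dconv (dF i) (ctest_partials [:: k; k] td).
move=> k; apply: (Enb_le (leqnn n) _ ((hc k).2 i)).
by rewrite ler_wpM2r.
Qed.

(** * Lowering the growth exponent along an MDFP factorization *)

Section bootstrap.
Variables (f0 : @functional R d) (hf : is_distribution f0).
Variables (r : R) (P Q chi : 'I_2 -> Rd -> C).
Hypotheses (r0 : 0 <= r) (tP : forall l, ctest r (P l)) (tQ : forall l, ctest r (Q l))
  (tchi : forall l, ctest r (chi l)).
Hypothesis PQ : forall x, 2 ^+ d * P 0 (2 *: x) - P 0 x = laplacian (Q 0) x.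
Hypothesis intP : cintegral (P 0) = 1.
Hypothesis PE : P 0 = (conv (chi 0) (P 0) \+ conv (chi 1) (P 1)).
Hypothesis QE : Q 0 = (conv (chi 0) (Q 0) \+ conv (chi 1) (Q 1)).

Let g (l : 'I_2) j := regular_dist (dconv f0 (dilate (chi l) j)).
Let D j x := dilate (P 0) j.+1 x - dilate (P 0) j x.
Let q j : R := (2 ^+ j ^+ 2)^-1.

Let q_ge0 j : 0 <= q j. Proof. by rewrite invr_ge0 !exprn_ge0. Qed.

Let tdP l j : ctest r (dilate (P l) j). Proof. exact: ctest_dilate. Qed.
Let tdQ l j : ctest r (dilate (Q l) j). Proof. exact: ctest_dilate. Qed.
Let tdchi l j : ctest r (dilate (chi l) j). Proof. exact: ctest_dilate. Qed.

Let dist_g l j : is_distribution (g l j).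
Proof. exact: regular_dist_distribution (L1loc_dconv hf (tdchi l j)). Qed.

Lemma laplacian_dilate phi j : ctest r phi ->
  laplacian (dilate phi j) = fun x => (2 ^+ j ^+ 2)%:C * dilate (laplacian phi) j x.
Proof.
move=> tp; apply/funext => x.
transitivity (\sum_(i < d) (2 ^+ j ^+ 2)%:C * dilate (cpartials [:: i; i] phi) j x).
  by apply: eq_bigr => i _; rewrite (cpartials_dilate j [:: i; i] tp).
by rewrite -big_distrr/=; congr (_ * _); rewrite /dilate -big_distrr.
Qed.

Let DE j : D j = fun x => (q j)%:C * laplacian (dilate (Q 0) j) x.
Proof.
apply/funext => x; rewrite /D laplacian_dilate// /dilate -PQ.
rewrite mulrA -rmorphM/= /q mulVf ?mul1r; last by rewrite !expf_neq0.
by rewrite mulSn exprD exprS scalerA -[2 ^+ d * _ * _]mulrA mulrCA mulrBr.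
Qed.

Let tD j : ctest r (D j).
Proof.
have := ctest_lin (-1) (tdP 0 j) (tdP 0 j.+1); congr ctest.
by apply/funext => x; rewrite mulN1r addrC.
Qed.

Let dconv_D T j theta : is_distribution T -> test_fun theta ->
  regular_dist (dconv T (D j)) theta =
  regular_dist (dconv T (dilate (P 0) j.+1)) theta - regular_dist (dconv T (dilate (P 0) j)) theta.
Proof.
move=> hT tt.
have -> : D j = fun x => -1 * dilate (P 0) j x + dilate (P 0) j.+1 x.
  by apply/funext => x; rewrite mulN1r addrC.
rewrite (dconv_lin _ hT (tdP 0 j) (tdP 0 j.+1)) regular_dist_linl//.
- by rewrite mulN1r addrC.
- exact: L1loc_dconv (tdP 0 j).
- exact: L1loc_dconv (tdP 0 j.+1).
Qed.

Let telescope T J K theta : is_distribution T -> test_fun theta ->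
  \sum_(k < K) regular_dist (dconv T (D (J + k))) theta =
  regular_dist (dconv T (dilate (P 0) (J + K))) theta - regular_dist (dconv T (dilate (P 0) J)) theta.
Proof.
move=> hT tt; elim: K => [|K ih]; first by rewrite big_ord0 addn0 subrr.
by rewrite big_ord_recr/= ih dconv_D// addnS; ring.
Qed.

Let dilateD phi psi j : dilate (phi \+ psi) j = fun x => dilate phi j x + dilate psi j x.
Proof. by apply/funext => x; rewrite /dilate/= mulrDr. Qed.

(** Associativity regroups the factorization so that [f] enters only through the g^l_j, whose growth
    is known. *)
Let dconv_PE j : dconv f0 (dilate (P 0) j) =
  fun x => 1 * dconv (g 0 j) (dilate (P 0) j) x + dconv (g 1 j) (dilate (P 1) j) x.
Proof.
have t0 := ctest_conv (tdchi 0 j) (tdP 0 j); have t1 := ctest_conv (tdchi 1 j) (tdP 1 j).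
have key l : dconv (g l j) (dilate (P l) j) = dconv f0 (conv (dilate (chi l) j) (dilate (P l) j)).
  rewrite -(dconv_conv hf (tdchi l j) (tdP l j)).
  by rewrite (conv_regular (L1loc_dconv hf (tdchi l j)) (csmooth_ccontinuous (tdP l j).1) (tdP l j).2).
rewrite !key -(dconv_lin 1 hf t0 t1); congr dconv.
rewrite [in LHS]PE dilateD (dilate_conv j (tchi 0) (tP 0)) (dilate_conv j (tchi 1) (tP 1)).
by apply/funext => x; rewrite mul1r.
Qed.

Let dconv_DE j : dconv f0 (D j) = fun x => (q j)%:C *
  (1 * dconv (g 0 j) (laplacian (dilate (Q 0) j)) x + dconv (g 1 j) (laplacian (dilate (Q 1) j)) x).
Proof.
have tl l := ctest_laplacian (tdQ l j).
have t0 := ctest_conv (tdchi 0 j) (tl 0); have t1 := ctest_conv (tdchi 1 j) (tl 1).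
have key l : dconv (g l j) (laplacian (dilate (Q l) j)) = dconv f0 (conv (dilate (chi l) j) (laplacian (dilate (Q l) j))).
  rewrite -(dconv_conv hf (tdchi l j) (tl l)).
  by rewrite (conv_regular (L1loc_dconv hf (tdchi l j)) (csmooth_ccontinuous (tl l).1) (tl l).2).
have lap l : laplacian (conv (dilate (chi l) j) (dilate (Q l) j)) = conv (dilate (chi l) j) (laplacian (dilate (Q l) j)).
  have Lc := ccontinuous_L1loc (csmooth_ccontinuous (tdchi l j).1).
  rewrite /laplacian (conv_regular Lc (csmooth_ccontinuous (tl l).1) (tl l).2).
  rewrite (dconv_sum _ (regular_dist_distribution Lc) (fun k => ctest_partials [:: k; k] (tdQ l j))).
  apply/funext => x; apply: eq_bigr => k _.
  have tk := ctest_partials [:: k; k] (tdQ l j).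
  by rewrite (csmooth_conv Lc (tdQ l j)).2 (conv_regular Lc (csmooth_ccontinuous tk.1) tk.2).
rewrite !key.
have -> : D j = fun x => (q j)%:C * (1 * conv (dilate (chi 0) j) (laplacian (dilate (Q 0) j)) x +
    conv (dilate (chi 1) j) (laplacian (dilate (Q 1) j)) x) + 0.
  rewrite DE; apply/funext => x; rewrite addr0 mul1r; congr (_ * _).
  rewrite [in LHS]QE dilateD (dilate_conv j (tchi 0) (tQ 0)) (dilate_conv j (tchi 1) (tQ 1)).
  rewrite -!lap /laplacian -big_split/=; apply: eq_bigr => k _.
  have s0 := (ctest_conv (tdchi 0 j) (tdQ 0 j)).1; have s1 := (ctest_conv (tdchi 1 j) (tdQ 1 j)).1.
  have := (csmooth_lin 1 s0 s1).2 [:: k; k] => /(congr1 (fun u => u x)).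
  by rewrite mul1r => <-; congr (cpartials _ _ x); apply/funext => y; rewrite mul1r.
have t01 := ctest_lin 1 t0 t1.
rewrite (dconv_lin _ hf t01 (@ctest0 R d (r + r))) (dconv_lin _ hf t0 t1).
by apply/funext => x; rewrite [X in _ + X](_ : _ = 0) ?addr0// /dconv dist0.
Qed.

Let bounded_P (a : nat -> R) : (forall j, 0 <= a j) -> (forall l, bounded_by (g l) a) ->
  bounded_by (fun j => regular_dist (dconv f0 (dilate (P 0) j))) a.
Proof.
move=> a0 hg.
have b l := @bounded_by_conv0 nat (g l) a id (P l) r (dist_g l) a0 r0 (tP l) (hg l).
apply: (bounded_by_deq _ (fun j => lexx _) (bounded_byD a0 (b 0) (b 1))).
move=> j theta tt; rewrite dconv_PE regular_dist_linl// ?mul1r//.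
- exact: L1loc_dconv (dist_g 0 j) (tdP 0 j).
- exact: L1loc_dconv (dist_g 1 j) (tdP 1 j).
Qed.

Let bounded_D (a : nat -> R) : (forall j, 0 <= a j) -> (forall l, bounded_by (g l) a) ->
  bounded_by (fun j => regular_dist (dconv f0 (D j))) (fun j => q j * a j).
Proof.
move=> a0 hg.
have b l := @bounded_by_laplacian nat (g l) a id (Q l) r (dist_g l) a0 r0 (tQ l) (hg l).
apply: (bounded_by_deq _ _ (bounded_by_scale (fun j => (q j)%:C) (bounded_byD a0 (b 0) (b 1)))).
  move=> j theta tt; rewrite dconv_DE.
  have L0 := L1loc_dconv (dist_g 0 j) (ctest_laplacian (tdQ 0 j)).
  have L1 := L1loc_dconv (dist_g 1 j) (ctest_laplacian (tdQ 1 j)).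
  rewrite (_ : (fun x => _) = fun x => (q j)%:C * (1 * dconv (g 0 j) (laplacian (dilate (Q 0) j)) x +
     dconv (g 1 j) (laplacian (dilate (Q 1) j)) x) + 0); last by apply/funext => x; rewrite addr0.
  rewrite regular_dist_linl//; [|exact: L1loc_lin|exact: L1loc0].
  by rewrite regular_dist0 addr0 regular_dist_linl// mul1r.
by move=> j; rewrite normc_real ger0_norm.
Qed.

Let q_geom J k : q (J + k) = q J * 4^-1 ^+ k.
Proof.
rewrite /q exprD exprMn invfM; congr (_ * _).
by rewrite -exprM mulnC exprM -exprVn; congr (_^-1 ^+ k); rewrite expr2 -natrM.
Qed.

Let geom_le K : \sum_(k < K) (4^-1 : R) ^+ k <= 2.
Proof.
(* The subtracted term makes the induction close. *)
have : \sum_(k < K) (4^-1 : R) ^+ k <= 2 - 2 * 4^-1 ^+ K; last first.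
  by move/le_trans; apply; rewrite gerBl mulr_ge0// exprn_ge0// invr_ge0.
elim: K => [|K ih]; first by rewrite big_ord0 expr0; lra.
rewrite big_ord_recr/= exprS.
have : 0 <= (4^-1 : R) ^+ K by rewrite exprn_ge0// invr_ge0.
lra.
Qed.

Lemma bootstrap_final : (forall l, bounded_by (g l) (fun j => 2 ^+ j)) ->
  forall n, exists c, Enb n (w n) c f0.
Proof.
move=> hg n; have a0 j : 0 <= (2 : R) ^+ j by rewrite exprn_ge0.
have [c [c0 hc]] := bounded_P a0 hg n; have [c' [c'0 hc']] := bounded_D a0 hg n.
(* The increments of f * phi^0_j decay geometrically here, which makes the series summable. *)
have qa j : q j * 2 ^+ j = 2^-1 ^+ j.
  by rewrite /q expr2 invfM -mulrA mulVf ?mulr1 ?exprVn// expf_neq0.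
(* The term of index 0 is f * phi^0_0, so the increments are shifted by one. *)
pose T k := if k is k'.+1 then regular_dist (dconv f0 (D k'))
            else regular_dist (dconv f0 (dilate (P 0) 0)).
pose b k : R := if k is k'.+1 then c' * 2^-1 ^+ k' else c.
exists (c + 2 * c').
apply: (Enb_lim hE (c := b) (T := T) (hw.1 n)).
- by case=> //= k; rewrite mulr_ge0// exprn_ge0// invr_ge0.
- case=> [|K]; first by rewrite big_ord0 addr_ge0// mulr_ge0.
  rewrite big_ord_recl/= lerD2l -big_distrr/= mulrC ler_wpM2r//.
  have : \sum_(k < K) (2^-1 : R) ^+ k <= 2 - 2^-1 ^+ K * 2; last first.
    by move/le_trans; apply; rewrite gerBl mulr_ge0// exprn_ge0// invr_ge0.
  elim: K => [|K ih]; first by rewrite big_ord0 expr0; lra.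
  by rewrite big_ord_recr/= exprS; lra.
- case=> [|k] /=; first by have := hc 0%N; rewrite expr0 mulr1.
  by have := hc' k; rewrite qa.
- move=> theta /[dup] tt /test_funP[r' [r'0 tt']] e e0.
  have [j0 hj0] := dconv_approx hf (tP 0) r0 intP tt' e0.
  exists j0.+1; case=> // K; rewrite ltnS => jK.
  rewrite big_ord_recl/= (_ : \sum_(i < K) _ = \sum_(k < K) regular_dist (dconv f0 (D (0 + k))) theta)//.
  by rewrite telescope// [X in X - _]addrC subrK add0n; exact: hj0.
Qed.

(** Only one power of 2^j is gained, although 4^(-j) suggests two: for N = 2 the increments are
    merely bounded, and the sum of J of them is absorbed by 2^J. *)
Lemma bootstrap_step N : (2 <= N)%N ->
  (forall l, bounded_by (g l) (fun j => 2 ^+ (N * j))) ->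
  forall l, bounded_by (g l) (fun j => 2 ^+ (N.-1 * j)).
Proof.
move=> N2 hg l; have a0 M j : 0 <= (2 : R) ^+ (M * j) by rewrite exprn_ge0.
have qa j : q j * 2 ^+ (N * j) <= 2 ^+ (N.-1 * j).
  rewrite /q mulrC ler_pdivrMr ?exprn_gt0// -exprM -exprD ler_weXn2l ?ler1n//.
  by case: N N2 {hg} => //= N _; rewrite mulSn addnC leq_add2l leq_pmulr.
have hP : bounded_by (fun j => regular_dist (dconv f0 (dilate (P 0) j))) (fun j => 2 ^+ (N.-1 * j)).
  move=> n; have [c [c0 hc]] := bounded_P (a0 N) hg n; have [c' [c'0 hc']] := bounded_D (a0 N) hg n.
  exists (c + c'); split; first exact: addr_ge0.
  move=> J.
  (* Induction by doubling: the bound at J plus the term of index J is at most twice 2^((N-1)J),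
     hence at most 2^((N-1)(J+1)) since N >= 2. *)
  have s1 : \sum_(k < J) c' * (q k * 2 ^+ (N * k)) <= c' * 2 ^+ (N.-1 * J).
    rewrite -big_distrr/= ler_wpM2l//; elim: J => [|J ih]; first by rewrite big_ord0.
    rewrite big_ord_recr/= (le_trans (lerD ih (qa J)))//.
    rewrite -mulr2n -[_ *+ 2]mulr_natl -exprS ler_weXn2l ?ler1n//.
    by case: N N2 {hg hc hc' qa ih} => // -[|N]//= _; rewrite mulnS -addn1 addnC leq_add2r.
  have h0 : Enb n (w n) c (regular_dist (dconv f0 (dilate (P 0) 0))).
    by have := hc 0%N; rewrite muln0 expr0 mulr1.
  have := Enb_lin hE 1 h0 (Enb_sum hE J hc').
  rewrite Normc.normc1 mul1r => h; apply: (Enb_le (leqnn n) _ (Enb_deq _ h)).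
    rewrite mulrDl lerD// ler_peMr// exprn_ege1// ler1n//.
  move=> theta tt; rewrite mul1r.
  rewrite (_ : \sum_(k < J) _ = \sum_(k < J) regular_dist (dconv f0 (D (0 + k))) theta)//.
  by rewrite telescope// addrC subrK add0n.
pose G j := regular_dist (dconv f0 (dilate (P 0) j)).
have dG j : is_distribution (G j) by exact: regular_dist_distribution (L1loc_dconv hf (tdP 0 j)).
have b1 := @bounded_by_conv0 nat G _ id (chi l) r dG (a0 N.-1) r0 (tchi l) hP.
(* The pair (J, k) stands for g_J against the kernel of scale J + k. One constant for all pairs lets
   the series in k be summed uniformly in J. *)
pose F (p : nat * nat) := g l p.1.
have hF : bounded_by F (fun p => 2 ^+ (N * p.1)).
  by move=> n; have [c [c0 hc]] := hg l n; exists c; split => // p; exact: hc.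
have b2 := @bounded_by_laplacian (nat * nat) F _ (fun p => p.1 + p.2)%N (Q 0) r
  (fun p => dist_g l p.1) (fun p => a0 N p.1) r0 (tQ 0) hF.
(* This difference is the sum over k of the convolutions of g_J with [D (J + k)]. As q (J + k) =
   4^(-k) q J, the norms add up to at most 2 c q_J 2^(NJ). *)
have b3 : bounded_by (fun j phi => g l j phi - regular_dist (dconv (g l j) (dilate (P 0) j)) phi)
    (fun j => 2 ^+ (N.-1 * j)).
  move=> n; have [c [c0 hc]] := b2 n; exists (2 * c); split; first by rewrite mulr_ge0.
  move=> J.
  pose b k := c * (q (J + k) * 2 ^+ (N * J)).
  apply: (Enb_lim hE (c := b) (T := fun k => regular_dist (dconv (g l J) (D (J + k)))) (hw.1 n)).
  - by move=> k; rewrite mulr_ge0// mulr_ge0.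
  - move=> K; rewrite /b -big_distrr/= -big_distrl/=.
    under eq_bigr do rewrite q_geom; rewrite -big_distrr/=.
    rewrite -mulrA mulrCA; apply: (@le_trans _ _ (q J * (c * (2 * 2 ^+ (N * J))))).
      rewrite ler_wpM2l// ler_wpM2l// ler_wpM2r//; exact: geom_le.
    rewrite [q J * _]mulrCA [q J * _]mulrCA mulrA [c * 2]mulrC.
    by rewrite ler_wpM2l// mulr_ge0.
  - move=> k; have := Enb_scale (q (J + k))%:C (hc (J, k)).
    rewrite normc_real ger0_norm// mulrCA; apply: Enb_deq => theta tt.
    have tl := ctest_laplacian (tdQ 0 (J + k)).
    have -> : D (J + k) = fun x => (q (J + k))%:C * laplacian (dilate (Q 0) (J + k)) x + 0.
      by rewrite DE; apply/funext => x; rewrite addr0.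
    rewrite (dconv_lin _ (dist_g l J) tl (@ctest0 R d r)) regular_dist_linl//.
    + rewrite (_ : dconv _ (fun=> 0) = fun=> 0) ?regular_dist0 ?addr0//.
      by apply/funext => x; rewrite /dconv dist0.
    + exact: L1loc_dconv (dist_g l J) tl.
    + exact: L1loc_dconv (dist_g l J) (@ctest0 R d r).
  - move=> theta /[dup] tt /test_funP[r' [r'0 tt']] e e0.
    have [j0 hj0] := dconv_approx (dist_g l J) (tP 0) r0 intP tt' e0.
    exists j0 => K jK; rewrite telescope//.
    by rewrite opprB addrA subrK; apply: hj0; rewrite (leq_trans jK)// leq_addl.
apply: (bounded_by_deq _ (fun j => lexx _) (bounded_byD (a0 N.-1) b1 b3)).
move=> j theta tt.
(* Both sides are the convolution of [f] with the two kernels, by associativity and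
   commutativity. *)
have -> : dconv (G j) (dilate (chi l) j) = dconv (g l j) (dilate (P 0) j).
  rewrite -(conv_regular (L1loc_dconv hf (tdP 0 j)) (csmooth_ccontinuous (tdchi l j).1) (tdchi l j).2).
  rewrite -(conv_regular (L1loc_dconv hf (tdchi l j)) (csmooth_ccontinuous (tdP 0 j).1) (tdP 0 j).2).
  rewrite (dconv_conv hf (tdP 0 j) (tdchi l j)) (dconv_conv hf (tdchi l j) (tdP 0 j)).
  by rewrite (conv_ctestC (tdP 0 j) (tdchi l j)).
by rewrite addrC subrK.
Qed.

(** Descent on the exponent. The successor keeps it at least 1, where [bootstrap_final] takes
    over. *)
Lemma bootstrap N : (forall l, bounded_by (g l) (fun j => 2 ^+ (N.+1 * j))) ->
  forall n, exists c, Enb n (w n) c f0.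
Proof.
elim: N => [|N ih] hg; first by apply: bootstrap_final => l; under eq_fun do rewrite -[X in _ ^+ X]mul1n; exact: hg.
exact/ih/(bootstrap_step (N := N.+2)).
Qed.

End bootstrap.

End bounded_families.

(** * Convolutions rescaled by 2^(-rj) *)

Section scaled_convolutions.
Context {R : realType} {d : nat}.
Local Notation Rd := 'rV[R]_d.
Local Notation C := R[i].
Variables (E : completeNormedModType C) (rep : E -> Rd -> C).
Hypothesis hE : TIBF rep.
Variables (f : @functional R d) (hf : is_distribution f).
Implicit Types (phi : Rd -> C) (w : Rd -> R) (j n : nat).

Lemma L1loc_dconv_dilate phi j : test_fun phi -> L1loc (dconv f (dilate phi j)).
Proof. by move=> /test_funP[r [r0 tp]]; apply: L1loc_dconv (ctest_dilate j (ltW r0) tp). Qed.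

Lemma scaled_conv_distribution a phi j : test_fun phi -> is_distribution (scaled_conv a f phi j).
Proof. by move=> tp; apply/regular_dist_distribution/L1locZ/L1loc_dconv_dilate. Qed.

Lemma scaled_convE a phi j theta : test_fun phi -> test_fun theta ->
  scaled_conv a f phi j theta =
  (2 `^ (- (a * j%:R)))%:C * regular_dist (dconv f (dilate phi j)) theta.
Proof.
move=> tp tt; rewrite -[RHS]addr0 -(regular_dist0 theta).
rewrite -regular_dist_linl//; [|exact: L1loc_dconv_dilate|exact: L1loc0].
by congr regular_dist; apply/funext => x; rewrite addr0.
Qed.

Lemma Enb_scaled_conv n w c a phi j : test_fun phi ->
  Enb rep n w c (scaled_conv a f phi j) <->
  Enb rep n w (2 `^ (a * j%:R) * c) (regular_dist (dconv f (dilate phi j))).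
Proof.
move=> tp; have q0 : 0 < 2 `^ (a * j%:R) :> R by rewrite powR_gt0.
split=> h.
  have := Enb_scale hE (2 `^ (a * j%:R))%:C h; rewrite normc_real ger0_norm ?ltW//.
  apply: Enb_deq => theta tt; rewrite scaled_convE// mulrA -rmorphM/= powRN mulfV ?gt_eqF//.
  by rewrite mul1r.
have := Enb_scale hE (2 `^ (- (a * j%:R)))%:C h.
rewrite normc_real ger0_norm ?powR_ge0// powRN mulKf ?gt_eqF//.
by apply: Enb_deq => theta tt; rewrite scaled_convE// powRN.
Qed.

(** A larger exponent only shrinks the functions, because j >= 0; the bound [c] is nonnegative since
    it dominates a norm. *)
Lemma Enb_scaled_conv_le n w c c' a b phi j : test_fun phi -> a <= b -> c <= c' ->
  Enb rep n w c (scaled_conv a f phi j) -> Enb rep n w c' (scaled_conv b f phi j).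
Proof.
move=> tp ab cc h; have c0 := Enb_ge0 h.
apply/(Enb_scaled_conv _ _ _ _ _ tp).
apply: (Enb_le (leqnn n) _ ((Enb_scaled_conv _ _ _ _ _ tp).1 h)).
rewrite ler_pM ?powR_ge0// ler_powR ?ler1n// ler_wpM2r//.
Qed.

End scaled_convolutions.

(** Lets a sum play the part of a maximum when one constant must serve both functions of the
    pair. *)
Lemma le_sum_ord2 (R : numDomainType) (F : 'I_2 -> R) l : (forall i, 0 <= F i) -> F l <= F 0 + F 1.
Proof.
move=> F0; have -> : F 0 + F 1 = \sum_i F i.
  by rewrite big_ord_recl big_ord1; congr (F _ + F _); apply: val_inj.
by rewrite (bigD1 l)//= lerDl sumr_ge0.
Qed.

Theorem theorem6p9 (R : realType) (d : nat) (hd : (0 < d)%N)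
    (E : completeNormedModType R[i]) (rep : E -> 'rV[R]_d -> R[i])
    (hE : TIBF rep) (hsolid : is_solid rep)
    (w : nat -> 'rV[R]_d -> R) (hw : weight_system w) (hwM : wM w)
    (chi : 'I_2 -> 'rV[R]_d -> R[i])
    (htest : forall l, test_fun (chi l)) (hchi : MDFP chi)
    (f : @functional R d) (hf : is_distribution f) :
  [<->
    Eoo rep w f;
    forall phi, test_fun phi ->
      Eoo_bounded rep w [set regular_dist (dconv f (dilate phi j)) | j in [set: nat]];
    forall phi, test_fun phi -> exists r : R, 0 < r /\
      Eoo_bounded rep w [set scaled_conv r f phi j | j in [set: nat]];
    exists r : R, 0 < r /\
      Eoo_bounded rep w
        [set scaled_conv r f (chi l) j | j in [set: nat] & l in [set: 'I_2]]].
Proof.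
have [K [cK [phi [psi [hpp /(_ 0%N)[PQ intP PE QE]]]]]] := hchi.
have [rK [rK0 Kr]] := compact_sub_cball cK.
have tK h : test_on K h -> ctest rK h.
  by move=> [sh hK]; split => // x rx; apply: hK => /Kr; rewrite /cball/= leNgt rx.
have /choice[rc hrc] : forall l, exists r : R, 0 < r /\ ctest r (chi l).
  by move=> l; apply/test_funP.
(* One radius for all six functions: the two [chi] and the four functions factored by the MDFP. *)
pose r := rK + (rc 0 + rc 1).
have rc0 l : 0 <= rc l by have [/ltW] := hrc l.
have r0 : 0 <= r by rewrite !addr_ge0// ltW.
have tP l : ctest r (phi l 0%N).
  by have [/tK + _ _ _] := hpp l 0%N; apply: ctest_le; rewrite lerDl addr_ge0.
have tQ l : ctest r (psi l 0%N).
  by have [_ [/tK + _] _ _] := hpp l 0%N; apply: ctest_le; rewrite lerDl addr_ge0.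
have tchi l : ctest r (chi l).
  apply: ctest_le (hrc l).2; rewrite /r -[leLHS]add0r lerD ?(ltW rK0)//.
  exact: le_sum_ord2.
(* phi^0 has integral 1 and is the mollifier on which the uniqueness of weighted derivatives
   rests. *)
have bP B := Eoo_boundedP hE (tP 0) r0 intP w B.
tfae.
- move=> fE phi0 /test_funP[r1 [r10 t1]]; apply/bP; split.
    by move=> _ [j _ <-]; apply/regular_dist_distribution/(L1loc_dconv hf)/(ctest_dilate j (ltW r10) t1).
  (* With [f] as a constant family of growth 1, the convolution estimate bounds f * phi_j uniformly
     in j. *)
  have bf : bounded_by rep w (fun _ : nat => f) (fun=> 1).
    move=> n; have [c hc] := En_Enb (fE n I).
    by exists c; split; [exact: Enb_ge0 hc|rewrite mulr1].
  have b := bounded_by_conv0 hE hsolid hw hwM id (fun=> hf) (fun=> ler01) (ltW r10) t1 bf.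
  by move=> n; have [c [_ hc]] := b n; exists (c * 1) => _ [j _ <-]; exact: hc.
(* Any positive exponent works, since 2^(-rj) <= 1. *)
- move=> h phi0 tp; exists 1; split => //; apply/bP; split.
    by move=> _ [j _ <-]; exact: scaled_conv_distribution.
  have /bP[_ hb] := h _ tp; move=> n; have [M hM] := hb n.
  exists M => _ [j _ <-]; apply/(Enb_scaled_conv hE hf _ _ _ _ _ tp).
  have hj := hM _ (ex_intro2 _ _ j I erefl); have M0 := Enb_ge0 hj.
  apply: (Enb_le (leqnn n) _ hj); rewrite ler_peMl//.
  by rewrite -[leLHS](powRr0 2) ler_powR ?ler1n// mul1r.
- move=> h; have /choice[a ha] := fun l => h _ (htest l).
  (* The exponents obtained for the two functions are added, so that one exponent covers both. *)
  exists (a 0 + a 1); split; first by rewrite addr_gt0//; [have [] := ha 0|have [] := ha 1].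
  have a0 l : 0 <= a l by have [/ltW] := ha l.
  have la l : a l <= a 0 + a 1 by exact: le_sum_ord2.
  apply/bP; split; first by move=> _ [j _ [l _ <-]]; exact: scaled_conv_distribution.
  move=> n.
  have /choice[M hM] : forall l, exists M, forall j, Enb rep n (w n) M (scaled_conv (a l) f (chi l) j).
    move=> l; have [_ /bP[_ /(_ n)[M hM]]] := ha l; exists M => j; apply: hM; by exists j.
  have M0 l : 0 <= M l by exact: Enb_ge0 (hM l 0%N).
  exists (M 0 + M 1) => _ [j _ [l _ <-]].
  apply: (Enb_scaled_conv_le hE hf (htest l) (la l) _ (hM l j)).
  exact: le_sum_ord2.
- move=> [a [a0 /bP[_ hB]]] n _; split => //.
  (* The bootstrap descends by units, so the real exponent is rounded up to the integer N + 1. *)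
  pose N := `|Num.ceil a|%N.
  have aN : a <= N.+1%:R.
    apply: (le_trans (Num.Theory.ceil_ge _)).
    apply: (@le_trans _ _ (N%:R)); last by rewrite ler_nat.
    by rewrite -[leRHS]/((N : int)%:~R) ler_int abszE ler_norm.
  have hg l : bounded_by rep w (fun j => regular_dist (dconv f (dilate (chi l) j)))
      (fun j => 2 ^+ (N.+1 * j)).
    move=> k; have [M hM] := hB k.
    have hj j : Enb rep k (w k) M (scaled_conv a f (chi l) j).
      by apply: hM; exists j => //; exists l.
    exists M; split; first exact: Enb_ge0 (hj 0%N).
    move=> j; apply: (Enb_le (leqnn k) _ ((Enb_scaled_conv hE hf _ _ _ _ _ (htest l)).1 (hj j))).
    rewrite mulrC ler_wpM2l//; first exact: Enb_ge0 (hj 0%N).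
    by rewrite -powR_mulrn// ler_powR ?ler1n// natrM ler_wpM2r.
  have [c hc] := bootstrap hE hsolid hw hwM hf r0 tP tQ tchi PQ intP PE QE hg n.
  by move=> alpha an; have [u [hu _]] := hc alpha an; exists u.
Qed.
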